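(* As $y\to0$ in the sector $|\arg(y)|<\pi/2$, one has the asymptotic expansion \begin{align*} \sum_{n=1}^{\infty}\frac{\log(n) }{e^{ny}-1}&\sim\frac{1}{2y}\log^{2}(y) + \frac{1}{y}\left(\frac{\pi^2}{12} - \frac{\gamma^2}{2} \right)-\frac{1}{4}\log(2\pi) +\frac{y}{12}\left(\log A - \frac{1}{12} \right) \\ &\quad +\sum_{k=2}^{\infty} \frac{B_{2k} y^{2k-1}}{k}\left\{\frac{B_{2k}}{2(2k)!}\left(\gamma - \sum_{j=1}^{2k-1}\frac{1}{j}+\log (2\pi)\right)+ \frac{(-1)^k \zeta'(2k)}{(2\pi)^{2k}}\right\}. \end{align*}
   Context: $\log$ is the principal branch of the logarithm, $\gamma$ is Euler's constant, $B_{m}$ are the Bernoulli numbers, $\zeta$ is the Riemann zeta function, and $A$ is the Glaisher–Kinkelin constant defined by $\log(A)=\lim_{n\to\infty}\left\{\sum_{k=1}^{n}k\log(k)-\left(\frac{n^2}{2}+\frac{n}{2}+\frac{1}{12}\right)\log(n)+\frac{n^2}{4}\right\}$. The symbol $\sim$ denotes an asymptotic (Poincaré-type) expansion: the difference between the left-hand side and the terms up to $y^{2N-1}$ is $O(|y|^{2N+1})$ as $y\to0$ in the sector, for each $N$. *)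

(* Defs.v *)
From Stdlib Require Import Reals Lra Lia Arith.
From Coquelicot Require Export Coquelicot.

Open Scope R_scope.

Definition Cexp (z : C) : C := (exp (Re z) * cos (Im z), exp (Re z) * sin (Im z)).

(* Principal argument, with values in (-PI, PI]; meaningful for z <> 0 only. *)
Definition Carg (z : C) : R :=
  if Rle_dec 0 (Im z) then acos (Re z / Cmod z) else - acos (Re z / Cmod z).

Definition Clog (z : C) : C := (ln (Cmod z), Carg z).

(* [CSeries] is meaningful only when the series of real and imaginary parts
   both converge. *)
Definition CSeries (a : nat -> C) : C :=
  (Series (fun n => Re (a n)), Series (fun n => Im (a n))).

Definition harmonic (n : nat) : R := sum_n_m (fun j => / INR j) 1 n.

Definition euler_gamma : R := real (Lim_seq (fun n => harmonic n - ln (INR n))).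

Definition glaisher : R :=
  exp (real (Lim_seq (fun n =>
    sum_n_m (fun k => INR k * ln (INR k)) 1 n
    - (INR n ^ 2 / 2 + INR n / 2 + 1 / 12) * ln (INR n)
    + INR n ^ 2 / 4))).

(* The Riemann zeta function on the half-line s > 1, which contains all the
   points 2k at which its derivative is needed. *)
Definition zeta (s : R) : R := Series (fun n => / Rpower (INR (S n)) s).

(* [bernoulli_table n j] is B_j for j <= n; its last entry comes from
   sum_(i <= n) C(n+1, i) B_i = 0, so that B_1 = -1/2. *)
Fixpoint bernoulli_table (n : nat) : nat -> R :=
  match n with
  | O => fun _ => 1
  | S m => fun j =>
      if (j <=? m)%nat then bernoulli_table m j
      else - / INR (S n) *
             sum_n (fun i => Binomial.C (S n) i * bernoulli_table m i) m
  end.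

Definition bernoulli (n : nat) : R := bernoulli_table n n.

Lemma bernoulli_table_le (n j : nat) :
  (j <= n)%nat -> bernoulli_table n j = bernoulli j.
Proof.
induction n as [|n IH]; intros Hj.
- now replace j with 0%nat by lia.
- destruct (Nat.eq_dec j (S n)) as [->|Hne]; [reflexivity|].
  simpl. replace (j <=? n)%nat with true by (symmetry; apply Nat.leb_le; lia).
  apply IH; lia.
Qed.

Lemma bernoulli_0 : bernoulli 0 = 1.
Proof. reflexivity. Qed.

Lemma bernoulli_rec (n : nat) :
  (0 < n)%nat -> sum_n (fun i => Binomial.C (S n) i * bernoulli i) n = 0.
Proof.
destruct n as [|m]; intros Hn; [lia|].
rewrite sum_Sn.
assert (E : bernoulli (S m) = - / INR (S (S m)) *
          sum_n (fun i => Binomial.C (S (S m)) i * bernoulli i) m).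
{ unfold bernoulli at 1. cbn [bernoulli_table].
  replace (S m <=? m)%nat with false by (symmetry; apply Nat.leb_gt; lia).
  f_equal. apply sum_n_ext_loc. intros k Hk.
  now rewrite bernoulli_table_le. }
rewrite E.
assert (HC : Binomial.C (S (S m)) (S m) = INR (S (S m))).
{ unfold Binomial.C.
  replace (S (S m) - S m)%nat with 1%nat by lia.
  rewrite (fact_simpl (S m)), mult_INR. simpl (fact 1).
  change (INR 1) with 1. field. apply INR_fact_neq_0. }
rewrite HC. unfold plus; simpl plus.
set (s := sum_n _ m).
assert (INR (S (S m)) <> 0) by (apply not_0_INR; lia).
change (s + INR (S (S m)) * (- / INR (S (S m)) * s) = 0).
field; assumption.
Qed.

Definition lambert_log_term (y : C) (n : nat) : C :=
  (RtoC (ln (INR n)) / (Cexp (RtoC (INR n) * y) - 1))%C.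

(* The sum over n >= 1, whence the index shift. *)
Definition lambert_log (y : C) : C :=
  CSeries (fun n => lambert_log_term y (S n)).

Definition lambert_log_coeff (k : nat) : R :=
  bernoulli (2 * k) / INR k *
  (bernoulli (2 * k) / (2 * INR (fact (2 * k))) *
     (euler_gamma - harmonic (2 * k - 1) + ln (2 * PI))
   + (-1) ^ k * Derive zeta (INR (2 * k)) / (2 * PI) ^ (2 * k)).

(* The terms of the expansion up to y^(2N-1), for N >= 1. *)
Definition lambert_log_expansion (N : nat) (y : C) : C :=
  (1 / (2 * y) * Clog y ^ 2
   + 1 / y * RtoC (PI ^ 2 / 12 - euler_gamma ^ 2 / 2)
   - RtoC (1 / 4 * ln (2 * PI))
   + y / 12 * RtoC (ln glaisher - 1 / 12)
   + sum_n_m (fun k => RtoC (lambert_log_coeff k) * y ^ (2 * k - 1)) 2 N)%C.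

(* Main.v *)
(** Put [q z = z / (e^z - 1)] and let [S] be the Lambert series. Then [y * S y] is the sum of
    [ln n * q (n y) / n], whose [y]-derivative is the sum of [ln n * q' (n y)]. Once a Taylor
    polynomial of [q] is split off, the rest [ln x * r' (x y)] decays with all its derivatives
    uniformly in a closed cone, so Euler-Maclaurin gives the expansion of the derivative there;
    the polynomial part contributes the Euler-Maclaurin constants of [n ^ k * ln n]. The cone is
    convex, so integrating along chords transfers the expansion to [y * S y] up to one constant.
    That constant is computed for real [y -> 0] by comparing [ln n] with harmonic numbers, whose
    generating function turns the double sum into [ln (1 - e^(-m y))] and finally into
    [gamma^2] and [zeta 2]. The constants of [n ^ k * ln n] are Stirling's for [k = 0] (Wallis),
    Glaisher's for [k = 1], and for odd [k >= 3] come from the Fourier series of the Bernoulli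
    polynomials: integrating it against [ln] gives cosine integrals, which produce [gamma],
    [ln (2 pi)] and [zeta' (k + 1)]. *)

Require Import Defs.
From Stdlib Require Import Reals Lra Lia Psatz Arith Factorial.
From Coquelicot Require Import Coquelicot.
Open Scope R_scope.

(** The passage to the derivative makes the Euler-Maclaurin antiderivative elementary. Integrating
    [ln x * q (x y) / x] in [x] leads to the integral of [log (1 - e^(-x y)) / x], whereas [ln x]
    times the [x]-derivative of [q (x y)] integrates by parts to
    [ln x * q (x y) - log (1 - e^(-x y))]. The [log y] hidden in the last logarithm becomes
    [log^2 y / 2] after division by [y] and integration. The price is an additive constant which no
    local expansion sees. Two regimes compete. The boundary term at infinity of the full summand
    vanishes only for [y] away from 0, while the errors of the remainder are [O(|y|^(M+1))]
    uniformly but do not vanish at infinity. So the number of terms is chosen after a lower bound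
    [r] on [|y|], and the final constants are free of [r]. Complex analysis is reduced to one real
    variable, along rays [x y] and chords; mean value inequalities replace contour integrals. *)

Lemma is_derive_Rplus (f g : R -> R) (x a b : R) :
  is_derive f x a -> is_derive g x b -> is_derive (fun t => f t + g t) x (a + b).
Proof. exact (is_derive_plus f g x a b). Qed.

Lemma is_derive_Rminus (f g : R -> R) (x a b : R) :
  is_derive f x a -> is_derive g x b -> is_derive (fun t => f t - g t) x (a - b).
Proof. exact (is_derive_minus f g x a b). Qed.

Lemma is_derive_Ropp (f : R -> R) (x a : R) :
  is_derive f x a -> is_derive (fun t => - f t) x (- a).
Proof. exact (is_derive_opp f x a). Qed.

Lemma is_derive_Rmult (f g : R -> R) (x a b : R) :
  is_derive f x a -> is_derive g x b ->
  is_derive (fun t => f t * g t) x (a * g x + f x * b).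
Proof.
intros Hf Hg. apply is_derive_Reals. apply is_derive_Reals in Hf, Hg.
exact (derivable_pt_lim_mult f g x a b Hf Hg).
Qed.

Lemma is_derive_Rdiv (f g : R -> R) (x a b : R) :
  is_derive f x a -> is_derive g x b -> g x <> 0 ->
  is_derive (fun t => f t / g t) x ((a * g x - b * f x) / (g x) ^ 2).
Proof.
intros Hf Hg H0. apply is_derive_Reals. apply is_derive_Reals in Hf, Hg.
replace (g x ^ 2) with (Rsqr (g x)) by (unfold Rsqr; ring).
exact (derivable_pt_lim_div f g x a b Hf Hg H0).
Qed.

Lemma is_derive_Rcomp (f g : R -> R) (x a b : R) :
  is_derive f (g x) a -> is_derive g x b -> is_derive (fun t => f (g t)) x (a * b).
Proof.
intros Hf Hg. apply is_derive_Reals. apply is_derive_Reals in Hf, Hg.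
exact (derivable_pt_lim_comp g f x b a Hg Hf).
Qed.

Lemma is_derive_eq (f : R -> R) (x a b : R) : is_derive f x a -> a = b -> is_derive f x b.
Proof. now intros H <-. Qed.

Lemma is_derive_Rsqr (f : R -> R) (x a : R) :
  is_derive f x a -> is_derive (fun t => f t ^ 2) x (2 * f x * a).
Proof.
intros Hf. eapply is_derive_eq.
- exact (is_derive_pow f 2 x a Hf).
- simpl; ring.
Qed.

Lemma MVT_bound (f df : R -> R) (a b B : R) :
  a <= b -> (forall t, a <= t <= b -> is_derive f t (df t)) ->
  (forall t, a <= t <= b -> Rabs (df t) <= B) ->
  Rabs (f b - f a) <= B * (b - a).
Proof.
intros Hab Hd HB.
destruct (MVT_gen f a b df) as (c & Hc & E).
- rewrite Rmin_left, Rmax_right by lra. intros; apply Hd; lra.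
- rewrite Rmin_left, Rmax_right by lra. intros x Hx.
  apply continuity_pt_filterlim.
  apply (ex_derive_continuous f x). exists (df x). apply Hd; lra.
- rewrite Rmin_left, Rmax_right in Hc by lra.
  rewrite E, Rabs_mult, (Rabs_pos_eq (b - a)) by lra.
  apply Rmult_le_compat_r; [lra | apply HB; lra].
Qed.

(** * Calculus of complex-valued functions of a real variable *)

(** Componentwise, so that the real derivative rules and the real mean value theorem apply
    directly. *)
Definition Cderiv (F : R -> C) (x : R) (l : C) : Prop :=
  is_derive (fun t => fst (F t)) x (fst l) /\ is_derive (fun t => snd (F t)) x (snd l).

Lemma C_ext (z w : C) : fst z = fst w -> snd z = snd w -> z = w.
Proof. destruct z, w; simpl; now intros -> ->. Qed.

Lemma Cderiv_eq (F : R -> C) (x : R) (l l' : C) : Cderiv F x l -> l = l' -> Cderiv F x l'.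
Proof. now intros H <-. Qed.

Lemma Cderiv_ext_loc (F G : R -> C) (x : R) (l : C) :
  locally x (fun t => F t = G t) -> Cderiv F x l -> Cderiv G x l.
Proof.
intros E [H1 H2]; split.
- refine (is_derive_ext_loc _ _ _ _ _ H1).
  revert E; apply filter_imp; now intros t ->.
- refine (is_derive_ext_loc _ _ _ _ _ H2).
  revert E; apply filter_imp; now intros t ->.
Qed.

Lemma Cderiv_ext (F G : R -> C) (x : R) (l : C) :
  (forall t, F t = G t) -> Cderiv F x l -> Cderiv G x l.
Proof. intros E; apply Cderiv_ext_loc; now apply filter_forall. Qed.

Lemma locally_gt (a x : R) : a < x -> locally x (fun t => a < t).
Proof. exact (open_gt a x). Qed.

Lemma Cderiv_ext_pos (F G : R -> C) (x : R) (l : C) :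
  0 < x -> (forall t, 0 < t -> F t = G t) -> Cderiv F x l -> Cderiv G x l.
Proof.
intros Hx E; apply Cderiv_ext_loc.
generalize (locally_gt 0 x Hx); apply filter_imp; exact E.
Qed.

Lemma Cderiv_unique (F : R -> C) (x : R) (l l' : C) :
  Cderiv F x l -> Cderiv F x l' -> l = l'.
Proof.
intros [H1 H2] [H1' H2']; apply C_ext.
- now rewrite <- (is_derive_unique _ _ _ H1), <- (is_derive_unique _ _ _ H1').
- now rewrite <- (is_derive_unique _ _ _ H2), <- (is_derive_unique _ _ _ H2').
Qed.

Lemma Cderiv_const (c : C) (x : R) : Cderiv (fun _ => c) x (RtoC 0).
Proof. split; exact (is_derive_const _ x). Qed.

Lemma Cderiv_RtoC (f : R -> R) (x a : R) :
  is_derive f x a -> Cderiv (fun t => RtoC (f t)) x (RtoC a).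
Proof. split; [exact H | exact (is_derive_const _ x)]. Qed.

Lemma Cderiv_id (x : R) : Cderiv RtoC x (RtoC 1).
Proof. apply (Cderiv_RtoC (fun t => t)). exact (is_derive_id x). Qed.

Lemma Cderiv_plus (F G : R -> C) (x : R) (a b : C) :
  Cderiv F x a -> Cderiv G x b -> Cderiv (fun t => F t + G t)%C x (a + b)%C.
Proof. intros [] []; split; apply is_derive_Rplus; assumption. Qed.

Lemma Cderiv_opp (F : R -> C) (x : R) (a : C) :
  Cderiv F x a -> Cderiv (fun t => - F t)%C x (- a)%C.
Proof. intros []; split; apply is_derive_Ropp; assumption. Qed.

Lemma Cderiv_minus (F G : R -> C) (x : R) (a b : C) :
  Cderiv F x a -> Cderiv G x b -> Cderiv (fun t => F t - G t)%C x (a - b)%C.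
Proof. intros; apply Cderiv_plus; [|apply Cderiv_opp]; assumption. Qed.

Lemma Cderiv_mult (F G : R -> C) (x : R) (a b : C) :
  Cderiv F x a -> Cderiv G x b ->
  Cderiv (fun t => F t * G t)%C x (a * G x + F x * b)%C.
Proof.
intros [F1 F2] [G1 G2]; split; simpl.
- eapply is_derive_eq.
  + apply is_derive_Rminus; apply is_derive_Rmult; eassumption.
  + simpl; ring.
- eapply is_derive_eq.
  + apply is_derive_Rplus; apply is_derive_Rmult; eassumption.
  + simpl; ring.
Qed.

Lemma Cderiv_scal (F : R -> C) (x : R) (c a : C) :
  Cderiv F x a -> Cderiv (fun t => c * F t)%C x (c * a)%C.
Proof.
intros H. eapply Cderiv_eq; [exact (Cderiv_mult _ _ _ _ _ (Cderiv_const c x) H)|].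
simpl; ring.
Qed.

Lemma Cmod2_pos (z : C) : z <> RtoC 0 -> 0 < fst z ^ 2 + snd z ^ 2.
Proof.
intros Hz. destruct (Rlt_le_dec 0 (fst z ^ 2 + snd z ^ 2)) as [H|H]; [exact H|].
exfalso; apply Hz; apply C_ext; simpl; nra.
Qed.

Lemma Cderiv_inv (F : R -> C) (x : R) (a : C) :
  F x <> RtoC 0 -> Cderiv F x a ->
  Cderiv (fun t => / F t)%C x (- a / (F x * F x))%C.
Proof.
intros H0 [F1 F2].
assert (Hp := Cmod2_pos _ H0).
assert (Hd : is_derive (fun t => fst (F t) ^ 2 + snd (F t) ^ 2) x
   (2 * fst (F x) * fst a + 2 * snd (F x) * snd a)).
{ apply is_derive_Rplus; apply is_derive_Rsqr; assumption. }
assert (E : (- a / (F x * F x) = - (a * / F x * / F x))%C) by (field; exact H0).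
split.
- eapply is_derive_eq.
  + apply (is_derive_Rdiv (fun t => fst (F t)) _ x _ _ F1 Hd); lra.
  + rewrite E. cbn [fst snd Cmult Copp Cinv]. field. lra.
- eapply is_derive_eq.
  + apply (is_derive_Rdiv (fun t => - snd (F t)) _ x _ _ (is_derive_Ropp _ _ _ F2) Hd); lra.
  + rewrite E. cbn [fst snd Cmult Copp Cinv]. field. lra.
Qed.

Lemma Cderiv_exp (F : R -> C) (x : R) (a : C) :
  Cderiv F x a -> Cderiv (fun t => Cexp (F t)) x (a * Cexp (F x))%C.
Proof.
intros [F1 F2].
assert (He := is_derive_Rcomp exp _ x _ _ (is_derive_exp _) F1).
assert (Hc := is_derive_Rcomp cos _ x _ _ (is_derive_cos _) F2).
assert (Hs := is_derive_Rcomp sin _ x _ _ (is_derive_sin _) F2).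
split; (eapply is_derive_eq; [apply is_derive_Rmult; [exact He | eassumption]|]);
  unfold Cexp, Re, Im; cbn [fst snd Cmult]; ring.
Qed.

Lemma Rabs_fst_le_Cmod (z : C) : Rabs (fst z) <= Cmod z.
Proof. apply Rle_trans with (2 := Rmax_Cmod z), Rmax_l. Qed.

Lemma Rabs_snd_le_Cmod (z : C) : Rabs (snd z) <= Cmod z.
Proof. apply Rle_trans with (2 := Rmax_Cmod z), Rmax_r. Qed.

Lemma Cmod_le_plus (z : C) : Cmod z <= Rabs (fst z) + Rabs (snd z).
Proof.
replace z with (RtoC (fst z) + Ci * RtoC (snd z))%C at 1.
2: apply C_ext; simpl; ring.
eapply Rle_trans; [apply Cmod_triangle|].
rewrite Cmod_mult, Cmod_Ci, !Cmod_R. lra.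
Qed.

(** The mean value theorem fails for complex values, so each component is estimated by the real one;
    the factor 2 comes from [Cmod_le_plus]. *)
Lemma Cderiv_MVT (F dF : R -> C) (a b B : R) :
  a <= b -> (forall t, a <= t <= b -> Cderiv F t (dF t)) ->
  (forall t, a <= t <= b -> Cmod (dF t) <= B) ->
  Cmod (F b - F a)%C <= 2 * B * (b - a).
Proof.
intros Hab Hd HB.
eapply Rle_trans; [apply Cmod_le_plus|].
assert (H1 : Rabs (fst (F b) - fst (F a)) <= B * (b - a)).
{ apply (MVT_bound (fun t => fst (F t)) (fun t => fst (dF t))); [exact Hab| |].
  - intros t Ht; apply (Hd t Ht).
  - intros t Ht; eapply Rle_trans; [apply Rabs_fst_le_Cmod | apply HB, Ht]. }
assert (H2 : Rabs (snd (F b) - snd (F a)) <= B * (b - a)).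
{ apply (MVT_bound (fun t => snd (F t)) (fun t => snd (dF t))); [exact Hab| |].
  - intros t Ht; apply (Hd t Ht).
  - intros t Ht; eapply Rle_trans; [apply Rabs_snd_le_Cmod | apply HB, Ht]. }
cbn [fst snd Cminus Cplus Copp]. unfold Rminus in *. lra.
Qed.

(** * The exponential and the principal logarithm *)

Lemma Cexp_plus (z w : C) : Cexp (z + w) = (Cexp z * Cexp w)%C.
Proof.
unfold Cexp, Re, Im; apply C_ext; simpl; rewrite exp_plus, ?cos_plus, ?sin_plus; ring.
Qed.

Lemma Cexp_0 : Cexp 0 = 1.
Proof. unfold Cexp, Re, Im; apply C_ext; simpl; rewrite exp_0, ?cos_0, ?sin_0; ring. Qed.

Lemma Cmod_eq_of_sqr (z : C) (r : R) : 0 <= r -> fst z ^ 2 + snd z ^ 2 = r ^ 2 -> Cmod z = r.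
Proof.
intros Hr E. unfold Cmod. rewrite E. replace (r ^ 2) with (r * r) by ring.
now apply sqrt_square.
Qed.

Lemma Cmod_Cexp (z : C) : Cmod (Cexp z) = exp (fst z).
Proof.
apply Cmod_eq_of_sqr; [left; apply exp_pos|].
unfold Cexp, Re, Im; cbn [fst snd].
replace ((exp (fst z) * cos (snd z)) ^ 2 + (exp (fst z) * sin (snd z)) ^ 2)
  with ((exp (fst z)) ^ 2 * (Rsqr (sin (snd z)) + Rsqr (cos (snd z)))) by (unfold Rsqr; ring).
rewrite sin2_cos2; ring.
Qed.

Lemma Cexp_RtoC (x : R) : Cexp (RtoC x) = RtoC (exp x).
Proof. unfold Cexp, Re, Im; apply C_ext; simpl; rewrite ?cos_0, ?sin_0; ring. Qed.

Lemma Cmod_sqr (z : C) : Cmod z ^ 2 = fst z ^ 2 + snd z ^ 2.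
Proof.
unfold Cmod. rewrite <- (Rsqr_pow2 (sqrt _)), Rsqr_sqrt; [reflexivity|nra].
Qed.

(** With [t] the arctangent, [cos t * Cmod z] and [fst z] are both positive and have the same
    square. So the arccosine in [Carg] is that of [cos t], and the sign test on the imaginary part
    selects [t] itself. Unlike the arccosine, this form can be differentiated across the real
    axis. *)
Lemma Carg_atan (z : C) : 0 < fst z -> Carg z = atan (snd z / fst z).
Proof.
intros Hz.
assert (Hm : 0 < Cmod z).
{ apply Cmod_gt_0. intros ->. simpl in Hz; lra. }
set (t := atan (snd z / fst z)).
assert (Ht := atan_bound (snd z / fst z)). fold t in Ht.
assert (Hc : 0 < cos t) by (apply cos_gt_0; lra).
assert (Htan : tan t = snd z / fst z) by apply tan_atan.
assert (E : Re z / Cmod z = cos t).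
{ assert (Hs : sin t = cos t * (snd z / fst z)).
  { rewrite <- Htan. unfold tan. field. lra. }
  assert (H1 : (cos t * Cmod z) ^ 2 = fst z ^ 2).
  { rewrite Rpow_mult_distr, Cmod_sqr.
    assert (H2 := sin2_cos2 t). unfold Rsqr in H2.
    rewrite Hs in H2.
    assert (H3 : cos t ^ 2 * (fst z ^ 2 + snd z ^ 2) =
       fst z ^ 2 * (cos t * (snd z / fst z) * (cos t * (snd z / fst z)) + cos t * cos t)).
    { field. lra. }
    rewrite H3, H2. ring. }
  assert (H4 : cos t * Cmod z = fst z).
  { rewrite <- !Rsqr_pow2 in H1. apply Rsqr_inj; [|lra|exact H1].
    apply Rmult_le_pos; lra. }
  unfold Re. rewrite <- H4. field. lra. }
unfold Carg. rewrite E.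
destruct (Rle_dec 0 (Im z)) as [Hi|Hi]; unfold Im in Hi.
- apply acos_cos. split; [|lra].
  unfold t. rewrite <- atan_0.
  destruct (Req_dec (snd z) 0) as [->|Hn].
  + replace (0 / fst z) with 0 by (field; lra). lra.
  + left; apply atan_increasing. apply Rdiv_lt_0_compat; lra.
- rewrite <- (cos_neg t), acos_cos; [ring|]. split; [|lra].
  assert (t < 0); [|lra].
  unfold t. rewrite <- atan_0. apply atan_increasing.
  replace (snd z / fst z) with (- ((- snd z) / fst z)) by (field; lra).
  assert (0 < - snd z / fst z); [apply Rdiv_lt_0_compat; lra | lra].
Qed.

Lemma ln_Cmod (z : C) : 0 < fst z -> ln (Cmod z) = ln (fst z ^ 2 + snd z ^ 2) / 2.
Proof.
intros Hz.
assert (Hm : 0 < Cmod z).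
{ apply Cmod_gt_0. intros ->. simpl in Hz; lra. }
rewrite <- Cmod_sqr. replace (Cmod z ^ 2) with (Cmod z * Cmod z) by ring.
rewrite ln_mult by lra. lra.
Qed.

Lemma Clog_right (z : C) : 0 < fst z ->
  Clog z = (ln (fst z ^ 2 + snd z ^ 2) / 2, atan (snd z / fst z)).
Proof. intros Hz. unfold Clog. now rewrite ln_Cmod, Carg_atan. Qed.

Lemma Cderiv_log (F : R -> C) (x : R) (a : C) :
  0 < fst (F x) -> Cderiv F x a -> Cderiv (fun t => Clog (F t)) x (a / F x)%C.
Proof.
intros Hx [F1 F2].
assert (H0 : F x <> RtoC 0) by (intros E; rewrite E in Hx; simpl in Hx; lra).
assert (Hp := Cmod2_pos _ H0).
assert (Hloc : locally x (fun t => 0 < fst (F t))).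
{ assert (Hc : continuous (fun t => fst (F t)) x).
  { apply (ex_derive_continuous (fun t => fst (F t))). eexists; exact F1. }
  apply (Hc (fun u => 0 < u)). now apply locally_gt. }
apply (Cderiv_ext_loc (fun t => (ln (fst (F t) ^ 2 + snd (F t) ^ 2) / 2,
  atan (snd (F t) / fst (F t))))).
{ revert Hloc; apply filter_imp; intros t Ht; symmetry; now apply Clog_right. }
assert (Hd : is_derive (fun t => fst (F t) ^ 2 + snd (F t) ^ 2) x
   (2 * fst (F x) * fst a + 2 * snd (F x) * snd a)).
{ apply is_derive_Rplus; apply is_derive_Rsqr; assumption. }
split; cbn [fst snd].
- eapply is_derive_eq.
  + apply (is_derive_Rdiv _ (fun _ => 2)).
    * apply (is_derive_Rcomp ln); [apply is_derive_ln; exact Hp | exact Hd].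
    * exact (is_derive_const 2 x).
    * lra.
  + unfold Cdiv. cbn [fst snd Cmult Cinv]. change (@zero R_NormedModule) with 0. field. lra.
- eapply is_derive_eq.
  + apply (is_derive_Rcomp atan); [apply is_derive_atan|].
    apply is_derive_Rdiv; [exact F2 | exact F1 | lra].
  + unfold Cdiv. cbn [fst snd Cmult Cinv]. unfold Rsqr. field. nra.
Qed.

Lemma Clog_RtoC (x : R) : 0 < x -> Clog (RtoC x) = RtoC (ln x).
Proof.
intros Hx. rewrite Clog_right by exact Hx. apply C_ext; simpl.
- replace (x * (x * 1) + 0 * (0 * 1)) with (x * x) by ring. rewrite ln_mult by lra. lra.
- replace (0 / x) with 0 by (field; lra). apply atan_0.
Qed.

Lemma Clog_scal (x : R) (z : C) : 0 < x -> 0 < fst z ->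
  Clog (RtoC x * z) = (RtoC (ln x) + Clog z)%C.
Proof.
intros Hx Hz.
assert (E1 : fst (RtoC x * z)%C = x * fst z) by (simpl; ring).
assert (E2 : snd (RtoC x * z)%C = x * snd z) by (simpl; ring).
rewrite !Clog_right; [|exact Hz|rewrite E1; now apply Rmult_lt_0_compat].
rewrite E1, E2. apply C_ext; cbn [fst snd Cplus RtoC].
- replace ((x * fst z) ^ 2 + (x * snd z) ^ 2)
    with (x * x * (fst z ^ 2 + snd z ^ 2)) by ring.
  rewrite !ln_mult; try nra.
- rewrite Rplus_0_l. f_equal. field. split; lra.
Qed.

(** * Finite sums and Bernoulli numbers *)

(* Both sums run over [i < n]. *)
Fixpoint csum (f : nat -> C) (n : nat) : C :=
  match n with O => RtoC 0 | S m => (csum f m + f m)%C end.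

Fixpoint rsum (f : nat -> R) (n : nat) : R :=
  match n with O => 0 | S m => rsum f m + f m end.

Lemma csum_S (f : nat -> C) (n : nat) : csum f (S n) = (csum f n + f n)%C.
Proof. reflexivity. Qed.

Lemma rsum_S (f : nat -> R) (n : nat) : rsum f (S n) = rsum f n + f n.
Proof. reflexivity. Qed.

Lemma csum_ext (f g : nat -> C) (n : nat) :
  (forall i, (i < n)%nat -> f i = g i) -> csum f n = csum g n.
Proof.
induction n as [|n IH]; intros H; simpl; [reflexivity|].
rewrite IH, H; [reflexivity | lia | intros; apply H; lia].
Qed.

Lemma rsum_ext (f g : nat -> R) (n : nat) :
  (forall i, (i < n)%nat -> f i = g i) -> rsum f n = rsum g n.
Proof.
induction n as [|n IH]; intros H; simpl; [reflexivity|].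
rewrite IH, H; [reflexivity | lia | intros; apply H; lia].
Qed.

Lemma csum_plus (f g : nat -> C) (n : nat) :
  csum (fun i => f i + g i)%C n = (csum f n + csum g n)%C.
Proof. induction n as [|n IH]; simpl; [ring | rewrite IH; ring]. Qed.

Lemma csum_minus (f g : nat -> C) (n : nat) :
  csum (fun i => f i - g i)%C n = (csum f n - csum g n)%C.
Proof. induction n as [|n IH]; simpl; [ring | rewrite IH; ring]. Qed.

Lemma csum_scal (c : C) (f : nat -> C) (n : nat) :
  csum (fun i => c * f i)%C n = (c * csum f n)%C.
Proof. induction n as [|n IH]; simpl; [ring | rewrite IH; ring]. Qed.

Lemma rsum_minus (f g : nat -> R) (n : nat) :
  rsum (fun i => f i - g i) n = rsum f n - rsum g n.
Proof. induction n as [|n IH]; simpl; [ring | rewrite IH; ring]. Qed.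

Lemma rsum_scal (c : R) (f : nat -> R) (n : nat) :
  rsum (fun i => c * f i) n = c * rsum f n.
Proof. induction n as [|n IH]; simpl; [ring | rewrite IH; ring]. Qed.

Lemma rsum_le (f g : nat -> R) (n : nat) :
  (forall i, (i < n)%nat -> f i <= g i) -> rsum f n <= rsum g n.
Proof.
induction n as [|n IH]; intros H; simpl; [lra|].
apply Rplus_le_compat; [apply IH; intros; apply H; lia | apply H; lia].
Qed.

Lemma rsum_0 (f : nat -> R) (n : nat) : (forall i, (i < n)%nat -> f i = 0) -> rsum f n = 0.
Proof.
induction n as [|n IH]; intros H; simpl; [reflexivity|].
rewrite IH, H; [ring | lia | intros; apply H; lia].
Qed.

Lemma rsum_pos (f : nat -> R) (n : nat) :
  (forall i, (i < n)%nat -> 0 <= f i) -> 0 <= rsum f n.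
Proof.
intros H. rewrite <- (rsum_0 (fun _ => 0) n) by reflexivity. now apply rsum_le.
Qed.

Lemma rsum_telescope (f : nat -> R) (n : nat) :
  rsum (fun i => f (S i) - f i) n = f n - f O.
Proof. induction n as [|n IH]; simpl; [ring | rewrite IH; ring]. Qed.

Lemma csum_telescope (f : nat -> C) (n : nat) :
  csum (fun i => f (S i) - f i)%C n = (f n - f O)%C.
Proof. induction n as [|n IH]; simpl; [ring | rewrite IH; ring]. Qed.

Lemma Rabs_rsum (f : nat -> R) (n : nat) : Rabs (rsum f n) <= rsum (fun i => Rabs (f i)) n.
Proof.
induction n as [|n IH]; simpl; [rewrite Rabs_R0; lra|].
eapply Rle_trans; [apply Rabs_triang|]. lra.
Qed.

Lemma Cmod_csum (f : nat -> C) (n : nat) : Cmod (csum f n) <= rsum (fun i => Cmod (f i)) n.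
Proof.
induction n as [|n IH]; simpl; [rewrite Cmod_0; lra|].
eapply Rle_trans; [apply Cmod_triangle|]. lra.
Qed.

Lemma csum_RtoC (f : nat -> R) (n : nat) : csum (fun i => RtoC (f i)) n = RtoC (rsum f n).
Proof. induction n as [|n IH]; simpl; [reflexivity | now rewrite IH, RtoC_plus]. Qed.

Lemma csum_shift (f : nat -> C) (n : nat) :
  csum f (S n) = (f O + csum (fun i => f (S i)) n)%C.
Proof. induction n as [|n IH]; [simpl; ring|]. simpl in *. rewrite IH. ring. Qed.

Lemma rsum_shift (f : nat -> R) (n : nat) :
  rsum f (S n) = f O + rsum (fun i => f (S i)) n.
Proof. induction n as [|n IH]; [simpl; ring|]. simpl in *. rewrite IH. ring. Qed.

Lemma Cderiv_csum (F : nat -> R -> C) (dF : nat -> C) (x : R) (n : nat) :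
  (forall i, (i < n)%nat -> Cderiv (F i) x (dF i)) ->
  Cderiv (fun t => csum (fun i => F i t) n) x (csum dF n).
Proof.
induction n as [|n IH]; intros H; simpl; [apply Cderiv_const|].
apply Cderiv_plus; [apply IH; intros; apply H; lia | apply H; lia].
Qed.

Lemma is_derive_rsum (F : nat -> R -> R) (dF : nat -> R) (x : R) (n : nat) :
  (forall i, (i < n)%nat -> is_derive (F i) x (dF i)) ->
  is_derive (fun t => rsum (fun i => F i t) n) x (rsum dF n).
Proof.
induction n as [|n IH]; intros H; simpl; [exact (is_derive_const 0 x)|].
apply is_derive_Rplus; [apply IH; intros; apply H; lia | apply H; lia].
Qed.

Lemma sum_n_rsum (f : nat -> R) (n : nat) : sum_n f n = rsum f (S n).
Proof.
induction n as [|n IH].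
- rewrite sum_O. simpl; ring.
- rewrite sum_Sn, IH. reflexivity.
Qed.

Lemma sum_n_m_rsum (f : nat -> R) (n : nat) : sum_n_m f 1 n = rsum (fun i => f (S i)) n.
Proof.
induction n as [|n IH].
- now rewrite sum_n_m_zero by lia.
- rewrite sum_n_Sm, IH by lia. reflexivity.
Qed.

(** The Taylor coefficient of [z / (e^z - 1)], and the weight of order [i] in Euler-Maclaurin
    summation. *)
Definition bern_fact (i : nat) : R := bernoulli i / INR (fact i).

Lemma bern_fact_rec (p : nat) : (1 <= p)%nat ->
  rsum (fun i => bern_fact i / INR (fact (S p - i))) (S p) = 0.
Proof.
intros Hp. assert (H := bernoulli_rec p Hp).
rewrite sum_n_rsum in H.
apply (Rmult_eq_reg_l (INR (fact (S p)))); [|apply INR_fact_neq_0].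
rewrite Rmult_0_r, <- H, <- rsum_scal. apply rsum_ext; intros i Hi.
unfold bern_fact, Binomial.C. field. split; apply INR_fact_neq_0.
Qed.

(* The recurrence of the Bernoulli numbers, in the form in which it inverts [exp D - 1]:
   with [u i = D^i F] the left-hand side is [D (F (x + 1) - F x)] up to order [p]. *)
Lemma bern_fact_inverse (u : nat -> C) (p : nat) : (1 <= p)%nat ->
  csum (fun i => RtoC (bern_fact i) *
    csum (fun l => u (i + S l)%nat / RtoC (INR (fact (S l)))) (p - i))%C (S p) = u 1%nat.
Proof.
induction p as [|p IH]; intros Hp; [lia|].
destruct (Nat.eq_dec p 0) as [->|Hne].
- simpl. unfold bern_fact; simpl. rewrite bernoulli_0. replace (1 / 1) with 1 by field.
  field.
(* Raising the order by one adds a single multiple of [u (S p)] to each inner sum; their total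
   weight vanishes by [bern_fact_rec]. *)
- rewrite <- IH by lia.
  rewrite (csum_S _ (S p)), Nat.sub_diag.
  change (csum _ 0) with (RtoC 0). rewrite Cmult_0_r, Cplus_0_r.
  rewrite (csum_ext _ (fun i => RtoC (bern_fact i) *
    csum (fun l => u (i + S l)%nat / RtoC (INR (fact (S l)))) (p - i) +
    u (S p) * RtoC (bern_fact i / INR (fact (S p - i))))%C).
  + rewrite csum_plus, csum_scal, csum_RtoC. rewrite bern_fact_rec by lia. ring.
  + intros i Hi. replace (S p - i)%nat with (S (p - i)) by lia. rewrite csum_S.
    replace (i + S (p - i))%nat with (S p) by lia.
    rewrite RtoC_div by apply INR_fact_neq_0. unfold Cdiv. ring.
Qed.

(** * Euler-Maclaurin summation *)

Lemma Cderiv_monomial (a t : R) (l : nat) :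
  Cderiv (fun t => RtoC ((t - a) ^ S l / INR (fact (S l)))) t (RtoC ((t - a) ^ l / INR (fact l))).
Proof.
apply Cderiv_RtoC. auto_derive; [trivial|].
change (match l with 0%nat => 1 | S _ => INR l + 1 end) with (INR (S l)).
change (fact l + l * fact l)%nat with (fact (S l)).
rewrite fact_simpl, mult_INR. unfold Rminus. field.
split; [apply INR_fact_neq_0 | apply not_0_INR; lia].
Qed.

(** The remainder vanishes at [x] and its derivative is the remainder of the shifted chain, so the
    induction costs one [Cderiv_MVT] per order. Hence [2 ^ m]; the usual [1 / m!] is given up, as
    only a constant depending on the order matters. *)
Lemma taylor_bound (m : nat) (F : nat -> R -> C) (x B : R) :
  (forall l t, (l < m)%nat -> x <= t <= x + 1 -> Cderiv (F l) t (F (S l) t)) ->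
  (forall t, x <= t <= x + 1 -> Cmod (F m t) <= B) ->
  forall t, x <= t <= x + 1 ->
  Cmod (F O t - csum (fun l => F l x * RtoC ((t - x) ^ l / INR (fact l))) m)%C <= 2 ^ m * B.
Proof.
revert F; induction m as [|m IH]; intros F Hd HB t Ht.
- simpl. replace (F O t - 0)%C with (F O t) by ring. rewrite Rmult_1_l. now apply HB.
- assert (H0 : (F O x - csum (fun l => F l x * RtoC ((x - x) ^ l / INR (fact l))) (S m))%C
     = RtoC 0).
  { rewrite csum_shift, (csum_ext _ (fun _ => RtoC 0 * RtoC 0)%C).
    - rewrite csum_scal. simpl. replace (1 / 1) with 1 by field. ring.
    - intros i _. rewrite Rminus_diag, pow_i by lia. unfold Rdiv. rewrite Rmult_0_l. ring. }
  assert (HM := Cderiv_MVT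
    (fun s => F O s - csum (fun l => F l x * RtoC ((s - x) ^ l / INR (fact l))) (S m))%C
    (fun s => F 1%nat s - csum (fun l => F (S l) x * RtoC ((s - x) ^ l / INR (fact l))) m)%C
    x t (2 ^ m * B)).
  cbv beta in HM. rewrite H0 in HM.
  match type of HM with _ -> _ -> _ -> Cmod (?a - _)%C <= _ =>
    replace (a - 0)%C with a in HM by ring end.
  eapply Rle_trans; [apply HM|].
  + lra.
  + intros s Hs. apply Cderiv_minus; [apply Hd; [lia|lra]|].
    apply (Cderiv_ext (fun s => F O x +
      csum (fun l => F (S l) x * RtoC ((s - x) ^ S l / INR (fact (S l)))) m)%C).
    * intros r. rewrite csum_shift. simpl. replace (1 / 1) with 1 by field. ring.
    * eapply Cderiv_eq.
      -- apply Cderiv_plus; [apply Cderiv_const|].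
         apply Cderiv_csum. intros l _. apply Cderiv_scal, Cderiv_monomial.
      -- ring.
  + intros s Hs. apply (IH (fun l => F (S l))); [|exact HB|lra].
    intros l r Hl Hr. apply Hd; [lia|lra].
  + assert (0 <= 2 ^ m * B).
    { eapply Rle_trans; [apply Cmod_ge_0|].
      apply (IH (fun l => F (S l))) with (t := x); [|exact HB|lra].
      intros l r Hl Hr. apply Hd; [lia|lra]. }
    change (2 ^ S m) with (2 * 2 ^ m).
    replace (2 * 2 ^ m * B) with (2 * (2 ^ m * B) * 1) by ring.
    apply Rmult_le_compat_l; lra.
Qed.

(* [u 0] is an antiderivative of the summand [u 1]. *)
Definition euler_maclaurin (p : nat) (u : nat -> C) : C :=
  csum (fun i => RtoC (bern_fact i) * u i)%C (S p).

(** Collects the factors of [taylor_bound]: the entry [u i] is expanded to order [S p - i], so that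
    every remainder involves the same derivative [u (S p)]. *)
Definition em_const (p : nat) : R := rsum (fun i => Rabs (bern_fact i) * 2 ^ (S p - i)) (S p).

Lemma em_const_pos (p : nat) : 0 <= em_const p.
Proof.
apply rsum_pos; intros i _. apply Rmult_le_pos; [apply Rabs_pos | apply pow_le; lra].
Qed.

(** Each [u i] at [x + 1] is replaced by its Taylor polynomial at [x]. By [bern_fact_inverse] these
    polynomials combine to exactly [u 1 x], and only Taylor remainders are left. Telescoping over
    unit steps gives the summation formula. *)
Lemma euler_maclaurin_step (p : nat) (u : nat -> R -> C) (x B : R) : (1 <= p)%nat ->
  (forall i t, (i <= p)%nat -> x <= t <= x + 1 -> Cderiv (u i) t (u (S i) t)) ->
  (forall t, x <= t <= x + 1 -> Cmod (u (S p) t) <= B) ->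
  Cmod (euler_maclaurin p (fun i => u i (x + 1)%R) - euler_maclaurin p (fun i => u i x)
        - u 1%nat x)%C <= em_const p * B.
Proof.
intros Hp Hd HB.
rewrite <- (bern_fact_inverse (fun i => u i x) p Hp).
unfold euler_maclaurin. rewrite <- !csum_minus.
eapply Rle_trans; [apply Cmod_csum|].
unfold em_const. rewrite (Rmult_comm _ B), <- rsum_scal.
apply rsum_le; intros i Hi.
match goal with |- Cmod ?a <= _ => replace a with (RtoC (bern_fact i) *
  (u i (x + 1)%R - (u i x + csum (fun l => u (i + S l)%nat x / RtoC (INR (fact (S l)))) (p - i))))%C
  by ring end.
rewrite Cmod_mult, Cmod_R.
replace (B * (Rabs (bern_fact i) * 2 ^ (S p - i))) with
  (Rabs (bern_fact i) * (2 ^ (S p - i) * B)) by ring.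
apply Rmult_le_compat_l; [apply Rabs_pos|].
assert (HT := taylor_bound (S p - i) (fun l => u (i + l)%nat) x B).
replace (S p - i)%nat with (S (p - i)) in * by lia.
specialize (HT ltac:(intros l t Hl Ht; replace (i + S l)%nat with (S (i + l)) by lia;
  apply Hd; [lia|lra])).
specialize (HT ltac:(intros t Ht; replace (i + S (p - i))%nat with (S p) by lia; now apply HB)).
specialize (HT (x + 1) ltac:(lra)).
rewrite csum_shift in HT. cbv beta in HT. rewrite Nat.add_0_r in HT.
rewrite (csum_ext _ (fun l => u (i + S l)%nat x / RtoC (INR (fact (S l))))%C) in HT.
- cbn [pow fact] in HT. simpl (INR 1) in HT. replace (1 / 1) with 1 in HT by field.
  rewrite Cmult_1_r in HT. exact HT.
- intros l Hl. replace (x + 1 - x) with 1 by ring. rewrite pow1.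
  rewrite RtoC_div by apply INR_fact_neq_0. unfold Cdiv. ring.
Qed.

(** * The Euler-Maclaurin constants of [n ^ k * ln n] *)

Lemma INR_S_pos (n : nat) : 0 < INR (S n).
Proof. apply lt_0_INR; lia. Qed.

Lemma INR_S_ge1 (n : nat) : 1 <= INR (S n).
Proof. apply (le_INR 1); lia. Qed.

Lemma is_lim_seq_inv_INR : is_lim_seq (fun n => / INR n) 0.
Proof.
apply (is_lim_seq_inv _ p_infty); [apply is_lim_seq_INR | discriminate].
Qed.

Lemma is_lim_seq_inv_INR_S : is_lim_seq (fun n => / INR (S n)) 0.
Proof. apply (is_lim_seq_incr_1 (fun n => / INR n)), is_lim_seq_inv_INR. Qed.

Lemma is_series_rsum (a : nat -> R) (l : R) :
  is_series a l <-> is_lim_seq (fun n => rsum a n) l.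
Proof.
rewrite (is_lim_seq_incr_1 (fun n => rsum a n)).
change (is_series a l) with (is_lim_seq (sum_n a) l).
split; apply is_lim_seq_ext; intros n; now rewrite sum_n_rsum.
Qed.

Lemma ex_series_inv_sqr : ex_series (fun n => / INR (S n) ^ 2).
Proof.
apply (ex_series_le (fun n => / INR (S n) ^ 2) (fun n => 2 * (/ INR (S n) - / INR (S (S n))))).
- intros n. change (norm ?a) with (Rabs a).
  assert (H := INR_S_ge1 n). rewrite (S_INR (S n)).
  rewrite Rabs_pos_eq by (left; apply Rinv_0_lt_compat; nra).
  set (a := INR (S n)) in *.
  replace (2 * (/ a - / (a + 1))) with (2 / (a * (a + 1))) by (field; lra).
  replace (/ a ^ 2) with (2 / (2 * a ^ 2)) by (field; lra).
  apply Rmult_le_compat_l; [lra|]. apply Rinv_le_contravar; nra.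
- exists (2 * (1 - 0)). apply (is_series_scal_l 2 (fun n => / INR (S n) - / INR (S (S n)))  (1 - 0)).
  apply is_series_rsum.
  apply (is_lim_seq_ext (fun n => 1 - / INR (S n))).
  + intros n. rewrite (rsum_ext _ (fun i => (- / INR (S (S i))) - (- / INR (S i))))
      by (intros; ring).
    rewrite (rsum_telescope (fun i => - / INR (S i))). simpl (INR 1). field.
    apply Rgt_not_eq, INR_S_pos.
  + apply is_lim_seq_minus'; [apply is_lim_seq_const | apply is_lim_seq_inv_INR_S].
Qed.

Lemma ex_series_le_inv_sqr (a : nat -> R) (K : R) :
  (forall n, Rabs (a n) <= K / INR (S n) ^ 2) -> ex_series a.
Proof.
intros H. apply (ex_series_le a (fun n => K * / INR (S n) ^ 2)); [exact H|].
apply (ex_series_scal_l K (fun n => / INR (S n) ^ 2)), ex_series_inv_sqr.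
Qed.

Lemma ex_lim_of_increments (u : nat -> R) (K : R) :
  (forall n, Rabs (u (S n) - u n) <= K / INR (S n) ^ 2) -> exists l : R, is_lim_seq u l.
Proof.
intros H. destruct (ex_series_le_inv_sqr _ K H) as [l Hl].
exists (l + u O). apply is_series_rsum in Hl.
apply (is_lim_seq_ext (fun n => rsum (fun n => u (S n) - u n) n + u O)).
- intros n; rewrite rsum_telescope; ring.
- apply is_lim_seq_plus'; [exact Hl | apply is_lim_seq_const].
Qed.

Lemma harmonic_rsum (n : nat) : harmonic n = rsum (fun j => / INR (S j)) n.
Proof. apply sum_n_m_rsum. Qed.

Lemma harmonic_0 : harmonic 0 = 0.
Proof. now rewrite harmonic_rsum. Qed.

Lemma harmonic_S (n : nat) : harmonic (S n) = harmonic n + / INR (S n).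
Proof. now rewrite !harmonic_rsum. Qed.

(* The derivative of order [i - 1] of [x ^ k * ln x]; order -1 is an antiderivative. *)
Definition pow_ln_jet (k i : nat) (x : R) : R :=
  if (i <=? S k)%nat then
    INR (fact k) / INR (fact (S k - i)) * x ^ (S k - i) * (ln x + harmonic k - harmonic (S k - i))
  else INR (fact k) * (-1) ^ (i - k) * INR (fact (i - k - 2)) / x ^ (i - k - 1).

Lemma pow_ln_jet_le (k d : nat) (x : R) : (d <= S k)%nat ->
  pow_ln_jet k (S k - d) x =
  INR (fact k) / INR (fact d) * x ^ d * (ln x + harmonic k - harmonic d).
Proof.
intros Hd. unfold pow_ln_jet.
rewrite (proj2 (Nat.leb_le _ _)) by lia.
now replace (S k - (S k - d))%nat with d by lia.
Qed.

Lemma pow_ln_jet_gt (k j : nat) (x : R) :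
  pow_ln_jet k (k + 2 + j) x = INR (fact k) * (-1) ^ j * INR (fact j) / x ^ S j.
Proof.
unfold pow_ln_jet. rewrite (proj2 (Nat.leb_gt _ _)) by lia.
replace (k + 2 + j - k - 2)%nat with j by lia.
replace (k + 2 + j - k - 1)%nat with (S j) by lia.
replace (k + 2 + j - k)%nat with (S (S j)) by lia.
replace ((-1) ^ S (S j)) with ((-1) ^ j) by (simpl; ring). reflexivity.
Qed.

Lemma pow_ln_jet_1 (k : nat) (x : R) : pow_ln_jet k 1 x = x ^ k * ln x.
Proof.
replace 1%nat with (S k - k)%nat by lia. rewrite pow_ln_jet_le by lia.
field. apply INR_fact_neq_0.
Qed.

Lemma is_derive_pow_ln_jet (k i : nat) (x : R) : 0 < x ->
  is_derive (pow_ln_jet k i) x (pow_ln_jet k (S i) x).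
Proof.
intros Hx. destruct (le_lt_dec (S i) (S k)) as [H|H].
- replace i with (S k - S (k - i))%nat at 1 by lia.
  replace (S i) with (S k - (k - i))%nat by lia.
  set (d := (k - i)%nat). assert (Hd : (S d <= S k)%nat) by (unfold d; lia). clearbody d.
  apply (is_derive_ext (fun x => INR (fact k) / INR (fact (S d)) * x ^ S d
     * (ln x + harmonic k - harmonic (S d)))).
  { intros t; now rewrite pow_ln_jet_le. }
  rewrite pow_ln_jet_le by lia.
  auto_derive; [exact Hx|].
  change (match d with 0%nat => 1 | S _ => INR d + 1 end) with (INR (S d)).
  change (fact d + d * fact d)%nat with (fact (S d)).
  change (x * x ^ d) with (x ^ S d).
  rewrite harmonic_S, fact_simpl, mult_INR.
  assert (H1 := INR_S_pos d). assert (H2 := INR_fact_neq_0 d).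
  simpl (x ^ S d). field. lra.
- destruct (le_lt_dec (S (S k)) i) as [H'|H'].
  + replace i with (k + 2 + (i - k - 2))%nat by lia. set (j := (i - k - 2)%nat).
    clearbody j.
    apply (is_derive_ext (fun x => INR (fact k) * (-1) ^ j * INR (fact j) * / x ^ S j)).
    { intros t; now rewrite pow_ln_jet_gt. }
    replace (S (k + 2 + j)) with (k + 2 + S j)%nat by lia.
    rewrite pow_ln_jet_gt.
    assert (Hp : x ^ j <> 0) by (apply pow_nonzero; lra).
    auto_derive.
    { apply pow_nonzero with (n := S j). lra. }
    change (match j with 0%nat => 1 | S _ => INR j + 1 end) with (INR (S j)).
    rewrite fact_simpl, mult_INR. simpl. field. lra.
  + replace i with (S k - 0)%nat at 1 by lia.
    apply (is_derive_ext (fun x => INR (fact k) / INR (fact 0) * x ^ 0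
     * (ln x + harmonic k - harmonic 0))).
    { intros t; now rewrite pow_ln_jet_le by lia. }
    replace (S i) with (k + 2 + 0)%nat by lia. rewrite pow_ln_jet_gt.
    auto_derive; [exact Hx|]. simpl. field. lra.
Qed.

Lemma pow_ln_jet_bound (k i : nat) (x : R) : (k + 3 <= i)%nat -> 1 <= x ->
  Rabs (pow_ln_jet k i x) <= INR (fact k) * INR (fact (i - k - 2)) / x ^ 2.
Proof.
intros Hi Hx. replace i with (k + 2 + (i - k - 2))%nat at 1 by lia.
rewrite pow_ln_jet_gt. set (j := (i - k - 2)%nat). assert (Hj : (1 <= j)%nat) by (unfold j; lia).
clearbody j. unfold Rdiv.
rewrite !Rabs_mult, pow_1_abs, Rmult_1_r.
rewrite !(Rabs_pos_eq (INR _)) by apply pos_INR.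
assert (0 < x ^ 2) by (apply pow_lt; lra).
assert (H2 : x ^ 2 <= x ^ S j) by (apply Rle_pow; [exact Hx | lia]).
rewrite Rabs_pos_eq by (left; apply Rinv_0_lt_compat; lra).
apply Rmult_le_compat_l.
- apply Rmult_le_pos; apply pos_INR.
- now apply Rinv_le_contravar.
Qed.

Definition euler_maclaurin_R (p : nat) (u : nat -> R) : R :=
  rsum (fun i => bern_fact i * u i) (S p).

Lemma euler_maclaurin_RtoC (p : nat) (u : nat -> R) :
  euler_maclaurin p (fun i => RtoC (u i)) = RtoC (euler_maclaurin_R p u).
Proof.
unfold euler_maclaurin, euler_maclaurin_R. rewrite <- csum_RtoC.
apply csum_ext; intros; now rewrite RtoC_mult.
Qed.

(** The sum ends at [X] but the Euler-Maclaurin expression is taken at [X + 1]: a step from [n] to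
    [n + 1] accounts for the summand at its left end, in accordance with [B_1 = -1/2]. *)
Definition pow_ln_defect (k p X : nat) : R :=
  rsum (fun n => INR (S n) ^ k * ln (INR (S n))) X
  - euler_maclaurin_R p (fun i => pow_ln_jet k i (INR (S X))).

Lemma pow_ln_defect_step (k p X : nat) : (k + 2 <= p)%nat ->
  Rabs (pow_ln_defect k p (S X) - pow_ln_defect k p X)
  <= em_const p * (INR (fact k) * INR (fact (S p - k - 2))) / INR (S X) ^ 2.
Proof.
intros Hp. unfold pow_ln_defect. rewrite rsum_S, <- pow_ln_jet_1.
assert (HE := euler_maclaurin_step p (fun i x => RtoC (pow_ln_jet k i x)) (INR (S X))
  (INR (fact k) * INR (fact (S p - k - 2)) / INR (S X) ^ 2) ltac:(lia)).
cbv beta in HE.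
rewrite (euler_maclaurin_RtoC p (fun i => pow_ln_jet k i (INR (S X) + 1))),
  (euler_maclaurin_RtoC p (fun i => pow_ln_jet k i (INR (S X)))), <- !RtoC_minus, Cmod_R in HE.
rewrite (S_INR (S X)), <- Rabs_Ropp.
match goal with |- Rabs ?a <= _ => match type of HE with _ -> _ -> Rabs ?b <= _ =>
  replace a with b by ring end end.
unfold Rdiv in *. rewrite Rmult_assoc. apply HE; assert (H1 := INR_S_ge1 X).
- intros i t Hi Ht. apply Cderiv_RtoC, is_derive_pow_ln_jet. lra.
- intros t Ht. rewrite Cmod_R. eapply Rle_trans; [apply pow_ln_jet_bound; [lia|lra]|].
  unfold Rdiv. apply Rmult_le_compat_l; [apply Rmult_le_pos; apply pos_INR|].
  apply Rinv_le_contravar; [nra | apply pow_incr; lra].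
Qed.

(** This is [- zeta'(-k)], used here only as a limit. At order [S k] all jet entries that do not
    tend to 0 are included. *)
Definition pow_ln_const (k : nat) : R := real (Lim_seq (pow_ln_defect k (S k))).

Lemma pow_ln_jet_lim (k i : nat) : (k + 2 <= i)%nat ->
  is_lim_seq (fun X => pow_ln_jet k i (INR (S X))) 0.
Proof.
intros Hi.
apply (is_lim_seq_ext (fun X => INR (fact k) * (-1) ^ (i - k - 2) * INR (fact (i - k - 2)) *
  (/ INR (S X)) ^ S (i - k - 2))).
{ intros n. replace i with (k + 2 + (i - k - 2))%nat at 4 by lia.
  rewrite pow_ln_jet_gt, pow_inv. reflexivity. }
set (j := (i - k - 2)%nat).
replace (Finite 0) with (Finite (INR (fact k) * (-1) ^ j * INR (fact j) * 0)) by (f_equal; ring).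
apply is_lim_seq_mult'; [apply is_lim_seq_const|].
apply (is_lim_seq_le_le (fun _ => 0) _ (fun X => / INR (S X)));
  [|apply is_lim_seq_const|apply is_lim_seq_inv_INR_S].
intros n. assert (H := INR_S_ge1 n).
assert (H1 : 0 < / INR (S n) <= 1).
{ split; [apply Rinv_0_lt_compat; lra|]. rewrite <- Rinv_1. apply Rinv_le_contravar; lra. }
set (r := / INR (S n)) in *.
split; [left; apply pow_lt; lra|].
assert (r ^ j <= 1) by (rewrite <- (pow1 j); apply pow_incr; lra).
change (r ^ S j) with (r * r ^ j). nra.
Qed.

Lemma is_lim_seq_rsum (u : nat -> nat -> R) (l : nat -> R) (n : nat) :
  (forall i, (i < n)%nat -> is_lim_seq (u i) (l i)) ->
  is_lim_seq (fun X => rsum (fun i => u i X) n) (rsum l n).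
Proof.
induction n as [|n IH]; intros H; simpl; [apply is_lim_seq_const|].
apply is_lim_seq_plus'; [apply IH; intros; apply H; lia | apply H; lia].
Qed.

Lemma rsum_app (f : nat -> R) (m n : nat) :
  rsum f (m + n) = rsum f m + rsum (fun i => f (m + i)%nat) n.
Proof.
induction n as [|n IH]; [rewrite Nat.add_0_r; simpl; ring|].
rewrite Nat.add_succ_r. simpl. rewrite IH. ring.
Qed.

(** Orders beyond [S k] only add jet entries that vanish at infinity, so all these limits agree.
    Existence is shown at order [k + 2], where a step changes the defect by [O(1 / X^2)]. *)
Lemma pow_ln_const_lim (k p : nat) : (k + 1 <= p)%nat ->
  is_lim_seq (pow_ln_defect k p) (pow_ln_const k).
Proof.
assert (Hdiff : forall p, (k + 1 <= p)%nat ->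
  is_lim_seq (fun X => pow_ln_defect k p X - pow_ln_defect k (S k) X) 0).
{ clear p; intros p Hp.
  apply (is_lim_seq_ext (fun X => - rsum (fun i => bern_fact (S (S k) + i) *
     pow_ln_jet k (S (S k) + i) (INR (S X))) (p - S k))).
  - intros X. unfold pow_ln_defect, euler_maclaurin_R.
    replace (S p) with (S (S k) + (p - S k))%nat by lia. rewrite rsum_app. ring.
  - replace (Finite 0) with (Rbar_opp (rsum (fun i => bern_fact (S (S k) + i) * 0) (p - S k))).
    + apply -> is_lim_seq_opp. apply is_lim_seq_rsum. intros i _.
      apply is_lim_seq_mult'; [apply is_lim_seq_const | apply pow_ln_jet_lim; lia].
    + rewrite rsum_0 by (intros; ring). simpl. f_equal; ring. }
destruct (ex_lim_of_increments (pow_ln_defect k (k + 2)) _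
  (fun X => pow_ln_defect_step k (k + 2) X (le_n _))) as [l Hl].
assert (Hk : is_lim_seq (pow_ln_defect k (S k)) l).
{ replace (Finite l) with (Finite (l - 0)) by (f_equal; ring).
  apply (is_lim_seq_ext (fun X => pow_ln_defect k (k + 2) X -
    (pow_ln_defect k (k + 2) X - pow_ln_defect k (S k) X))); [intros; ring|].
  apply is_lim_seq_minus'; [exact Hl | apply Hdiff; lia]. }
intros Hp. unfold pow_ln_const. rewrite (is_lim_seq_unique _ _ Hk). simpl real.
replace (Finite l) with (Finite (0 + l)) by (f_equal; ring).
apply (is_lim_seq_ext (fun X => (pow_ln_defect k p X - pow_ln_defect k (S k) X)
  + pow_ln_defect k (S k) X)); [intros; ring|].
apply is_lim_seq_plus'; [now apply Hdiff | exact Hk].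
Qed.

Lemma bern_fact_0 : bern_fact 0 = 1.
Proof. unfold bern_fact. rewrite bernoulli_0. simpl. field. Qed.

Lemma bern_fact_1 : bern_fact 1 = - (1 / 2).
Proof.
assert (H := bern_fact_rec 1 (le_n _)). simpl in H. rewrite bern_fact_0 in H. lra.
Qed.

Lemma bern_fact_2 : bern_fact 2 = 1 / 12.
Proof.
assert (H := bern_fact_rec 2 ltac:(lia)). simpl in H.
rewrite bern_fact_0, bern_fact_1 in H. lra.
Qed.

(** The second Bernoulli term of the jet is [(ln x + 1) / 12], but only [ln x / 12] is subtracted in
    [glaisher], whence [1 / 12]. The sum in [glaisher] also includes the summand at the endpoint,
    which turns the [- x / 2 * ln x] of the Euler-Maclaurin expression into [x / 2 * ln x]. *)
Lemma ln_glaisher : ln glaisher = pow_ln_const 1 + 1 / 12.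
Proof.
unfold glaisher. rewrite ln_exp.
assert (H : is_lim_seq (fun n => sum_n_m (fun k => INR k * ln (INR k)) 1 n
    - (INR n ^ 2 / 2 + INR n / 2 + 1 / 12) * ln (INR n) + INR n ^ 2 / 4)
    (pow_ln_const 1 + 1 / 12)).
{ apply is_lim_seq_incr_1.
  apply (is_lim_seq_ext (fun X => pow_ln_defect 1 2 X + 1 / 12)).
  - intros X. rewrite sum_n_m_rsum, rsum_S.
    unfold pow_ln_defect, euler_maclaurin_R. cbn [rsum].
    rewrite (rsum_ext (fun n => INR (S n) ^ 1 * _) (fun n => INR (S n) * ln (INR (S n))))
      by (intros; rewrite pow_1; reflexivity).
    rewrite bern_fact_0, bern_fact_1, bern_fact_2. unfold pow_ln_jet.
    cbn [Nat.leb Nat.sub fact Nat.mul Nat.add].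
    rewrite !harmonic_S, harmonic_0.
    set (x := INR (S X)). simpl. field.
  - apply is_lim_seq_plus'; [apply pow_ln_const_lim; lia | apply is_lim_seq_const]. }
now rewrite (is_lim_seq_unique _ _ H).
Qed.

(** * Jets with weighted bounds *)

(** Derivatives of all orders are carried along as an explicit sequence of functions; by uniqueness
    of derivatives, two such sequences need to be compared at order 0 only. *)
Definition is_jet (a : nat -> R -> C) : Prop :=
  forall i x, 0 < x -> Cderiv (a i) x (a (S i) x).

(** The product rule is left as a binary tree instead of a sum with binomial coefficients, which
    makes both the jet property and the weighted bounds plain inductions. *)
Fixpoint leibniz (j : nat) (a b : nat -> R -> C) (x : R) : C :=
  match j with
  | O => (a O x * b O x)%C
  | S j => (leibniz j (fun i => a (S i)) b x + leibniz j a (fun i => b (S i)) x)%C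
  end.

Lemma is_jet_leibniz (a b : nat -> R -> C) :
  is_jet a -> is_jet b -> is_jet (fun j => leibniz j a b).
Proof.
intros Ha Hb j x Hx. revert a b Ha Hb; induction j as [|j IH]; intros a b Ha Hb.
- apply Cderiv_mult; [now apply Ha | now apply Hb].
- simpl. apply Cderiv_plus; apply IH; intros i y Hy; (now apply Ha) || (now apply Hb).
Qed.

Lemma is_jet_scal (c : C) (a : nat -> R -> C) :
  is_jet a -> is_jet (fun i x => c * a i x)%C.
Proof. intros Ha i x Hx. now apply Cderiv_scal, Ha. Qed.

Lemma is_jet_minus (a b : nat -> R -> C) :
  is_jet a -> is_jet b -> is_jet (fun i x => a i x - b i x)%C.
Proof. intros Ha Hb i x Hx. apply Cderiv_minus; [now apply Ha | now apply Hb]. Qed.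

Lemma is_jet_plus (a b : nat -> R -> C) :
  is_jet a -> is_jet b -> is_jet (fun i x => a i x + b i x)%C.
Proof. intros Ha Hb i x Hx. apply Cderiv_plus; [now apply Ha | now apply Hb]. Qed.

Lemma is_jet_csum (F : nat -> nat -> R -> C) (n : nat) :
  (forall k, (k < n)%nat -> is_jet (F k)) -> is_jet (fun i x => csum (fun k => F k i x) n).
Proof. intros H i x Hx. apply Cderiv_csum. intros k Hk. now apply H. Qed.

Lemma is_jet_unique (a b : nat -> R -> C) : is_jet a -> is_jet b ->
  (forall x, 0 < x -> a O x = b O x) -> forall i x, 0 < x -> a i x = b i x.
Proof.
intros Ha Hb H0 i; induction i as [|i IH]; intros x Hx; [now apply H0|].
apply (Cderiv_unique (a i) x); [now apply Ha|].
apply (Cderiv_ext_pos (b i)); [exact Hx | intros t Ht; symmetry; now apply IH | now apply Hb].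
Qed.

(** Symbol-type estimates: every [x]-derivative gains a factor [1 / x], with a constant uniform in
    [y]. Weights multiply under [leibniz], so bounds for composite functions need no explicit
    derivatives. *)
Definition jet_bound (D : C -> R -> Prop) (w : C -> R -> R) (a : C -> nat -> R -> C) : Prop :=
  forall i, exists K, 0 <= K /\ forall y x, D y x -> x ^ i * Cmod (a y i x) <= K * w y x.

Lemma jet_bound_shift (D : C -> R -> Prop) (w : C -> R -> R) (a : C -> nat -> R -> C) :
  (forall y x, D y x -> 0 < x) -> jet_bound D w a ->
  jet_bound D (fun y x => w y x / x) (fun y i => a y (S i)).
Proof.
intros HD Ha i. destruct (Ha (S i)) as (K & HK & H). exists K; split; [exact HK|].
intros y x Hyx. specialize (H y x Hyx). specialize (HD y x Hyx).
apply (Rmult_le_reg_l x); [exact HD|].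
replace (x * (K * (w y x / x))) with (K * w y x) by (field; lra).
simpl in H. lra.
Qed.

Lemma jet_bound_leibniz (D : C -> R -> Prop) (wa wb : C -> R -> R) (a b : C -> nat -> R -> C) :
  (forall y x, D y x -> 0 < x) -> jet_bound D wa a -> jet_bound D wb b ->
  jet_bound D (fun y x => wa y x * wb y x) (fun y j => leibniz j (a y) (b y)).
Proof.
intros HD Ha Hb j; revert wa wb a b Ha Hb; induction j as [|j IH]; intros wa wb a b Ha Hb.
- destruct (Ha O) as (K & HK & H), (Hb O) as (L & HL & H').
  exists (K * L); split; [now apply Rmult_le_pos|]. intros y x Hyx. simpl.
  specialize (H y x Hyx); specialize (H' y x Hyx). simpl in H, H'.
  rewrite Cmod_mult. rewrite !Rmult_1_l in *.
  replace (K * L * (wa y x * wb y x)) with (K * wa y x * (L * wb y x)) by ring.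
  apply Rmult_le_compat; auto using Cmod_ge_0.
(* Shifting a jet divides its weight by [x]; the extra factor in [x ^ S j] restores it. *)
- destruct (IH _ _ _ _ (jet_bound_shift _ _ _ HD Ha) Hb) as (K & HK & H).
  destruct (IH _ _ _ _ Ha (jet_bound_shift _ _ _ HD Hb)) as (L & HL & H').
  exists (K + L); split; [lra|]. intros y x Hyx. simpl.
  specialize (H y x Hyx); specialize (H' y x Hyx). specialize (HD y x Hyx).
  assert (Hp : 0 < x ^ j) by now apply pow_lt.
  eapply Rle_trans.
  { apply Rmult_le_compat_l; [|apply Cmod_triangle]. nra. }
  set (A := Cmod _) in *. set (B := Cmod _) in *.
  apply (Rmult_le_compat_l x) in H; [|lra]. apply (Rmult_le_compat_l x) in H'; [|lra].
  replace (x * (K * (wa y x / x * wb y x))) with (K * (wa y x * wb y x)) in H by (field; lra).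
  replace (x * (L * (wa y x * (wb y x / x)))) with (L * (wa y x * wb y x)) in H' by (field; lra).
  lra.
Qed.

Lemma jet_bound_csum (D : C -> R -> Prop) (w : C -> R -> R) (c : nat -> C)
    (F : nat -> C -> nat -> R -> C) (n : nat) :
  (forall y x, D y x -> 0 < x) ->
  (forall k, (k < n)%nat -> jet_bound D w (F k)) ->
  jet_bound D w (fun y i x => csum (fun k => c k * F k y i x)%C n).
Proof.
intros HD HF i. induction n as [|n IH].
- exists 0; split; [lra|]. intros; simpl. rewrite Cmod_0; lra.
- destruct IH as (K & HK & H); [intros; apply HF; lia|].
  destruct (HF n (le_n _) i) as (L & HL & H').
  exists (K + Cmod (c n) * L).
  assert (Hc := Cmod_ge_0 (c n)).
  split; [apply Rplus_le_le_0_compat; [|apply Rmult_le_pos]; assumption|].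
  intros y x Hyx. simpl.
  specialize (H y x Hyx); specialize (H' y x Hyx). specialize (HD y x Hyx).
  assert (Hp : 0 < x ^ i) by now apply pow_lt.
  eapply Rle_trans.
  { apply Rmult_le_compat_l; [|apply Cmod_triangle]. lra. }
  rewrite Cmod_mult, !Rmult_plus_distr_l, Rmult_plus_distr_r.
  apply Rplus_le_compat; [exact H|].
  apply (Rmult_le_compat_l (Cmod (c n))) in H'; [|exact Hc]. lra.
Qed.

Lemma jet_bound_weaken (D D' : C -> R -> Prop) (w w' : C -> R -> R) (a : C -> nat -> R -> C) (c : R) :
  0 <= c ->
  (forall y x, D' y x -> D y x) -> (forall y x, D' y x -> w y x <= c * w' y x) ->
  jet_bound D w a -> jet_bound D' w' a.
Proof.
intros Hc HD Hw Ha i. destruct (Ha i) as (K & HK & H). exists (K * c).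
split; [now apply Rmult_le_pos|]. intros y x Hyx.
eapply Rle_trans; [apply H, HD, Hyx|]. rewrite Rmult_assoc.
apply Rmult_le_compat_l; [exact HK | now apply Hw].
Qed.

(** * The kernel [1 / (e^z - 1)] in a cone *)

(** For [0 < c <= 1] this is the closed sector [|arg y| <= arccos c] without its vertex, written so
    that convexity is the triangle inequality. *)
Definition cone (c : R) (y : C) : Prop := y <> RtoC 0 /\ c * Cmod y <= fst y.

Definition bose (z : C) : C := (/ (Cexp z - 1))%C.

Lemma cone_re (c : R) (y : C) : 0 < c -> cone c y -> 0 < fst y.
Proof.
intros Hc [H0 H]. apply Cmod_gt_0 in H0. assert (0 < c * Cmod y) by nra. lra.
Qed.

Lemma Cmod_scal_pos (x : R) (y : C) : 0 < x -> Cmod (RtoC x * y) = x * Cmod y.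
Proof. intros Hx. rewrite Cmod_mult, Cmod_R, Rabs_pos_eq; lra. Qed.

Lemma cone_scal (c x : R) (y : C) : 0 < x -> cone c y -> cone c (RtoC x * y).
Proof.
intros Hx [H0 H]; split.
- apply Cmult_neq_0; [|exact H0]. intros E. apply RtoC_inj in E; lra.
- rewrite Cmod_scal_pos by exact Hx. simpl. nra.
Qed.

Lemma exp_ge_pow (s : nat) (t : R) : 0 <= t -> t ^ S s / INR (fact (S s)) <= exp t - 1.
Proof.
revert t; induction s as [|s IH]; intros t Ht.
- simpl. generalize (exp_ineq1_le t); lra.
- set (f := fun t => exp t - 1 - t ^ S (S s) / INR (fact (S (S s)))).
  assert (Hd : forall u, is_derive f u (exp u - u ^ S s / INR (fact (S s)))).
  { intros u. unfold f.
    apply (is_derive_ext (fun t => exp t - 1 - (t - 0) ^ S (S s) / INR (fact (S (S s))))).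
    { intros v; now rewrite Rminus_0_r. }
    apply is_derive_Rminus.
    - eapply is_derive_eq; [apply is_derive_Rminus; [apply is_derive_exp|
        exact (is_derive_const 1 u)]|]. apply Rminus_0_r.
    - destruct (Cderiv_monomial 0 u (S s)) as [H _]. simpl fst in H.
      eapply is_derive_eq; [exact H|]. now rewrite Rminus_0_r. }
  destruct (MVT_gen f 0 t _ (fun u _ => Hd u)) as (u & Hu & E).
  { intros v _. apply continuity_pt_filterlim, (ex_derive_continuous f v). eexists; apply Hd. }
  rewrite Rmin_left, Rmax_right in Hu by lra.
  assert (f 0 = 0). { unfold f. rewrite exp_0, pow_i by lia. unfold Rdiv; ring. }
  assert (0 <= (exp u - u ^ S s / INR (fact (S s))) * (t - 0)).
  { apply Rmult_le_pos; [|lra]. specialize (IH u (proj1 Hu)). lra. }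
  unfold f in *. lra.
Qed.

Lemma Cmod_Cexp_minus_1_ge (z : C) : 0 < fst z -> exp (fst z) - 1 <= Cmod (Cexp z - 1).
Proof.
intros Hz. rewrite <- Cmod_Cexp.
assert (H := Cmod_triangle (Cexp z - 1) 1).
replace (Cexp z - 1 + 1)%C with (Cexp z) in H by ring. rewrite Cmod_1 in H. lra.
Qed.

Lemma Cexp_minus_1_neq_0 (z : C) : 0 < fst z -> (Cexp z - 1)%C <> RtoC 0.
Proof.
intros Hz E. assert (H := Cmod_Cexp_minus_1_ge z Hz). rewrite E, Cmod_0 in H.
generalize (exp_ineq1 (fst z)); lra.
Qed.

(** In the cone [Re z >= c * |z|], and [|e^z - 1| >= e^(Re z) - 1] dominates every power of [Re z];
    this gives the constant [(s + 1)! / c^(s + 1)]. The case [s = 0] expresses the simple pole at 0,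
    large [s] the decay at infinity. *)
Lemma bose_bound (c : R) (s : nat) : 0 < c -> exists K, 0 <= K /\
  forall z, cone c z -> Cmod z ^ S s * Cmod (bose z) <= K.
Proof.
intros Hc. exists (INR (fact (S s)) / c ^ S s).
assert (Hcs : 0 < c ^ S s) by now apply pow_lt.
assert (Hf := lt_0_INR _ (lt_O_fact (S s))).
split; [left; now apply Rdiv_lt_0_compat|]. intros z Hz.
assert (Hre := cone_re c z Hc Hz). destruct Hz as [H0 Hz].
unfold bose. rewrite Cmod_inv by now apply Cexp_minus_1_neq_0.
assert (H1 := Cmod_Cexp_minus_1_ge z Hre).
assert (H2 := exp_ge_pow s (fst z) (Rlt_le _ _ Hre)).
assert (H3 : (c * Cmod z) ^ S s <= fst z ^ S s).
{ apply pow_incr. split; [|exact Hz]. apply Rmult_le_pos; [lra | apply Cmod_ge_0]. }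
rewrite Rpow_mult_distr in H3.
assert (H5 : 0 < Cmod z ^ S s) by (apply pow_lt; now apply Cmod_gt_0).
set (m := Cmod z ^ S s) in *. set (E := Cmod (Cexp z - 1)) in *.
set (F := INR (fact (S s))) in *. set (cs := c ^ S s) in *.
assert (H4 : cs * m / F <= E).
{ eapply Rle_trans; [|exact (Rle_trans _ _ _ H2 H1)].
  apply Rmult_le_compat_r; [left; now apply Rinv_0_lt_compat | exact H3]. }
assert (HE : 0 < cs * m / F) by (apply Rdiv_lt_0_compat; [apply Rmult_lt_0_compat|]; assumption).
apply Rle_trans with (m * / (cs * m / F)).
- apply Rmult_le_compat_l; [lra|]. now apply Rinv_le_contravar.
- right. field. lra.
Qed.

Lemma Cderiv_ray (y : C) (x : R) : Cderiv (fun t => RtoC t * y)%C x y.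
Proof.
eapply Cderiv_eq; [apply Cderiv_mult; [apply Cderiv_id | apply Cderiv_const]|]. cbv beta. ring.
Qed.

Lemma Cderiv_bose (F : R -> C) (x : R) (a : C) : 0 < fst (F x) -> Cderiv F x a ->
  Cderiv (fun t => bose (F t)) x (- a * (bose (F x) + bose (F x) * bose (F x)))%C.
Proof.
intros Hx HF. assert (H0 := Cexp_minus_1_neq_0 _ Hx). unfold bose.
eapply Cderiv_eq.
- apply Cderiv_inv; [exact H0|].
  apply Cderiv_minus; [apply Cderiv_exp, HF | apply Cderiv_const].
- cbv beta. field. exact H0.
Qed.

Lemma Cderiv_pow (F : R -> C) (x : R) (a : C) (n : nat) : Cderiv F x a ->
  Cderiv (fun t => F t ^ S n)%C x (RtoC (INR (S n)) * F x ^ n * a)%C.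
Proof.
intros HF. induction n as [|n IH].
- apply (Cderiv_ext F); [intros; simpl; ring|].
  eapply Cderiv_eq; [exact HF|]. simpl; ring.
- apply (Cderiv_ext (fun t => F t * F t ^ S n)%C); [reflexivity|].
  eapply Cderiv_eq; [apply Cderiv_mult; [exact HF | exact IH]|].
  rewrite (S_INR (S n)), RtoC_plus, !Cpow_S. ring.
Qed.

(* The [j]-th derivative of [bose (x y) ^ i], by [bose' = - bose - bose^2]. *)
Fixpoint bose_jet (y : C) (j i : nat) (x : R) : C :=
  match j with
  | O => (bose (RtoC x * y) ^ i)%C
  | S j => (- y * RtoC (INR i) * (bose_jet y j i x + bose_jet y j (S i) x))%C
  end.

Lemma Cderiv_bose_jet (y : C) (j i : nat) (x : R) : 0 < fst y -> 0 < x ->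
  Cderiv (bose_jet y j i) x (bose_jet y (S j) i x).
Proof.
intros Hy Hx; revert i; induction j as [|j IH]; intros i.
- simpl. destruct i as [|i].
  + simpl. eapply Cderiv_eq; [apply Cderiv_const | ring].
  + eapply Cderiv_eq.
    * apply (Cderiv_pow (fun t => bose (RtoC t * y))).
      apply Cderiv_bose; [simpl; nra | apply Cderiv_ray].
    * rewrite !Cpow_S. ring.
- simpl. apply Cderiv_scal, Cderiv_plus; apply IH.
Qed.

(** Each derivative brings down a factor [y], which together with one [x] makes [m = x * Cmod y] and
    is paid for by raising [s] by one. The condition [1 <= i] keeps at least one factor [bose],
    hence the decay. *)
Lemma bose_jet_bound (c : R) (j i s : nat) : 0 < c -> (1 <= i <= s)%nat -> exists K, 0 <= K /\
  forall y x, cone c y -> 0 < x -> (x * Cmod y) ^ s * (x ^ j * Cmod (bose_jet y j i x)) <= K.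
Proof.
intros Hc; revert i s; induction j as [|j IH]; intros i s His.
- destruct (bose_bound c (s - i) Hc) as (K & HK & H).
  destruct (bose_bound c 0 Hc) as (L & HL & H').
  exists (K * L ^ (i - 1)); split; [apply Rmult_le_pos; [lra | now apply pow_le]|].
  intros y x Hy Hx. simpl.
  rewrite <- Cmod_scal_pos by exact Hx.
  specialize (H _ (cone_scal c x y Hx Hy)). specialize (H' _ (cone_scal c x y Hx Hy)).
  set (z := (RtoC x * y)%C) in *.
  rewrite Cmod_pow, Rmult_1_l.
  (* One factor [bose] takes the power [s - i + 1], each of the other [i - 1] factors a single
     power. *)
  replace s with (S (s - i) + (i - 1))%nat at 1 by lia. rewrite pow_add.
  replace i with (S (i - 1)) at 3 by lia.
  change (Cmod (bose z) ^ S (i - 1)) with (Cmod (bose z) * Cmod (bose z) ^ (i - 1)).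
  replace (Cmod z ^ S (s - i) * Cmod z ^ (i - 1) * (Cmod (bose z) * Cmod (bose z) ^ (i - 1)))
    with (Cmod z ^ S (s - i) * Cmod (bose z) * (Cmod z * Cmod (bose z)) ^ (i - 1))
    by (rewrite Rpow_mult_distr; ring).
  assert (Hz := Cmod_ge_0 z). assert (Hb := Cmod_ge_0 (bose z)).
  apply Rmult_le_compat; [apply Rmult_le_pos; [now apply pow_le | lra]
    | apply pow_le; now apply Rmult_le_pos | exact H | ].
  apply pow_incr. split; [now apply Rmult_le_pos|]. rewrite pow_1 in H'. exact H'.
- destruct (IH i (S s) ltac:(lia)) as (K & HK & H).
  destruct (IH (S i) (S s) ltac:(lia)) as (L & HL & H').
  exists (INR i * (K + L)). assert (Hi := pos_INR i).
  split; [apply Rmult_le_pos; lra|]. intros y x Hy Hx.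
  specialize (H y x Hy Hx). specialize (H' y x Hy Hx).
  cbn [bose_jet]. rewrite !Cmod_mult, Cmod_opp, Cmod_R, (Rabs_pos_eq (INR i)) by exact Hi.
  set (m := x * Cmod y) in *.
  assert (Hm : 0 <= m) by (apply Rmult_le_pos; [lra | apply Cmod_ge_0]).
  apply Rle_trans with (INR i * (m ^ S s * (x ^ j *
    (Cmod (bose_jet y j i x) + Cmod (bose_jet y j (S i) x))))).
  + replace (m ^ s * (x ^ S j * (Cmod y * INR i * Cmod (bose_jet y j i x + bose_jet y j (S i) x))))
      with (INR i * (m ^ S s * (x ^ j * Cmod (bose_jet y j i x + bose_jet y j (S i) x))))
      by (simpl; unfold m; ring).
    apply Rmult_le_compat_l; [exact Hi|].
    apply Rmult_le_compat_l; [now apply pow_le|].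
    apply Rmult_le_compat_l; [apply pow_le; lra | apply Cmod_triangle].
  + apply Rmult_le_compat_l; [exact Hi|]. lra.
Qed.

Definition z_jet (y : C) (i : nat) (x : R) : C :=
  match i with O => (RtoC x * y)%C | 1%nat => y | _ => RtoC 0 end.

Lemma is_jet_z (y : C) : is_jet (z_jet y).
Proof.
intros [|[|i]] x _; simpl; [apply Cderiv_ray | apply Cderiv_const | apply Cderiv_const].
Qed.

(** An iterated Leibniz product, so that the weighted bound is inherited from [z_jet]; closed forms
    are derived at orders 0 and 1. *)
Fixpoint zpow_jet (y : C) (k : nat) : nat -> R -> C :=
  match k with
  | O => fun i _ => match i with O => RtoC 1 | _ => RtoC 0 end
  | S k => fun j => leibniz j (z_jet y) (zpow_jet y k)
  end.

Lemma is_jet_zpow (y : C) (k : nat) : is_jet (zpow_jet y k).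
Proof.
induction k as [|k IH].
- intros [|i] x _; apply Cderiv_const.
- exact (is_jet_leibniz _ _ (is_jet_z y) IH).
Qed.

Lemma zpow_jet_0 (y : C) (k : nat) (x : R) : zpow_jet y k 0 x = ((RtoC x * y) ^ k)%C.
Proof. induction k as [|k IH]; [reflexivity|]. simpl in *. now rewrite IH. Qed.

Lemma zpow_jet_1 (y : C) (k : nat) (x : R) : 0 < x ->
  zpow_jet y k 1 x = (RtoC (INR k) * y ^ k * RtoC (x ^ (k - 1)))%C.
Proof.
intros Hx. apply (Cderiv_unique (zpow_jet y k 0) x); [now apply is_jet_zpow|].
apply (Cderiv_ext (fun t => (RtoC t * y) ^ k)%C); [intros; now rewrite zpow_jet_0|].
destruct k as [|k].
- simpl. eapply Cderiv_eq; [apply Cderiv_const|]. ring.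
- eapply Cderiv_eq; [apply Cderiv_pow, Cderiv_ray|].
  replace (S k - 1)%nat with k by lia. rewrite RtoC_pow, Cpow_mult_l, Cpow_S. ring.
Qed.

Lemma z_jet_bound (D : C -> R -> Prop) :
  (forall y x, D y x -> 0 < x) -> jet_bound D (fun y x => x * Cmod y) z_jet.
Proof.
intros HD i. exists 1; split; [lra|]. intros y x Hyx. specialize (HD y x Hyx).
destruct i as [|[|i]]; cbn [z_jet].
- rewrite Cmod_scal_pos by exact HD. simpl; lra.
- simpl; lra.
- rewrite Cmod_0, Rmult_0_r, Rmult_1_l.
  apply Rmult_le_pos; [lra | apply Cmod_ge_0].
Qed.

Lemma zpow_jet_bound (D : C -> R -> Prop) (k : nat) :
  (forall y x, D y x -> 0 < x) ->
  jet_bound D (fun y x => (x * Cmod y) ^ k) (fun y => zpow_jet y k).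
Proof.
intros HD; induction k as [|k IH].
- intros i. exists 1; split; [lra|]. intros y x Hyx. specialize (HD y x Hyx).
  destruct i as [|i]; simpl; rewrite ?Cmod_1, ?Cmod_0; lra.
- exact (jet_bound_leibniz _ _ _ _ _ HD (z_jet_bound D HD) IH).
Qed.

(** * The Taylor remainder of [z / (e^z - 1)] *)

Definition exp_rem (L : nat) (z : C) : C :=
  (Cexp z - csum (fun l => z ^ l / RtoC (INR (fact l)))%C (S L))%C.

Lemma exp_rem_0 (z : C) : exp_rem 0 z = (Cexp z - 1)%C.
Proof. unfold exp_rem. simpl. field. Qed.

Lemma Cderiv_exp_rem (y : C) (L : nat) (x : R) :
  Cderiv (fun t => exp_rem (S L) (RtoC t * y)) x (y * exp_rem L (RtoC x * y))%C.
Proof.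
unfold exp_rem.
apply (Cderiv_ext (fun t => Cexp (RtoC t * y) - (1 + csum (fun l =>
  / RtoC (INR (fact (S l))) * (RtoC t * y) ^ S l) (S L)))%C).
- intros t. rewrite (csum_shift _ (S L)). f_equal. f_equal. f_equal.
  + simpl. field.
  + apply csum_ext; intros; unfold Cdiv; ring.
- eapply Cderiv_eq.
  + apply Cderiv_minus; [apply Cderiv_exp, Cderiv_ray|].
    apply Cderiv_plus; [apply Cderiv_const|].
    apply Cderiv_csum. intros i _. apply Cderiv_scal, Cderiv_pow, Cderiv_ray.
  + rewrite (csum_ext _ (fun l => y * ((RtoC x * y) ^ l / RtoC (INR (fact l))))%C).
    * rewrite csum_scal. ring.
    * intros i _. rewrite fact_simpl, mult_INR, RtoC_mult. field.
      split; intros E; apply RtoC_inj in E; [now apply INR_fact_neq_0 in E|].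
      now apply not_0_INR in E.
Qed.

Lemma exp_rem_at_0 (L : nat) : exp_rem L 0 = RtoC 0.
Proof.
unfold exp_rem. rewrite Cexp_0, csum_shift, (csum_ext _ (fun _ => RtoC 0 * RtoC 0)%C).
- rewrite csum_scal. simpl. field.
- intros i _. rewrite Cpow_S. unfold Cdiv. ring.
Qed.

Lemma Cmod_Cexp_le (z : C) : Cmod z <= 1 -> Cmod (Cexp z) <= exp 1.
Proof.
intros H. rewrite Cmod_Cexp.
assert (H1 := Rabs_fst_le_Cmod z). assert (H2 := Rle_abs (fst z)).
destruct (Req_dec (fst z) 1) as [->|]; [lra|]. left. apply exp_increasing. lra.
Qed.

(** Along the segment from 0 to [z] the derivative of the remainder of order [L + 1] is [z] times
    the one of order [L], so each integration gains a power of [|z|]. *)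
Lemma exp_rem_bound (L : nat) : exists K, 0 <= K /\
  forall z, Cmod z <= 1 -> Cmod (exp_rem L z) <= K * Cmod z ^ S L.
Proof.
induction L as [|L (K & HK & IH)].
- exists (2 * exp 1). assert (He := exp_pos 1). split; [lra|]. intros z Hz.
  assert (HM := Cderiv_MVT (fun t => exp_rem 0 (RtoC t * z)) (fun t => z * Cexp (RtoC t * z))%C
    0 1 (Cmod z * exp 1)).
  cbv beta in HM. rewrite Cmult_0_l, exp_rem_at_0, Cmult_1_l in HM.
  replace (exp_rem 0 z - 0)%C with (exp_rem 0 z) in HM by ring.
  simpl (Cmod z ^ 1).
  eapply Rle_trans; [apply HM|]; [lra| | | lra].
  + intros t Ht. apply (Cderiv_ext (fun t => Cexp (RtoC t * z) - 1)%C).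
    { intros; now rewrite exp_rem_0. }
    eapply Cderiv_eq; [apply Cderiv_minus; [apply Cderiv_exp, Cderiv_ray|apply Cderiv_const]|].
    cbv beta. ring.
  + intros t Ht. rewrite Cmod_mult. apply Rmult_le_compat_l; [apply Cmod_ge_0|].
    apply Cmod_Cexp_le. rewrite Cmod_mult, Cmod_R, Rabs_pos_eq by lra.
    generalize (Cmod_ge_0 z); nra.
- exists (2 * K). split; [lra|]. intros z Hz.
  assert (H0 := Cmod_ge_0 z).
  assert (HM := Cderiv_MVT (fun t => exp_rem (S L) (RtoC t * z))
    (fun t => z * exp_rem L (RtoC t * z))%C 0 1 (Cmod z * (K * Cmod z ^ S L))).
  cbv beta in HM. rewrite Cmult_0_l, exp_rem_at_0, Cmult_1_l in HM.
  replace (exp_rem (S L) z - 0)%C with (exp_rem (S L) z) in HM by ring.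
  eapply Rle_trans; [apply HM|]; [lra| | |simpl; lra].
  + intros t Ht. apply Cderiv_exp_rem.
  + intros t Ht. rewrite Cmod_mult. apply Rmult_le_compat_l; [apply Cmod_ge_0|].
    assert (Hm : Cmod (RtoC t * z) <= Cmod z).
    { rewrite Cmod_mult, Cmod_R, Rabs_pos_eq by lra. nra. }
    eapply Rle_trans; [apply IH; lra|]. apply Rmult_le_compat_l; [exact HK|].
    apply pow_incr. split; [apply Cmod_ge_0 | exact Hm].
Qed.

(** Differentiation lowers the order of the remainder by one; once the order is used up, only the
    exponential is left. *)
Definition exp_rem_jet (y : C) (L i : nat) (x : R) : C :=
  if (i <=? L)%nat then (y ^ i * exp_rem (L - i) (RtoC x * y))%C
  else (y ^ i * Cexp (RtoC x * y))%C.

Lemma is_jet_exp_rem (y : C) (L : nat) : is_jet (exp_rem_jet y L).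
Proof.
intros i x _. unfold exp_rem_jet.
destruct (Nat.leb_spec i L) as [H|H], (Nat.leb_spec (S i) L) as [H'|H']; try lia.
- eapply Cderiv_eq.
  + apply Cderiv_scal. replace (L - i)%nat with (S (L - S i)) by lia. apply Cderiv_exp_rem.
  + rewrite Cpow_S. ring.
- replace (L - i)%nat with 0%nat by lia.
  apply (Cderiv_ext (fun t => y ^ i * (Cexp (RtoC t * y) - 1))%C).
  { intros; now rewrite exp_rem_0. }
  eapply Cderiv_eq.
  + apply Cderiv_scal, Cderiv_minus; [apply Cderiv_exp, Cderiv_ray|apply Cderiv_const].
  + rewrite Cpow_S. ring.
- eapply Cderiv_eq.
  + apply Cderiv_scal, Cderiv_exp, Cderiv_ray.
  + rewrite Cpow_S. ring.
Qed.

Lemma exp_rem_jet_bound (D : C -> R -> Prop) (L : nat) :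
  (forall y x, D y x -> 0 < x /\ x * Cmod y <= 1) ->
  jet_bound D (fun y x => (x * Cmod y) ^ S L) (fun y => exp_rem_jet y L).
Proof.
intros HD i. unfold exp_rem_jet.
destruct (Nat.leb_spec i L) as [H|H].
- destruct (exp_rem_bound (L - i)) as (K & HK & HB). exists K; split; [exact HK|].
  intros y x Hyx. destruct (HD y x Hyx) as [Hx H1].
  rewrite Cmod_mult, Cmod_pow.
  specialize (HB (RtoC x * y)%C). rewrite Cmod_scal_pos in HB by exact Hx. specialize (HB H1).
  set (m := x * Cmod y) in *.
  assert (Hm : 0 <= m) by (apply Rmult_le_pos; [lra | apply Cmod_ge_0]).
  replace (S L) with (i + S (L - i))%nat by lia. rewrite pow_add.
  rewrite <- Rmult_assoc, <- Rpow_mult_distr. fold m.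
  replace (K * (m ^ i * m ^ S (L - i))) with (m ^ i * (K * m ^ S (L - i))) by ring.
  apply Rmult_le_compat_l; [now apply pow_le | exact HB].
- exists (exp 1); split; [left; apply exp_pos|].
  intros y x Hyx. destruct (HD y x Hyx) as [Hx H1].
  rewrite Cmod_mult, Cmod_pow.
  assert (HE := Cmod_Cexp_le (RtoC x * y)). rewrite Cmod_scal_pos in HE by exact Hx.
  specialize (HE H1).
  set (m := x * Cmod y) in *.
  assert (Hm : 0 <= m) by (apply Rmult_le_pos; [lra | apply Cmod_ge_0]).
  rewrite <- Rmult_assoc, <- Rpow_mult_distr. fold m.
  rewrite (Rmult_comm (exp 1)).
  apply Rmult_le_compat; [now apply pow_le | apply Cmod_ge_0 | | exact HE].
  replace i with (S L + (i - S L))%nat by lia. rewrite pow_add.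
  rewrite <- (Rmult_1_r (m ^ S L)) at 2.
  apply Rmult_le_compat_l; [now apply pow_le|].
  rewrite <- (pow1 (i - S L)). now apply pow_incr.
Qed.

Definition q_jet (y : C) (j : nat) (x : R) : C :=
  leibniz j (z_jet y) (fun j => bose_jet y j 1) x.

Definition taylor_jet (M : nat) (y : C) (j : nat) (x : R) : C :=
  csum (fun k => RtoC (bern_fact k) * zpow_jet y k j x)%C (S M).

Definition rem_jet (M : nat) (y : C) (j : nat) (x : R) : C :=
  (q_jet y j x - taylor_jet M y j x)%C.

Lemma is_jet_q (y : C) : 0 < fst y -> is_jet (q_jet y).
Proof.
intros Hy. apply is_jet_leibniz; [apply is_jet_z|].
intros i x Hx. now apply Cderiv_bose_jet.
Qed.

Lemma is_jet_taylor (M : nat) (y : C) : is_jet (taylor_jet M y).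
Proof. apply is_jet_csum. intros k _. apply is_jet_scal, is_jet_zpow. Qed.

Lemma is_jet_rem (M : nat) (y : C) : 0 < fst y -> is_jet (rem_jet M y).
Proof. intros Hy. apply is_jet_minus; [now apply is_jet_q | apply is_jet_taylor]. Qed.

Lemma q_jet_0 (y : C) (x : R) : q_jet y 0 x = (RtoC x * y * bose (RtoC x * y))%C.
Proof. unfold q_jet; simpl; ring. Qed.

Lemma q_jet_1 (y : C) (x : R) : q_jet y 1 x = (y * (bose (RtoC x * y)
  - RtoC x * y * (bose (RtoC x * y) + bose (RtoC x * y) ^ 2)))%C.
Proof. unfold q_jet; simpl; ring. Qed.

Lemma q_jet_bound (c : R) (s : nat) : 0 < c ->
  jet_bound (fun y x => cone c y /\ 0 < x) (fun y x => / (x * Cmod y) ^ s) q_jet.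
Proof.
intros Hc.
assert (HD : forall y x, cone c y /\ 0 < x -> 0 < x) by tauto.
assert (HB : jet_bound (fun y x => cone c y /\ 0 < x) (fun y x => / (x * Cmod y) ^ S s)
  (fun y j => bose_jet y j 1)).
{ intros j. destruct (bose_jet_bound c j 1 (S s) Hc ltac:(lia)) as (K & HK & H).
  exists K; split; [exact HK|]. intros y x [Hy Hx]. specialize (H y x Hy Hx).
  assert (Hm : 0 < (x * Cmod y) ^ S s).
  { apply pow_lt, Rmult_lt_0_compat; [exact Hx|]. apply Cmod_gt_0, Hy. }
  apply (Rmult_le_reg_l _ _ _ Hm). eapply Rle_trans; [exact H|].

    clear H; match type of Hm with _ < ?a => set (m := a) in *; clearbody m end. right. field. lra. }
refine (jet_bound_weaken _ _ _ _ _ 1 Rle_0_1 _ _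
  (jet_bound_leibniz _ _ _ _ _ HD (z_jet_bound _ HD) HB)); [tauto|].
intros y x [Hy Hx]. right. simpl.
assert (Hm : 0 < x * Cmod y).
{ apply Rmult_lt_0_compat; [exact Hx|]. apply Cmod_gt_0, Hy. }
field. split; [apply pow_nonzero|]; nra.
Qed.

(** A numerator of order [M + 2] at 0 times [1 / (e^z - 1)]. In this product form the vanishing is
    visible factor by factor, while the difference of [q] and its Taylor polynomial hides it in
    cancellation. Each [z^k] is paired with the exponential remainder of the complementary order
    [M + 1 - k]. *)
Definition near_jet (M : nat) (y : C) (j : nat) (x : R) : C :=
  leibniz j (fun j x => csum (fun k => RtoC (bern_fact k) *
    leibniz j (zpow_jet y k) (exp_rem_jet y (M + 1 - k)) x)%C (S M)) (fun j => bose_jet y j 1) x.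

Lemma exp_minus_1_rem (L : nat) (z : C) : (Cexp z - 1 = exp_rem L z +
  csum (fun l => z ^ S l / RtoC (INR (fact (S l)))) L)%C.
Proof.
unfold exp_rem. rewrite (csum_shift _ L). simpl (z ^ 0)%C. simpl (INR (fact 0)). field.
Qed.

(* [(z / (e^z - 1) - T) (e^z - 1) = z - T (e^z - 1)], whose Taylor polynomial of degree
   [M + 1] vanishes by the Bernoulli recurrence. *)
Lemma rem_jet_near (M : nat) (y : C) (i : nat) (x : R) : 0 < fst y -> 0 < x ->
  rem_jet M y i x = (- (1) * near_jet M y i x)%C.
Proof.
intros Hy Hx.
apply (is_jet_unique (rem_jet M y) (fun i x => - (1) * near_jet M y i x)%C); [|
  apply is_jet_scal; unfold near_jet; apply is_jet_leibniz; [
    apply is_jet_csum; intros k _; apply is_jet_scal, is_jet_leibniz;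
      [apply is_jet_zpow | apply is_jet_exp_rem]
    | intros j t Ht; now apply Cderiv_bose_jet]| |exact Hx].
- now apply is_jet_rem.
- clear i x Hx. intros x Hx.
  unfold rem_jet, near_jet, taylor_jet. rewrite q_jet_0. cbn [leibniz].
  set (z := (RtoC x * y)%C).
  replace (bose_jet y 0 1 x) with (bose z) by (simpl; fold z; ring).
  assert (Hz : (Cexp z - 1)%C <> RtoC 0).
  { apply Cexp_minus_1_neq_0. unfold z; simpl; nra. }
  assert (Hb : (bose z * (Cexp z - 1) = 1)%C) by (unfold bose; now apply Cinv_l).
  assert (HT : csum (fun k => RtoC (bern_fact k) * zpow_jet y k 0 x)%C (S M) =
    (bose z * csum (fun k => RtoC (bern_fact k) * z ^ k * (Cexp z - 1))%C (S M))%C).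
  { rewrite <- csum_scal. apply csum_ext; intros k _. rewrite zpow_jet_0. fold z.
    transitivity (RtoC (bern_fact k) * z ^ k * (bose z * (Cexp z - 1)))%C; [rewrite Hb|]; ring. }
  rewrite HT.
  rewrite (csum_ext (fun k => RtoC (bern_fact k) * z ^ k * (Cexp z - 1))%C (fun k =>
    RtoC (bern_fact k) * (zpow_jet y k 0 x * exp_rem_jet y (M + 1 - k) 0 x) +
    RtoC (bern_fact k) * csum (fun l => z ^ (k + S l) / RtoC (INR (fact (S l)))) (M + 1 - k))%C).
  + rewrite csum_plus.
    (* With powers of [z] in place of derivatives, the part of [T * (e^z - 1)] of degree at most
       [M + 1] collapses to [z]. *)
    assert (HB := bern_fact_inverse (fun s => z ^ s)%C (M + 1) ltac:(lia)).
    replace (S (M + 1)) with (S (S M)) in HB by lia. rewrite csum_S in HB.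
    replace (M + 1 - S M)%nat with 0%nat in HB by lia.
    change (csum _ 0) with (RtoC 0) in HB. rewrite Cmult_0_r, Cplus_0_r, Cpow_1_r in HB.
    rewrite HB. ring.
  + intros k Hk. rewrite zpow_jet_0. unfold exp_rem_jet. simpl (0 <=? _)%nat. cbv iota.
    fold z. rewrite Nat.sub_0_r, (exp_minus_1_rem (M + 1 - k) z).
    rewrite (csum_ext (fun l => z ^ (k + S l) / _)%C
      (fun l => z ^ k * (z ^ S l / RtoC (INR (fact (S l)))))%C).
    * rewrite csum_scal. simpl (y ^ 0)%C. ring.
    * intros l _. rewrite Cpow_add_r. unfold Cdiv. ring.
Qed.

Lemma jet_bound_ext (D : C -> R -> Prop) (w : C -> R -> R) (a b : C -> nat -> R -> C) :
  (forall y x i, D y x -> a y i x = b y i x) -> jet_bound D w a -> jet_bound D w b.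
Proof.
intros E Ha i. destruct (Ha i) as (K & HK & H). exists K; split; [exact HK|].
intros y x Hyx. rewrite <- E by exact Hyx. now apply H.
Qed.

Lemma rem_jet_bound (c : R) (M : nat) : 0 < c ->
  jet_bound (fun y x => cone c y /\ 0 < x) (fun y x => (x * Cmod y) ^ S M) (rem_jet M).
Proof.
intros Hc.
assert (Hnear : jet_bound (fun y x => (cone c y /\ 0 < x) /\ x * Cmod y <= 1)
  (fun y x => (x * Cmod y) ^ S M) (rem_jet M)).
{ set (D := fun y x => (cone c y /\ 0 < x) /\ x * Cmod y <= 1).
  assert (HD : forall y x, D y x -> 0 < x) by (unfold D; tauto).
  (* A one-term sum, so that [jet_bound_csum] supplies the scalar factor. *)
  apply (jet_bound_ext _ _ (fun y i x => csum (fun _ => - (1) * near_jet M y i x)%C 1)).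
  { intros y x i [[Hy Hx] _]. simpl. rewrite rem_jet_near; [ring| |exact Hx].
    now apply (cone_re c). }
  apply jet_bound_csum; [exact HD|]. intros _ _.
  assert (HB : jet_bound D (fun y x => / (x * Cmod y)) (fun y j => bose_jet y j 1)).
  { intros j. destruct (bose_jet_bound c j 1 1 Hc ltac:(lia)) as (K & HK & H).
    exists K; split; [exact HK|]. intros y x [[Hy Hx] _]. specialize (H y x Hy Hx).
    rewrite pow_1 in H.
    assert (Hm : 0 < x * Cmod y).
    { apply Rmult_lt_0_compat; [exact Hx|]. apply Cmod_gt_0, Hy. }
    apply (Rmult_le_reg_l _ _ _ Hm). eapply Rle_trans; [exact H|].

    clear H; match type of Hm with _ < ?a => set (m := a) in *; clearbody m end. right. field. lra. }
  assert (HN : jet_bound D (fun y x => (x * Cmod y) ^ S (S M))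
    (fun y j x => csum (fun k => RtoC (bern_fact k) *
      leibniz j (zpow_jet y k) (exp_rem_jet y (M + 1 - k)) x)%C (S M))).
  { apply (jet_bound_csum D _ (fun k => RtoC (bern_fact k))
      (fun k y j x => leibniz j (zpow_jet y k) (exp_rem_jet y (M + 1 - k)) x)); [exact HD|].
    intros k Hk.
    refine (jet_bound_weaken _ _ _ _ _ 1 Rle_0_1 _ _ (jet_bound_leibniz _ _ _ _ _ HD
      (zpow_jet_bound _ k HD) (exp_rem_jet_bound D (M + 1 - k) _))); [tauto| |].
    - intros y x _. right. rewrite <- pow_add, Rmult_1_l. f_equal. lia.
    - unfold D; tauto. }
  refine (jet_bound_weaken _ _ _ _ _ 1 Rle_0_1 _ _
    (jet_bound_leibniz _ _ _ _ _ HD HN HB)); [tauto|].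
  intros y x [[Hy Hx] _]. right. simpl.
  assert (Hm : 0 < x * Cmod y).
  { apply Rmult_lt_0_compat; [exact Hx|]. apply Cmod_gt_0, Hy. }
  field. nra. }
assert (Hfar : jet_bound (fun y x => (cone c y /\ 0 < x) /\ 1 <= x * Cmod y)
  (fun y x => (x * Cmod y) ^ S M) (rem_jet M)).
{ set (D := fun y x => (cone c y /\ 0 < x) /\ 1 <= x * Cmod y).
  assert (HD : forall y x, D y x -> 0 < x) by (unfold D; tauto).
  assert (H1 : forall y x, D y x -> 1 <= (x * Cmod y) ^ S M).
  { intros y x [_ H]. now apply pow_R1_Rle. }
  (* The difference [q - T] as a two-term sum with coefficients [1] and [-1], again for
     [jet_bound_csum]. *)
  apply (jet_bound_ext _ _ (fun y i x =>
    csum (fun k => RtoC (if k =? 0 then 1 else -1) *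
      (if k =? 0 then q_jet y i x else taylor_jet M y i x))%C 2)).
  { intros y x i _. simpl. unfold rem_jet. ring. }
  apply (jet_bound_csum D _ (fun k => RtoC (if k =? 0 then 1 else -1))
    (fun k y i x => if k =? 0 then q_jet y i x else taylor_jet M y i x)); [exact HD|].
  intros [|k] _; cbn [Nat.eqb].
  - refine (jet_bound_weaken _ _ _ _ _ 1 Rle_0_1 _ _ (q_jet_bound c 0 Hc)).
    + unfold D; tauto.
    + intros y x Hyx. specialize (H1 y x Hyx). rewrite pow_O, Rinv_1. lra.
  - apply (jet_bound_csum D _ (fun k => RtoC (bern_fact k)) (fun k y => zpow_jet y k));
      [exact HD|].
    intros i Hi.
    refine (jet_bound_weaken _ _ _ _ _ 1 Rle_0_1 _ _ (zpow_jet_bound D i HD)); [tauto|].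
    intros y x [_ H]. rewrite Rmult_1_l. apply Rle_pow; [exact H | lia]. }
intros i. destruct (Hnear i) as (K & HK & H), (Hfar i) as (L & HL & H').
exists (K + L); split; [lra|]. intros y x Hyx.
assert (Hm : 0 <= (x * Cmod y) ^ S M).
{ apply pow_le, Rmult_le_pos; [lra | apply Cmod_ge_0]. }
destruct (Rle_dec (x * Cmod y) 1) as [H1|H1].
- specialize (H y x (conj Hyx H1)). nra.
- specialize (H' y x (conj Hyx (Rlt_le _ _ (Rnot_le_lt _ _ H1)))). nra.
Qed.

(** * Uniform summation of [ln n * q'(n y)], where [q z = z / (e^z - 1)] *)

Definition ln_jet (i : nat) (x : R) : C := RtoC (pow_ln_jet 0 (S i) x).

Lemma is_jet_ln : is_jet ln_jet.
Proof. intros i x Hx. now apply Cderiv_RtoC, is_derive_pow_ln_jet. Qed.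

Lemma ln_jet_0 (x : R) : ln_jet 0 x = RtoC (ln x).
Proof. unfold ln_jet. rewrite pow_ln_jet_1. f_equal. simpl; ring. Qed.

Lemma ln_le_self (x : R) : 0 < x -> ln x <= x.
Proof.
intros Hx. apply Rlt_le, exp_lt_inv. rewrite exp_ln by exact Hx.
generalize (exp_ineq1 x); lra.
Qed.

Lemma ln_ge_0 (x : R) : 1 <= x -> 0 <= ln x.
Proof. intros Hx. rewrite <- ln_1. destruct Hx as [Hx| <-]; [left; apply ln_increasing; lra | lra]. Qed.

Lemma ln_jet_bound (D : C -> R -> Prop) : (forall y x, D y x -> 1 <= x) ->
  jet_bound D (fun _ x => x) (fun _ => ln_jet).
Proof.
intros HD [|i].
- exists 1; split; [lra|]. intros y x Hyx. specialize (HD y x Hyx).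
  rewrite ln_jet_0, Cmod_R, Rabs_pos_eq by now apply ln_ge_0.
  generalize (ln_le_self x); simpl; lra.
- exists (INR (fact i)); split; [apply pos_INR|]. intros y x Hyx. specialize (HD y x Hyx).
  unfold ln_jet. rewrite Cmod_R. replace (S (S i)) with (0 + 2 + i)%nat by lia.
  rewrite pow_ln_jet_gt. unfold Rdiv. rewrite !Rabs_mult, pow_1_abs, Rmult_1_r.
  simpl (INR (fact 0)). rewrite Rabs_R1, Rmult_1_l, (Rabs_pos_eq (INR _)) by apply pos_INR.
  assert (Hp : 0 < x ^ S i) by (apply pow_lt; lra).
  rewrite Rabs_pos_eq by (left; now apply Rinv_0_lt_compat).
  replace (x ^ S i * (INR (fact i) * / x ^ S i)) with (INR (fact i) * 1) by (field; lra).
  apply Rmult_le_compat_l; [apply pos_INR | exact HD].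
Qed.

Lemma fst_scal (x : R) (y : C) : fst (RtoC x * y)%C = x * fst y.
Proof. simpl; ring. Qed.

(** * The logarithm of 1 - e^(-z) and its Taylor remainder *)

Definition log_1mexp (z : C) : C := Clog (1 - Cexp (- z)).

Lemma one_minus_Cexp_re (z : C) : 0 < fst z -> 0 < fst (1 - Cexp (- z))%C.
Proof.
intros Hz. assert (H := Rabs_fst_le_Cmod (Cexp (- z))).
rewrite Cmod_Cexp in H. simpl (fst (- z)%C) in H.
assert (H1 : exp (- fst z) < 1) by (rewrite <- exp_0; apply exp_increasing; lra).
assert (H2 := Rle_abs (fst (Cexp (- z)))).
change (fst (1 - Cexp (- z))%C) with (1 + - fst (Cexp (- z))). lra.
Qed.

(** For [Re z > 0] the value [1 - e^(-z)] stays in the right half-plane, where the principal branch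
    is smooth; then [e^(-z) / (1 - e^(-z)) = 1 / (e^z - 1)]. *)
Lemma Cderiv_log_1mexp (F : R -> C) (x : R) (a : C) : 0 < fst (F x) -> Cderiv F x a ->
  Cderiv (fun t => log_1mexp (F t)) x (a * bose (F x))%C.
Proof.
intros Hx HF. unfold log_1mexp.
assert (H0 : (1 - Cexp (- F x))%C <> RtoC 0).
{ intros E. generalize (one_minus_Cexp_re _ Hx). rewrite E. simpl; lra. }
assert (H1 := Cexp_minus_1_neq_0 _ Hx).
assert (HE : (Cexp (F x) * Cexp (- F x) = 1)%C).
{ rewrite <- Cexp_plus. rewrite Cplus_opp_r. apply Cexp_0. }
eapply Cderiv_eq.
- apply Cderiv_log; [now apply one_minus_Cexp_re|].
  apply Cderiv_minus; [apply Cderiv_const | apply Cderiv_exp, Cderiv_opp, HF].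
- cbv beta. unfold bose.
  transitivity (a * (Cexp (- F x) / (1 - Cexp (- F x))))%C; [field; exact H0|].
  f_equal.
  transitivity (Cexp (- F x) * (Cexp (F x) - 1) / ((1 - Cexp (- F x)) * (Cexp (F x) - 1)))%C.
  + field; now split.
  + replace (Cexp (- F x) * (Cexp (F x) - 1))%C with (Cexp (F x) * Cexp (- F x) - Cexp (- F x))%C
      by ring.
    rewrite HE. field; now split.
Qed.

(** An antiderivative of [rem_jet M y 0 x / x], normalized to vanish as [x] tends to 0. The sum is
    the Taylor polynomial of [log ((1 - e^(-z)) / z)]. *)
Definition log_rem (M : nat) (y : C) (x : R) : C :=
  (log_1mexp (RtoC x * y) - Clog (RtoC x * y)
   - csum (fun k => RtoC (bern_fact (S k) / INR (S k)) * (RtoC x * y) ^ S k) M)%C.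

Lemma rem_jet_0 (M : nat) (y : C) (x : R) : rem_jet M y 0 x =
  (RtoC x * y * bose (RtoC x * y) - 1
   - csum (fun k => RtoC (bern_fact (S k)) * (RtoC x * y) ^ S k) M)%C.
Proof.
unfold rem_jet, taylor_jet. rewrite q_jet_0, csum_shift, bern_fact_0.
rewrite (csum_ext _ (fun k => RtoC (bern_fact (S k)) * (RtoC x * y) ^ S k)%C).
- simpl; ring.
- intros k _. now rewrite zpow_jet_0.
Qed.

Lemma Cderiv_log_rem (M : nat) (y : C) (x : R) : 0 < fst y -> 0 < x ->
  Cderiv (log_rem M y) x (rem_jet M y 0 x / RtoC x)%C.
Proof.
intros Hy Hx. unfold log_rem.
assert (Hz : 0 < fst (RtoC x * y)%C) by (simpl; nra).
assert (Hx0 : RtoC x <> RtoC 0) by (intros E; apply RtoC_inj in E; lra).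
assert (Hy0 : y <> RtoC 0) by (intros E; rewrite E in Hy; simpl in Hy; lra).
eapply Cderiv_eq.
- apply Cderiv_minus; [apply Cderiv_minus|].
  + apply (Cderiv_log_1mexp (fun t => RtoC t * y)%C); [exact Hz | apply Cderiv_ray].
  + apply (Cderiv_log (fun t => RtoC t * y)%C); [exact Hz | apply Cderiv_ray].
  + apply Cderiv_csum. intros k _. apply Cderiv_scal, Cderiv_pow, Cderiv_ray.
- cbv beta. rewrite rem_jet_0.
  rewrite (csum_ext (fun i => RtoC (bern_fact (S i) / INR (S i)) * _)%C
    (fun k => / RtoC x * (RtoC (bern_fact (S k)) * (RtoC x * y) ^ S k))%C).
  + rewrite csum_scal. field. now split.
  + intros k _. assert (Hk := INR_S_pos k).
    rewrite RtoC_div, Cpow_S by lra. field. split; [exact Hx0|].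
    intros E; apply RtoC_inj in E; lra.
Qed.

Lemma derive_lim_seq (f : R -> R) (l : R) : is_derive f 0 l ->
  is_lim_seq (fun n => (f (/ INR (S n)) - f 0) * INR (S n)) l.
Proof.
intros Hd. apply is_derive_Reals in Hd.
apply is_lim_seq_Reals. intros eps Heps.
destruct (Hd eps Heps) as [[d Hd0] H]. simpl in H.
assert (Hl := is_lim_seq_inv_INR_S). apply is_lim_seq_Reals in Hl.
destruct (Hl d Hd0) as [N HN]. exists N. intros n Hn.
specialize (HN n Hn). unfold Rdist in HN. rewrite Rminus_0_r in HN.
assert (Hp := INR_S_pos n). assert (Hi := Rinv_0_lt_compat _ Hp).
specialize (H (/ INR (S n)) ltac:(lra) HN).
rewrite Rplus_0_l in H. unfold Rdist.
replace ((f (/ INR (S n)) - f 0) / / INR (S n)) with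
  ((f (/ INR (S n)) - f 0) * INR (S n)) in H by (field; lra). exact H.
Qed.

Lemma Clog_lim_seq (w : nat -> C) (y : C) : 0 < fst y -> (forall n, 0 < fst (w n)) ->
  is_lim_seq (fun n => fst (w n)) (fst y) -> is_lim_seq (fun n => snd (w n)) (snd y) ->
  is_lim_seq (fun n => Cmod (Clog (w n) - Clog y)) 0.
Proof.
intros Hy Hw H1 H2.
assert (L1 : is_lim_seq (fun n => fst (Clog (w n))) (fst (Clog y))).
{ rewrite Clog_right by exact Hy.
  apply (is_lim_seq_ext (fun n => ln (fst (w n) ^ 2 + snd (w n) ^ 2) / 2)).
  { intros n; now rewrite Clog_right. }
  simpl fst. apply (is_lim_seq_scal_r _ (/ 2) (ln (fst y ^ 2 + snd y ^ 2))).
  apply (is_lim_seq_continuous ln).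
  - apply continuity_pt_filterlim, (ex_derive_continuous ln).
    exists (/ (fst y ^ 2 + snd y ^ 2)). apply is_derive_ln. nra.
  - apply is_lim_seq_plus'; simpl; apply is_lim_seq_mult'; try assumption;
      apply is_lim_seq_mult'; try assumption; apply is_lim_seq_const. }
assert (L2 : is_lim_seq (fun n => snd (Clog (w n))) (snd (Clog y))).
{ rewrite Clog_right by exact Hy.
  apply (is_lim_seq_ext (fun n => atan (snd (w n) / fst (w n)))).
  { intros n; now rewrite Clog_right. }
  simpl snd. apply (is_lim_seq_continuous atan).
  - apply continuity_pt_filterlim, (ex_derive_continuous atan).
    eexists. apply is_derive_atan.
  - apply is_lim_seq_div'; [assumption | assumption | lra]. }
apply (is_lim_seq_le_le (fun _ => 0) _ (fun n =>
  Rabs (fst (Clog (w n)) - fst (Clog y)) + Rabs (snd (Clog (w n)) - snd (Clog y)))).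
- intros n; split; [apply Cmod_ge_0 | apply Cmod_le_plus].
- apply is_lim_seq_const.
- replace (Finite 0) with (Finite (Rabs (fst (Clog y) - fst (Clog y)) +
    Rabs (snd (Clog y) - snd (Clog y)))).
  + apply is_lim_seq_plus'; apply (is_lim_seq_abs _ (Finite _)), is_lim_seq_minus';
      (assumption || apply is_lim_seq_const).
  + rewrite !Rminus_diag, Rabs_R0. f_equal; ring.
Qed.

(** The two logarithms differ by [Clog (w n) - Clog y], and [w n] tends to [y], being a difference
    quotient of [- e^(-x y)] at 0. Positive scalars pass through [Clog] without a branch jump. *)
Lemma log_rem_lim (M : nat) (y : C) : 0 < fst y ->
  is_lim_seq (fun n => Cmod (log_rem M y (/ INR (S n)))) 0.
Proof.
intros Hy.
set (w := fun n => (RtoC (INR (S n)) * (1 - Cexp (- (RtoC (/ INR (S n)) * y))))%C).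
assert (Hx : forall n, 0 < / INR (S n)) by (intros; apply Rinv_0_lt_compat, INR_S_pos).
assert (Hw : forall n, 0 < fst (w n)).
{ intros n. unfold w. assert (H := one_minus_Cexp_re (RtoC (/ INR (S n)) * y)).
  assert (0 < fst (RtoC (/ INR (S n)) * y)%C) by (rewrite fst_scal; now apply Rmult_lt_0_compat).
  specialize (H H0). assert (Hp := INR_S_pos n).
  rewrite fst_scal. now apply Rmult_lt_0_compat. }
assert (Hd : Cderiv (fun t => - Cexp (- (RtoC t * y)))%C 0 y).
{ eapply Cderiv_eq; [apply Cderiv_opp, Cderiv_exp, Cderiv_opp, Cderiv_ray|].
  cbv beta. rewrite Cmult_0_l. replace (- 0)%C with (RtoC 0) by ring. rewrite Cexp_0. ring. }
destruct Hd as [Hd1 Hd2]. apply derive_lim_seq in Hd1. apply derive_lim_seq in Hd2.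
assert (E0 : Cexp (- (RtoC 0 * y)) = RtoC 1).
{ rewrite Cmult_0_l. replace (- 0)%C with (RtoC 0) by ring. apply Cexp_0. }
assert (HL := Clog_lim_seq w y Hy Hw).
specialize (HL ltac:(revert Hd1; apply is_lim_seq_ext; intros n; rewrite E0;
  unfold w; simpl; ring)).
specialize (HL ltac:(revert Hd2; apply is_lim_seq_ext; intros n; rewrite E0;
  unfold w; simpl; ring)).
apply (is_lim_seq_le_le (fun _ => 0) _ (fun n => Cmod (Clog (w n) - Clog y) +
  rsum (fun k => Rabs (bern_fact (S k) / INR (S k)) * Cmod y ^ S k * (/ INR (S n))) M)).
- intros n; split; [apply Cmod_ge_0|].
  assert (E : log_rem M y (/ INR (S n)) = ((Clog (w n) - Clog y) +
    - csum (fun k => RtoC (bern_fact (S k) / INR (S k)) * (RtoC (/ INR (S n)) * y) ^ S k) M)%C).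
  { unfold log_rem, log_1mexp.
    replace (1 - Cexp (- (RtoC (/ INR (S n)) * y)))%C with (RtoC (/ INR (S n)) * w n)%C.
    - rewrite !Clog_scal by auto. ring.
    - unfold w. rewrite Cmult_assoc, <- RtoC_mult, Rinv_l, Cmult_1_l; [reflexivity|].
      apply Rgt_not_eq, INR_S_pos. }
  rewrite E. eapply Rle_trans; [apply Cmod_triangle|]. apply Rplus_le_compat_l.
  rewrite Cmod_opp. eapply Rle_trans; [apply Cmod_csum|]. apply rsum_le. intros k _.
  rewrite Cmod_mult, Cmod_R, Cmod_pow, Cmod_scal_pos, Rpow_mult_distr by auto.
  rewrite Rmult_assoc. apply Rmult_le_compat_l; [apply Rabs_pos|].
  rewrite Rmult_comm. apply Rmult_le_compat_l; [apply pow_le, Cmod_ge_0|].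
  assert (H1 : / INR (S n) <= 1).
  { rewrite <- Rinv_1. apply Rinv_le_contravar; [lra | apply INR_S_ge1]. }
  specialize (Hx n). set (r := / INR (S n)) in *.
  assert (r ^ k <= 1) by (rewrite <- (pow1 k); apply pow_incr; lra).
  change (r ^ S k) with (r * r ^ k). nra.
- apply is_lim_seq_const.
- replace (Finite 0) with (Finite (0 + rsum (fun k => Rabs (bern_fact (S k) / INR (S k)) *
    Cmod y ^ S k * 0) M)).
  + apply is_lim_seq_plus'; [exact HL|].
    apply is_lim_seq_rsum. intros k _. apply is_lim_seq_mult';
      [apply is_lim_seq_const | apply is_lim_seq_inv_INR_S].
  + rewrite rsum_0 by (intros; ring). f_equal; ring.
Qed.

(** The derivative is at most [K * t^M * |y|^(M+1)] on [(0, 1]]. It is integrated from [1 / (n + 1)]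
    to [1], and the lower end drops out by [log_rem_lim]. *)
Lemma log_rem_bound (c : R) (M : nat) : 0 < c -> exists K, 0 <= K /\
  forall y, cone c y -> Cmod (log_rem M y 1) <= K * Cmod y ^ S M.
Proof.
intros Hc. destruct (rem_jet_bound c M Hc O) as (K & HK & H).
exists (2 * K). split; [lra|]. intros y Hy.
assert (Hre := cone_re c y Hc Hy). assert (Hm := Cmod_ge_0 y).
assert (HB : forall n, Cmod (log_rem M y 1) <=
  Cmod (log_rem M y (/ INR (S n))) + 2 * K * Cmod y ^ S M).
{ intros n.
  assert (Hx : 0 < / INR (S n)) by apply Rinv_0_lt_compat, INR_S_pos.
  assert (H1 : / INR (S n) <= 1).
  { rewrite <- Rinv_1. apply Rinv_le_contravar; [lra | apply INR_S_ge1]. }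
  assert (HM := Cderiv_MVT (log_rem M y) (fun x => rem_jet M y 0 x / RtoC x)%C
    (/ INR (S n)) 1 (K * Cmod y ^ S M) H1).
  assert (HM' := HM ltac:(intros t Ht; apply Cderiv_log_rem; lra)). clear HM.
  assert (HT := Cmod_triangle (log_rem M y (/ INR (S n)))
    (log_rem M y 1 - log_rem M y (/ INR (S n)))).
  replace (log_rem M y (/ INR (S n)) + (log_rem M y 1 - log_rem M y (/ INR (S n))))%C
    with (log_rem M y 1) in HT by ring.
  eapply Rle_trans; [exact HT|]. apply Rplus_le_compat_l.
  assert (HKm : 0 <= K * Cmod y ^ S M) by (apply Rmult_le_pos; [lra | now apply pow_le]).
  eapply Rle_trans; [apply HM'|].
  - intros t Ht. assert (Ht0 : 0 < t) by lra. rewrite Cmod_div, Cmod_R, Rabs_pos_eq by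
      (lra || (intros E; apply RtoC_inj in E; lra)).
    specialize (H y t (conj Hy Ht0)).
    rewrite pow_O, Rmult_1_l, Rpow_mult_distr in H.
    apply (Rmult_le_reg_l t); [lra|].
    replace (t * (Cmod (rem_jet M y 0 t) / t)) with (Cmod (rem_jet M y 0 t)) by (field; lra).
    eapply Rle_trans; [exact H|].
    assert (t ^ M <= 1) by (rewrite <- (pow1 M); apply pow_incr; lra).
    assert (0 <= t ^ M) by (apply pow_le; lra).
    replace (K * (t ^ S M * Cmod y ^ S M)) with (t * (K * Cmod y ^ S M) * t ^ M) by (simpl; ring).
    rewrite <- (Rmult_1_r (t * (K * Cmod y ^ S M))) at 2.
    apply Rmult_le_compat_l; [|lra]. apply Rmult_le_pos; lra.
  - replace (2 * K * Cmod y ^ S M) with (2 * (K * Cmod y ^ S M) * 1) by ring.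
    apply Rmult_le_compat_l; lra. }
assert (HL := log_rem_lim M y Hre).
apply (is_lim_seq_le (fun _ => Cmod (log_rem M y 1)) _
  (Cmod (log_rem M y 1)) (0 + 2 * K * Cmod y ^ S M)) in HB.
- simpl in HB. simpl. lra.
- apply is_lim_seq_const.
- apply is_lim_seq_plus'; [exact HL | apply is_lim_seq_const].
Qed.

(** Entry 0 integrates [ln x] times the derivative of the remainder by parts: the subtracted
    [log_rem] is the integral of remainder over [x]. From entry 1 on the jet is a plain product. *)
Definition rem_em_jet (M : nat) (y : C) (i : nat) (x : R) : C :=
  match i with
  | O => (RtoC (ln x) * rem_jet M y 0 x - log_rem M y x)%C
  | S i => leibniz i ln_jet (fun j => rem_jet M y (S j)) x
  end.

Definition full_em_jet (y : C) (i : nat) (x : R) : C :=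
  match i with
  | O => (RtoC (ln x) * q_jet y 0 x - log_1mexp (RtoC x * y))%C
  | S i => leibniz i ln_jet (fun j => q_jet y (S j)) x
  end.

Lemma is_jet_rem_em (M : nat) (y : C) : 0 < fst y -> is_jet (rem_em_jet M y).
Proof.
intros Hy [|i] x Hx.
- assert (Hx0 : RtoC x <> RtoC 0) by (intros E; apply RtoC_inj in E; lra).
  eapply Cderiv_eq.
  + apply Cderiv_minus; [apply Cderiv_mult|].
    * apply Cderiv_RtoC, is_derive_ln, Hx.
    * now apply is_jet_rem.
    * now apply Cderiv_log_rem.
  + simpl. rewrite ln_jet_0, RtoC_inv by lra. field. exact Hx0.
- apply (is_jet_leibniz ln_jet (fun j => rem_jet M y (S j)));
    [apply is_jet_ln | intros j t Ht; now apply is_jet_rem | exact Hx].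
Qed.

(** The coefficient of [x ^ k * y ^ S k] in the [x]-derivative of the Taylor polynomial of
    [q (x y)]. *)
Definition pow_ln_coeff (k : nat) : R := bern_fact (S k) * INR (S k).

(** Entries from 1 on follow from entry 1 by uniqueness of jets. At entry 0, [log (1 - e^(-x y))]
    contains [Clog (x y) = ln x + Clog y]: the [ln x] cancels against the constant term of [q], and
    [Clog y] is left as a constant of integration. *)
Lemma full_em_jet_decomp (M : nat) (y : C) (i : nat) (x : R) : 0 < fst y -> 0 < x ->
  full_em_jet y i x = (rem_em_jet M y i x +
    csum (fun k => RtoC (pow_ln_coeff k) * y ^ S k * RtoC (pow_ln_jet k i x)) M
    - match i with O => Clog y | _ => 0 end)%C.
Proof.
intros Hy Hx. destruct i as [|i].
- cbn [full_em_jet rem_em_jet]. unfold log_rem. rewrite rem_jet_0, q_jet_0, (Clog_scal x y Hx Hy).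
  rewrite (csum_ext (fun k => RtoC (pow_ln_coeff k) * _ * _)%C (fun k =>
    RtoC (ln x) * (RtoC (bern_fact (S k)) * (RtoC x * y) ^ S k)
    - RtoC (bern_fact (S k) / INR (S k)) * (RtoC x * y) ^ S k)%C).
  + rewrite csum_minus, csum_scal. ring.
  + intros k _. replace (pow_ln_jet k 0 x) with
      (x ^ S k * (ln x / INR (S k) - / INR (S k) / INR (S k))).
    * unfold pow_ln_coeff. rewrite Cpow_mult_l, <- RtoC_pow.
      assert (Hk := INR_S_pos k).
      transitivity (RtoC (bern_fact (S k) * INR (S k) *
        (x ^ S k * (ln x / INR (S k) - / INR (S k) / INR (S k)))) * y ^ S k)%C;
        [rewrite !RtoC_mult; ring|].
      transitivity (RtoC (ln x * (bern_fact (S k) * x ^ S k) -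
        bern_fact (S k) / INR (S k) * x ^ S k) * y ^ S k)%C;
        [|rewrite RtoC_minus, !RtoC_mult; ring].
      f_equal. f_equal. field. lra.
    * replace 0%nat with (S k - S k)%nat at 1 by lia.
      rewrite pow_ln_jet_le, harmonic_S, fact_simpl, mult_INR by lia.
      assert (Hk := INR_S_pos k). assert (Hf := INR_fact_neq_0 k). field. lra.
- revert x Hx. apply (is_jet_unique (fun i => full_em_jet y (S i)) (fun i x => rem_em_jet M y (S i) x +
    csum (fun k => RtoC (pow_ln_coeff k) * y ^ S k * RtoC (pow_ln_jet k (S i) x)) M - 0)%C).
  + apply (is_jet_leibniz ln_jet (fun j => q_jet y (S j)));
      [apply is_jet_ln | intros j t Ht; now apply is_jet_q].
  + apply is_jet_minus; [apply is_jet_plus|].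
    * intros j t Ht. now apply (is_jet_rem_em M y Hy (S j)).
    * apply (is_jet_csum (fun k i x => RtoC (pow_ln_coeff k) * y ^ S k *
        RtoC (pow_ln_jet k (S i) x))%C). intros k _. apply is_jet_scal.
      intros j t Ht. apply Cderiv_RtoC, is_derive_pow_ln_jet, Ht.
    * intros j t _. apply Cderiv_const.
  + intros x Hx. cbn [full_em_jet rem_em_jet leibniz]. rewrite ln_jet_0. unfold rem_jet, taylor_jet.
    rewrite csum_shift, zpow_jet_1 by exact Hx.
    rewrite (csum_ext (fun k => RtoC (bern_fact (S k)) * _)%C (fun k =>
      RtoC (pow_ln_coeff k) * y ^ S k * RtoC (x ^ k))%C).
    * rewrite (csum_ext (fun k => RtoC (pow_ln_coeff k) * y ^ S k * RtoC (pow_ln_jet k _ x))%C (fun k =>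
        RtoC (ln x) * (RtoC (pow_ln_coeff k) * y ^ S k * RtoC (x ^ k)))%C).
      -- rewrite csum_scal. change (INR 0) with 0. ring.
      -- intros k _. rewrite pow_ln_jet_1, RtoC_mult. ring.
    * intros k _. rewrite zpow_jet_1 by exact Hx. replace (S k - 1)%nat with k by lia.
      unfold pow_ln_coeff. rewrite RtoC_mult. ring.
Qed.

Lemma csum_swap (f : nat -> nat -> C) (m n : nat) :
  csum (fun i => csum (fun k => f i k) m) n = csum (fun k => csum (fun i => f i k) n) m.
Proof.
induction n as [|n IH].
- simpl. rewrite (csum_ext _ (fun _ => RtoC 0 * RtoC 0)%C) by (intros; simpl; ring).
  rewrite csum_scal. ring.
- simpl. rewrite IH, <- csum_plus. reflexivity.
Qed.

Lemma euler_maclaurin_decomp (M p : nat) (y : C) (x : R) : 0 < fst y -> 0 < x ->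
  euler_maclaurin p (fun i => full_em_jet y i x) =
  (euler_maclaurin p (fun i => rem_em_jet M y i x)
   + csum (fun k => RtoC (pow_ln_coeff k) * y ^ S k *
       RtoC (euler_maclaurin_R p (fun i => pow_ln_jet k i x))) M - Clog y)%C.
Proof.
intros Hy Hx. unfold euler_maclaurin.
rewrite (csum_ext _ (fun i => (RtoC (bern_fact i) * rem_em_jet M y i x +
  csum (fun k => RtoC (pow_ln_coeff k) * y ^ S k * RtoC (bern_fact i * pow_ln_jet k i x)) M)
  - RtoC (bern_fact i) * match i with O => Clog y | _ => 0 end)%C).
- rewrite csum_minus, csum_plus, csum_swap. f_equal; [f_equal|].
  + apply csum_ext; intros k _. rewrite csum_scal, csum_RtoC. reflexivity.
  + rewrite csum_shift, bern_fact_0, (csum_ext _ (fun _ => RtoC 0 * RtoC 0)%C) by (intros; ring).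
    rewrite csum_scal. ring.
- intros i _. rewrite (full_em_jet_decomp M) by assumption.
  rewrite (csum_ext (fun k => _ * RtoC (bern_fact i * pow_ln_jet k i x))%C
    (fun k => RtoC (bern_fact i) * (RtoC (pow_ln_coeff k) * y ^ S k * RtoC (pow_ln_jet k i x)))%C)
    by (intros; rewrite RtoC_mult; ring).
  rewrite csum_scal. ring.
Qed.

Lemma rem_em_jet_bound (c : R) (M : nat) : 0 < c -> forall i, exists K, 0 <= K /\
  forall y x, cone c y -> 1 <= x ->
  x ^ i * Cmod (rem_em_jet M y (S i) x) <= K * (x * Cmod y) ^ S M.
Proof.
intros Hc i.
set (D := fun y x => cone c y /\ 1 <= x).
assert (HD : forall y x, D y x -> 0 < x) by (unfold D; intros y x []; lra).
assert (H1 : jet_bound D (fun y x => x) (fun _ => ln_jet)).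
{ apply ln_jet_bound. unfold D; tauto. }
assert (H2 : jet_bound D (fun y x => (x * Cmod y) ^ S M / x) (fun y j => rem_jet M y (S j))).
{ apply jet_bound_shift; [exact HD|].
  refine (jet_bound_weaken _ _ _ _ _ 1 Rle_0_1 _ _ (rem_jet_bound c M Hc)).
  - intros y x [? ?]; split; [assumption|lra].
  - intros; lra. }
destruct (jet_bound_leibniz _ _ _ _ _ HD H1 H2 i) as (K & HK & H).
exists K; split; [exact HK|]. intros y x Hy Hx. specialize (H y x (conj Hy Hx)).
replace (x * ((x * Cmod y) ^ S M / x)) with ((x * Cmod y) ^ S M) in H by (field; lra).
exact H.
Qed.

Lemma full_em_jet_bound (c : R) : 0 < c -> forall i, exists K, 0 <= K /\
  forall y x, cone c y -> 1 <= x ->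
  x ^ i * Cmod (full_em_jet y (S i) x) <= K * / (x * Cmod y) ^ 2.
Proof.
intros Hc i.
set (D := fun y x => cone c y /\ 1 <= x).
assert (HD : forall y x, D y x -> 0 < x) by (unfold D; intros y x []; lra).
assert (H1 : jet_bound D (fun y x => x) (fun _ => ln_jet)).
{ apply ln_jet_bound. unfold D; tauto. }
assert (H2 : jet_bound D (fun y x => / (x * Cmod y) ^ 2 / x) (fun y j => q_jet y (S j))).
{ apply (jet_bound_shift D (fun y x => / (x * Cmod y) ^ 2)); [exact HD|].
  refine (jet_bound_weaken _ _ _ _ _ 1 Rle_0_1 _ _ (q_jet_bound c 2 Hc)).
  - intros y x [? ?]; split; [assumption|lra].
  - intros; lra. }
destruct (jet_bound_leibniz _ _ _ _ _ HD H1 H2 i) as (K & HK & H).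
exists K; split; [exact HK|]. intros y x Hy Hx. specialize (H y x (conj Hy Hx)).
replace (x * (/ (x * Cmod y) ^ 2 / x)) with (/ (x * Cmod y) ^ 2) in H; [exact H|].
assert (Hm : Cmod y <> 0) by (apply Rgt_not_eq, Cmod_gt_0, Hy). field. lra.
Qed.

Lemma Cmod_Clog_1_minus (w : C) : Cmod w <= / 2 -> Cmod (Clog (1 - w)) <= 4 * Cmod w.
Proof.
intros Hw.
assert (Hb : forall t, 0 <= t <= 1 -> / 2 <= fst (1 - RtoC t * w)%C).
{ intros t Ht. change (fst (1 - RtoC t * w)%C) with (1 + - fst (RtoC t * w)%C).
  rewrite fst_scal. assert (H := Rabs_fst_le_Cmod w). assert (H1 := Rle_abs (fst w)).
  assert (H2 := Cmod_ge_0 w). nra. }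
assert (HM := Cderiv_MVT (fun t => Clog (1 - RtoC t * w)) (fun t => - w / (1 - RtoC t * w))%C
  0 1 (2 * Cmod w)).
cbv beta in HM. rewrite Cmult_0_l, Cmult_1_l in HM.
replace (1 - 0)%C with (RtoC 1) in HM by ring.
rewrite (Clog_RtoC 1), ln_1 in HM by lra.
replace (Clog (1 - w) - 0)%C with (Clog (1 - w)) in HM by ring.
replace (4 * Cmod w) with (2 * (2 * Cmod w) * (1 - 0)) by ring.
apply HM; [lra| |]; intros t Ht; specialize (Hb t Ht).
- eapply Cderiv_eq.
  + apply (Cderiv_log (fun t => 1 - RtoC t * w)%C); [lra|].
    apply Cderiv_minus; [apply Cderiv_const | apply Cderiv_ray].
  + cbv beta. f_equal. ring.
- assert (H1 : (1 - RtoC t * w)%C <> RtoC 0) by (intros E; rewrite E in Hb; simpl in Hb; lra).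
  rewrite Cmod_div, Cmod_opp by exact H1.
  assert (H2 := Rabs_fst_le_Cmod (1 - RtoC t * w)). assert (H3 := Rle_abs (fst (1 - RtoC t * w)%C)).
  assert (H4 : / Cmod (1 - RtoC t * w) <= 2).
  { rewrite <- (Rinv_inv 2). apply Rinv_le_contravar; lra. }
  unfold Rdiv. rewrite Rmult_comm. apply Rmult_le_compat_r; [apply Cmod_ge_0 | exact H4].
Qed.

Lemma log_1mexp_bound (c r : R) (y : C) (x : R) : 0 < c -> 0 < r -> cone c y -> r <= Cmod y ->
  2 <= c * r * x -> Cmod (log_1mexp (RtoC x * y)) <= 4 / (c * r) / x.
Proof.
intros Hc Hr Hy Hry Hx.
assert (Hcr : 0 < c * r) by now apply Rmult_lt_0_compat.
assert (Hx0 : 0 < x) by nra.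
assert (Hw : Cmod (Cexp (- (RtoC x * y))) <= / (c * r * x)).
{ rewrite Cmod_Cexp. change (fst (- (RtoC x * y))%C) with (- fst (RtoC x * y)%C).
  rewrite fst_scal, exp_Ropp. apply Rinv_le_contravar; [lra|].
  apply Rle_trans with (x * fst y).
  - destruct Hy as [_ Hy]. assert (c * r <= fst y) by nra. nra.
  - generalize (exp_ineq1_le (x * fst y)); lra. }
assert (/ (c * r * x) <= / 2) by (apply Rinv_le_contravar; lra).
unfold log_1mexp. eapply Rle_trans; [apply Cmod_Clog_1_minus; lra|].
replace (4 / (c * r) / x) with (4 * / (c * r * x)) by (field; lra).
lra.
Qed.

Lemma euler_maclaurin_bound (p : nat) (u : nat -> C) (B : R) :
  (forall i, (i <= p)%nat -> Cmod (u i) <= B) ->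
  Cmod (euler_maclaurin p u) <= rsum (fun i => Rabs (bern_fact i)) (S p) * B.
Proof.
intros H. unfold euler_maclaurin. eapply Rle_trans; [apply Cmod_csum|].
rewrite Rmult_comm, <- rsum_scal. apply rsum_le. intros i Hi.
rewrite Cmod_mult, Cmod_R, Rmult_comm. apply Rmult_le_compat_r; [apply Rabs_pos|].
apply H; lia.
Qed.

Lemma nat_bound_max (P : nat -> R -> Prop) (p : nat) :
  (forall i K K', K <= K' -> P i K -> P i K') ->
  (forall i, exists K, 0 <= K /\ P i K) ->
  exists K, 0 <= K /\ forall i, (i <= p)%nat -> P i K.
Proof.
intros Hmono H. induction p as [|p (K & HK & IH)].
- destruct (H O) as (K & HK & H0). exists K; split; [exact HK|].
  intros i Hi. now replace i with O by lia.
- destruct (H (S p)) as (L & HL & HS). exists (K + L); split; [lra|].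
  intros i Hi. destruct (Nat.eq_dec i (S p)) as [->|Hne].
  + apply (Hmono _ L); [lra | exact HS].
  + apply (Hmono _ K); [lra | apply IH; lia].
Qed.

Lemma rem_em_jet_at_1 (c : R) (M p : nat) : 0 < c -> exists K, 0 <= K /\
  forall y, cone c y ->
  Cmod (euler_maclaurin p (fun i => rem_em_jet M y i 1)) <= K * Cmod y ^ S M.
Proof.
intros Hc.
destruct (nat_bound_max (fun i K => forall y, cone c y ->
  Cmod (rem_em_jet M y i 1) <= K * Cmod y ^ S M) p) as (K & HK & H).
- intros i K K' HKK H y Hy. eapply Rle_trans; [now apply H|].
  apply Rmult_le_compat_r; [apply pow_le, Cmod_ge_0 | exact HKK].
- intros [|i].
  + destruct (log_rem_bound c M Hc) as (K & HK & H). exists K; split; [exact HK|].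
    intros y Hy. simpl rem_em_jet. rewrite ln_1.
    replace (0 * rem_jet M y 0 1 - log_rem M y 1)%C with (- log_rem M y 1)%C by ring.
    rewrite Cmod_opp. now apply H.
  + destruct (rem_em_jet_bound c M Hc i) as (K & HK & H). exists K; split; [exact HK|].
    intros y Hy. specialize (H y 1 Hy (Rle_refl 1)).
    rewrite pow1, !Rmult_1_l in H. exact H.
- exists (rsum (fun i => Rabs (bern_fact i)) (S p) * K). split.
  + apply Rmult_le_pos; [|exact HK]. apply rsum_pos; intros; apply Rabs_pos.
  + intros y Hy. rewrite Rmult_assoc. apply euler_maclaurin_bound.
    intros i Hi. now apply H.
Qed.

Lemma rsum_inv_sqr_le (X : nat) : rsum (fun n => / INR (S n) ^ 2) X <= 2.
Proof.
apply Rle_trans with (2 - 2 / INR (S X)).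
- induction X as [|X IH]; [simpl; lra|]. rewrite rsum_S.
  assert (H := INR_S_ge1 X). rewrite (S_INR (S X)).
  set (a := INR (S X)) in *.
  assert (/ a ^ 2 <= 2 / a - 2 / (a + 1)); [|lra].
  replace (2 / a - 2 / (a + 1)) with (2 / (a * (a + 1))) by (field; lra).
  replace (/ a ^ 2) with (2 / (2 * a ^ 2)) by (field; lra).
  apply Rmult_le_compat_l; [lra|]. apply Rinv_le_contravar; nra.
- assert (0 < 2 / INR (S X)); [|lra]. apply Rdiv_lt_0_compat; [lra | apply INR_S_pos].
Qed.

(** At order [M + 3] the first neglected entry is of size [|y|^(M+1) / x^2]: of the powers of
    [1 / x] gained, [M + 1] compensate the growth of the remainder and two make the step errors
    summable, uniformly in [X]. *)
Lemma rem_em_jet_steps (c : R) (M : nat) : 0 < c -> exists K, 0 <= K /\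
  forall y, cone c y -> forall X,
  Cmod (csum (fun n => rem_em_jet M y 1 (INR (S n))) X
    - (euler_maclaurin (M + 3) (fun i => rem_em_jet M y i (INR (S X)))
       - euler_maclaurin (M + 3) (fun i => rem_em_jet M y i 1)))%C <= K * Cmod y ^ S M.
Proof.
intros Hc.
destruct (rem_em_jet_bound c M Hc (M + 3)) as (K & HK & H).
assert (Hem := em_const_pos (M + 3)).
exists (em_const (M + 3) * K * 2).
split; [apply Rmult_le_pos; [apply Rmult_le_pos|]; lra|].
intros y Hy X. assert (Hre := cone_re c y Hc Hy).
set (E := fun x => euler_maclaurin (M + 3) (fun i => rem_em_jet M y i x)).
change (euler_maclaurin _ _) with (E (INR (S X))) at 1.
change (euler_maclaurin _ _) with (E (INR 1)).
rewrite <- (csum_telescope (fun n => E (INR (S n))) X), <- csum_minus.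
eapply Rle_trans; [apply Cmod_csum|].
assert (Hy0 : 0 <= Cmod y ^ S M) by apply pow_le, Cmod_ge_0.
apply Rle_trans with (rsum (fun n => em_const (M + 3) * (K * Cmod y ^ S M) * / INR (S n) ^ 2) X).
- apply rsum_le. intros n _. rewrite <- Cmod_opp.
  replace (- (rem_em_jet M y 1 (INR (S n)) - (E (INR (S (S n))) - E (INR (S n)))))%C with
    (E (INR (S n) + 1)%R - E (INR (S n)) - rem_em_jet M y 1 (INR (S n)))%C
    by (rewrite <- (S_INR (S n)); ring).
  rewrite Rmult_assoc.
  assert (Hn := INR_S_ge1 n).
  apply (euler_maclaurin_step (M + 3) (rem_em_jet M y)); [lia| |].
  + intros i t _ Ht. apply is_jet_rem_em; [exact Hre | lra].
  + intros t Ht. specialize (H y t Hy ltac:(lra)).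
    rewrite Rpow_mult_distr in H. replace (M + 3)%nat with (S M + 2)%nat in H by lia.
    replace (S (M + 3))%nat with (S (S M + 2)) by lia.
    rewrite pow_add in H.
    assert (Hp : 0 < t ^ S M) by (apply pow_lt; lra).
    set (A := Cmod (rem_em_jet M y (S (S M + 2)) t)) in *.
    assert (H' : t ^ 2 * A <= K * Cmod y ^ S M) by (apply (Rmult_le_reg_l _ _ _ Hp); lra).
    assert (Hn2 : 0 < INR (S n) ^ 2) by (apply pow_lt; lra).
    assert (Ht2 : INR (S n) ^ 2 <= t ^ 2) by (apply pow_incr; lra).
    apply (Rmult_le_reg_l (INR (S n) ^ 2)); [exact Hn2|].
    replace (INR (S n) ^ 2 * (K * Cmod y ^ S M * / INR (S n) ^ 2)) with (K * Cmod y ^ S M)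
      by (field; lra).
    eapply Rle_trans; [|exact H']. apply Rmult_le_compat_r; [apply Cmod_ge_0 | exact Ht2].
- rewrite rsum_scal. replace (em_const (M + 3) * K * 2 * Cmod y ^ S M) with
    (em_const (M + 3) * (K * Cmod y ^ S M) * 2) by ring.
  apply Rmult_le_compat_l; [|apply rsum_inv_sqr_le].
  apply Rmult_le_pos; [lra|]. now apply Rmult_le_pos.
Qed.

(** Exponential decay is weakened to powers of [x * Cmod y] with [Cmod y >= r]. In entry 0 the
    factor [ln x <= x] is absorbed by a bound of order [x^(-2)]. *)
Lemma full_em_jet_tail (c r : R) (p : nat) : 0 < c -> 0 < r -> exists K, 0 <= K /\
  forall y x, cone c y -> r <= Cmod y -> 1 <= x -> 2 <= c * r * x ->
  Cmod (euler_maclaurin p (fun i => full_em_jet y i x)) <= K / x.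
Proof.
intros Hc Hr.
assert (Hm : forall y x, r <= Cmod y -> 1 <= x -> / (x * Cmod y) ^ 2 <= / r ^ 2 / (x * x)).
{ intros y x Hy Hx. replace (/ r ^ 2 / (x * x)) with (/ (x * r) ^ 2) by (field; lra).
  apply Rinv_le_contravar.
  - apply pow_lt. nra.
  - apply pow_incr. nra. }
destruct (nat_bound_max (fun i K => forall y x, cone c y -> r <= Cmod y -> 1 <= x ->
  2 <= c * r * x -> Cmod (full_em_jet y i x) <= K / x) p) as (K & HK & H).
- intros i K K' HKK H y x Hy Hry Hx Hcx. eapply Rle_trans; [now apply H|].
  apply Rmult_le_compat_r; [left; apply Rinv_0_lt_compat; lra | exact HKK].
- intros [|i].
  + destruct (q_jet_bound c 2 Hc O) as (K & HK & H).
    assert (Hr2 : 0 < / r ^ 2) by (apply Rinv_0_lt_compat, pow_lt, Hr).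
    assert (Hcr : 0 < 4 / (c * r)) by (apply Rdiv_lt_0_compat; nra).
    exists (K * / r ^ 2 + 4 / (c * r)). split; [apply Rplus_le_le_0_compat; [|lra]; nra|].
    intros y x Hy Hry Hx Hcx. simpl.
    unfold Rdiv at 1. rewrite Rmult_plus_distr_r.
    eapply Rle_trans; [apply Cmod_triangle|]. rewrite Cmod_opp.
    apply Rplus_le_compat; [|now apply (log_1mexp_bound c r)].
    assert (Hx0 : 0 < x) by lra.
    specialize (H y x (conj Hy Hx0)). rewrite pow_O, Rmult_1_l in H.
    rewrite Cmod_mult, Cmod_R, Rabs_pos_eq by now apply ln_ge_0.
    specialize (Hm y x Hry Hx).
    apply Rle_trans with (x * (K * (/ r ^ 2 / (x * x)))).
    * apply Rmult_le_compat; [now apply ln_ge_0 | apply Cmod_ge_0 | now apply ln_le_self|].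
      eapply Rle_trans; [exact H|]. now apply Rmult_le_compat_l.
    * right. field. lra.
  + destruct (full_em_jet_bound c Hc i) as (K & HK & H).
    assert (Hr2 : 0 < / r ^ 2) by (apply Rinv_0_lt_compat, pow_lt, Hr).
    exists (K * / r ^ 2). split; [nra|].
    intros y x Hy Hry Hx Hcx. specialize (H y x Hy Hx). specialize (Hm y x Hry Hx).
    assert (Hp : 1 <= x ^ i) by now apply pow_R1_Rle.
    assert (H0 := Cmod_ge_0 (full_em_jet y (S i) x)).
    apply Rle_trans with (x ^ i * Cmod (full_em_jet y (S i) x)); [nra|].
    eapply Rle_trans; [exact H|].
    unfold Rdiv. rewrite Rmult_assoc. apply Rmult_le_compat_l; [exact HK|].
    eapply Rle_trans; [exact Hm|]. unfold Rdiv. apply Rmult_le_compat_l; [lra|].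
    apply Rinv_le_contravar; nra.
- exists (rsum (fun i => Rabs (bern_fact i)) (S p) * K). split.
  + apply Rmult_le_pos; [|exact HK]. apply rsum_pos; intros; apply Rabs_pos.
  + intros y x Hy Hry Hx Hcx. unfold Rdiv. rewrite Rmult_assoc. apply euler_maclaurin_bound.
    intros i Hi. now apply H.
Qed.

Lemma is_lim_seq_small (u : nat -> R) (l eps : R) : is_lim_seq u l -> 0 < eps ->
  exists N, forall n, (N <= n)%nat -> Rabs (u n - l) <= eps.
Proof.
intros H He. apply is_lim_seq_Reals in H. destruct (H eps He) as [N HN].
exists N. intros n Hn. specialize (HN n Hn). unfold Rdist in HN. lra.
Qed.

(** The boundary expression of the full function at [X + 1] tends to 0, and the power sums of the
    polynomial part minus their boundary expressions are [pow_ln_defect]. What survives is the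
    boundary expression of the remainder at [1] and the step errors, both [O(|y|^(M+1))]. [N] serves
    all [y] of the truncated sector at once, so finite sums can be integrated along chords. *)
Lemma uniform_ln_q_sum (c : R) (M : nat) : 0 < c -> exists K, 0 <= K /\
  forall r eps, 0 < r -> 0 < eps -> exists N, forall y X,
  cone c y -> r <= Cmod y -> Cmod y <= 1 -> (N <= X)%nat ->
  Cmod (csum (fun n => RtoC (ln (INR (S n))) * q_jet y 1 (INR (S n))) X - Clog y
    - csum (fun k => RtoC (pow_ln_coeff k * pow_ln_const k) * y ^ S k) M)%C
  <= K * Cmod y ^ S M + eps.
Proof.
intros Hc. set (p := (M + 3)%nat).
destruct (rem_em_jet_at_1 c M p Hc) as (K1 & HK1 & H1).
destruct (rem_em_jet_steps c M Hc) as (K2 & HK2 & H2). fold p in H2.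
exists (K1 + K2); split; [lra|]. intros r eps Hr He.
destruct (full_em_jet_tail c r p Hc Hr) as (K3 & HK3 & H3).
assert (HL1 : is_lim_seq (fun X => K3 * / INR (S X)) (K3 * 0)).
{ apply is_lim_seq_mult'; [apply is_lim_seq_const | apply is_lim_seq_inv_INR_S]. }
assert (HL2 : is_lim_seq (fun X => rsum (fun k => Rabs (pow_ln_coeff k) *
  Rabs (pow_ln_defect k p X - pow_ln_const k)) M) (rsum (fun k => Rabs (pow_ln_coeff k) * 0) M)).
{ apply is_lim_seq_rsum. intros k Hk. apply is_lim_seq_mult'; [apply is_lim_seq_const|].
  rewrite <- Rabs_R0. apply (is_lim_seq_abs _ (Finite 0)).
  replace (Finite 0) with (Finite (pow_ln_const k - pow_ln_const k)) by (f_equal; ring).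
  apply is_lim_seq_minus'; [|apply is_lim_seq_const]. apply pow_ln_const_lim. unfold p; lia. }
rewrite (rsum_0 _ M) in HL2 by (intros; ring).
assert (HL3 : is_lim_seq (fun X => / INR (S X)) 0) by apply is_lim_seq_inv_INR_S.
destruct (is_lim_seq_small _ _ (eps / 2) HL1 ltac:(lra)) as [N1 HN1].
destruct (is_lim_seq_small _ _ (eps / 2) HL2 ltac:(lra)) as [N2 HN2].
assert (Hcr : 0 < c * r / 2) by nra.
destruct (is_lim_seq_small _ _ (c * r / 2) HL3 Hcr) as [N3 HN3].
exists (N1 + N2 + N3)%nat. intros y X Hy Hry Hy1 HX.
assert (Hre := cone_re c y Hc Hy).
specialize (HN1 X ltac:(lia)). specialize (HN2 X ltac:(lia)). specialize (HN3 X ltac:(lia)).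
assert (Hx := INR_S_ge1 X). set (x := INR (S X)) in *.
assert (Hx0 : 0 < / x) by (apply Rinv_0_lt_compat; lra).
rewrite Rmult_0_r, Rminus_0_r, Rabs_pos_eq in HN1 by (apply Rmult_le_pos; lra).
rewrite Rminus_0_r in HN2, HN3. rewrite (Rabs_pos_eq (/ x)) in HN3 by lra.
assert (Hcx : 2 <= c * r * x).
{ apply (Rmult_le_compat_r x) in HN3; [|lra]. rewrite Rinv_l in HN3 by lra. lra. }
specialize (H1 y Hy). specialize (H2 y Hy X). specialize (H3 y x Hy Hry Hx Hcx).
fold x in H2. rewrite (euler_maclaurin_decomp M p y x Hre) in H3 by lra.
rewrite (csum_ext _ (fun n => rem_em_jet M y 1 (INR (S n)) +
  csum (fun k => RtoC (pow_ln_coeff k) * y ^ S k * RtoC (INR (S n) ^ k * ln (INR (S n)))) M)%C).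
2:{ intros n _. assert (Hn := INR_S_pos n).
  transitivity (full_em_jet y 1 (INR (S n))).
  - simpl full_em_jet. cbn [leibniz]. now rewrite ln_jet_0.
  - rewrite (full_em_jet_decomp M) by assumption.
    rewrite (csum_ext (fun k => _ * RtoC (pow_ln_jet k 1 _))%C (fun k =>
      RtoC (pow_ln_coeff k) * y ^ S k * RtoC (INR (S n) ^ k * ln (INR (S n))))%C)
      by (intros; now rewrite pow_ln_jet_1).
    ring. }
rewrite csum_plus, csum_swap.
rewrite (csum_ext (fun k => csum _ X) (fun k => RtoC (pow_ln_coeff k) * y ^ S k *
    RtoC (euler_maclaurin_R p (fun i => pow_ln_jet k i x))
  + RtoC (pow_ln_coeff k) * y ^ S k * RtoC (pow_ln_defect k p X))%C).
2:{ intros k _. rewrite csum_scal, csum_RtoC, <- Cmult_plus_distr_l, <- RtoC_plus.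
  unfold pow_ln_defect. fold x. do 2 f_equal. ring. }
rewrite csum_plus.
set (A := csum (fun n => rem_em_jet M y 1 (INR (S n))) X) in *.
set (E := euler_maclaurin p (fun i => rem_em_jet M y i x)) in *.
set (E1 := euler_maclaurin p (fun i => rem_em_jet M y i 1)) in *.
set (P := csum (fun k => RtoC (pow_ln_coeff k) * y ^ S k *
  RtoC (euler_maclaurin_R p (fun i => pow_ln_jet k i x)))%C M) in *.
set (Q := csum (fun k => RtoC (pow_ln_coeff k) * y ^ S k * RtoC (pow_ln_defect k p X))%C M).
set (T := csum (fun k => RtoC (pow_ln_coeff k * pow_ln_const k) * y ^ S k)%C M).
assert (HQ : Cmod (Q - T) <= eps / 2).
{ unfold Q, T. rewrite <- csum_minus. eapply Rle_trans; [apply Cmod_csum|].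
  eapply Rle_trans; [|apply (Rle_trans _ _ _ (Rle_abs _) HN2)].
  apply rsum_le; intros k _.
  replace (RtoC (pow_ln_coeff k) * y ^ S k * RtoC (pow_ln_defect k p X) -
    RtoC (pow_ln_coeff k * pow_ln_const k) * y ^ S k)%C with
    (RtoC (pow_ln_coeff k) * RtoC (pow_ln_defect k p X - pow_ln_const k) * y ^ S k)%C
    by (rewrite RtoC_minus, RtoC_mult; ring).
  rewrite !Cmod_mult, !Cmod_R, Cmod_pow.
  assert (Cmod y ^ S k <= 1).
  { rewrite <- (pow1 (S k)). apply pow_incr. split; [apply Cmod_ge_0 | exact Hy1]. }
  rewrite <- (Rmult_1_r (Rabs _ * Rabs _)) at 2. apply Rmult_le_compat_l; [|assumption].
  apply Rmult_le_pos; apply Rabs_pos. }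
(* Four small quantities: the step errors, the remainder at [1], the boundary expression of the full
   function, and the distance of the defects from their limits. *)
replace (A + (P + Q) - Clog y - T)%C with
  (((A - (E - E1)) + - E1) + ((E + P - Clog y) + (Q - T)))%C by ring.
eapply Rle_trans; [apply Cmod_triangle|].
assert (HT1 := Cmod_triangle (A - (E - E1)) (- E1)). rewrite Cmod_opp in HT1.
assert (HT2 := Cmod_triangle (E + P - Clog y) (Q - T)).
change (K3 / x) with (K3 * / x) in H3. lra.
Qed.

(** * The Lambert series and its regularized remainder *)

Lemma lambert_log_term_bose (y : C) (n : nat) :
  lambert_log_term y n = (RtoC (ln (INR n)) * bose (RtoC (INR n) * y))%C.
Proof. reflexivity. Qed.

Lemma right_half_cone (y : C) : 0 < fst y -> exists c, 0 < c /\ cone c y.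
Proof.
intros Hy. assert (Hy0 : y <> RtoC 0) by (intros E; rewrite E in Hy; simpl in Hy; lra).
assert (Hm := proj1 (Cmod_gt_0 y) Hy0).
exists (fst y / Cmod y). split; [now apply Rdiv_lt_0_compat|]. split; [exact Hy0|].
right. field. lra.
Qed.

Lemma lambert_log_term_bound (y : C) : 0 < fst y -> exists K, forall n,
  Cmod (lambert_log_term y (S n)) <= K / INR (S n) ^ 2.
Proof.
intros Hy. destruct (right_half_cone y Hy) as (c & Hc & Hcy).
destruct (bose_bound c 2 Hc) as (K & HK & H).
assert (Hm : 0 < Cmod y) by (apply Cmod_gt_0, Hcy).
exists (K / Cmod y ^ 3). intros n.
rewrite lambert_log_term_bose, Cmod_mult, Cmod_R.
assert (Hn := INR_S_ge1 n). set (x := INR (S n)) in *.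
assert (Hx : 0 < x) by lra.
specialize (H _ (cone_scal c x y Hx Hcy)). rewrite Cmod_scal_pos in H by lra.
rewrite Rabs_pos_eq by now apply ln_ge_0.
assert (Hl := ln_le_self x Hx). assert (Hl0 := ln_ge_0 x Hn).
assert (H0 := Cmod_ge_0 (bose (RtoC x * y))).
apply Rle_trans with (x * (K / (x * Cmod y) ^ 3)).
- apply Rmult_le_compat; [exact Hl0 | exact H0 | exact Hl |].
  assert (Hp : 0 < (x * Cmod y) ^ 3) by (apply pow_lt, Rmult_lt_0_compat; lra).
  apply (Rmult_le_reg_l _ _ _ Hp).
  replace ((x * Cmod y) ^ 3 * (K / (x * Cmod y) ^ 3)) with K by (field; lra). exact H.
- right. field. lra.
Qed.

Lemma lambert_log_lim (y : C) : 0 < fst y ->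
  is_lim_seq (fun X => fst (csum (fun n => lambert_log_term y (S n)) X)) (fst (lambert_log y)) /\
  is_lim_seq (fun X => snd (csum (fun n => lambert_log_term y (S n)) X)) (snd (lambert_log y)).
Proof.
intros Hy. destruct (lambert_log_term_bound y Hy) as (K & H).
assert (E1 : forall X, fst (csum (fun n => lambert_log_term y (S n)) X) =
  rsum (fun n => Re (lambert_log_term y (S n))) X).
{ intros X; induction X as [|X IH]; [reflexivity|]. now rewrite csum_S, rsum_S, <- IH. }
assert (E2 : forall X, snd (csum (fun n => lambert_log_term y (S n)) X) =
  rsum (fun n => Im (lambert_log_term y (S n))) X).
{ intros X; induction X as [|X IH]; [reflexivity|]. now rewrite csum_S, rsum_S, <- IH. }
split.
- apply (is_lim_seq_ext _ _ _ (fun X => eq_sym (E1 X))). apply is_series_rsum, Series_correct.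
  apply (ex_series_le_inv_sqr _ K). intros n.
  eapply Rle_trans; [apply Rabs_fst_le_Cmod | apply H].
- apply (is_lim_seq_ext _ _ _ (fun X => eq_sym (E2 X))). apply is_series_rsum, Series_correct.
  apply (ex_series_le_inv_sqr _ K). intros n.
  eapply Rle_trans; [apply Rabs_snd_le_Cmod | apply H].
Qed.

Lemma lambert_log_small (y : C) (eps : R) : 0 < fst y -> 0 < eps -> exists N, forall X,
  (N <= X)%nat -> Cmod (csum (fun n => lambert_log_term y (S n)) X - lambert_log y)%C <= eps.
Proof.
intros Hy He. destruct (lambert_log_lim y Hy) as [H1 H2].
destruct (is_lim_seq_small _ _ (eps / 2) H1 ltac:(lra)) as [N1 HN1].
destruct (is_lim_seq_small _ _ (eps / 2) H2 ltac:(lra)) as [N2 HN2].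
exists (N1 + N2)%nat. intros X HX.
specialize (HN1 X ltac:(lia)). specialize (HN2 X ltac:(lia)).
eapply Rle_trans; [apply Cmod_le_plus|].
change (Rabs (fst (?a - ?b)%C)) with (Rabs (fst a - fst b)).
change (Rabs (snd (?a - ?b)%C)) with (Rabs (snd a - snd b)). lra.
Qed.

Lemma lambert_log_is_series (y : C) : 0 < fst y ->
  is_series (K := C_AbsRing) (V := C_NormedModule)
    (fun n => lambert_log_term y (S n)) (lambert_log y).
Proof.
intros Hy. destruct (lambert_log_lim y Hy) as [H1 H2].
apply is_lim_seq_incr_1 in H1. apply is_lim_seq_incr_1 in H2.
assert (E : forall n, sum_n (G := C_AbelianMonoid) (fun n => lambert_log_term y (S n)) n =
  csum (fun n => lambert_log_term y (S n)) (S n)).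
{ intros n; induction n as [|n IH].
  - rewrite sum_O. simpl. ring.
  - rewrite sum_Sn, IH. reflexivity. }
intros P [eps HP].
destruct (H1 (ball (fst (lambert_log y)) eps)) as [N1 HN1]; [now exists eps|].
destruct (H2 (ball (snd (lambert_log y)) eps)) as [N2 HN2]; [now exists eps|].
exists (N1 + N2)%nat. intros n Hn. apply HP.
split; [specialize (HN1 n ltac:(lia)) | specialize (HN2 n ltac:(lia))].
- exact (eq_ind_r (fun w => ball (fst (lambert_log y)) eps (fst w)) HN1 (E n)).
- exact (eq_ind_r (fun w => ball (snd (lambert_log y)) eps (snd w)) HN2 (E n)).
Qed.

(** [y * S] minus its expansion without the constant [leading_const]. The sum is a parameter: the
    derivative is taken with partial sums, and the series is inserted afterwards. *)
Definition lambert_reg (M : nat) (S : C) (y : C) : C :=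
  (y * S - Clog y * Clog y / 2 -
   csum (fun k => RtoC (bern_fact (Datatypes.S k) * pow_ln_const k) * y ^ Datatypes.S k) M)%C.

(** Real parts interpolate linearly along the chord, which keeps it away from 0 by the smaller of
    the two; the sector condition is convexity of the modulus. *)
Lemma cone_chord (c t : R) (y1 y2 : C) : 0 < c -> 0 <= t <= 1 -> cone c y1 -> cone c y2 ->
  cone c (y1 + RtoC t * (y2 - y1)) /\ Rmin (fst y1) (fst y2) <= Cmod (y1 + RtoC t * (y2 - y1)).
Proof.
intros Hc Ht H1 H2.
assert (Hr1 := cone_re c y1 Hc H1). assert (Hr2 := cone_re c y2 Hc H2).
destruct H1 as [_ H1], H2 as [_ H2].
assert (E : fst (y1 + RtoC t * (y2 - y1))%C = (1 - t) * fst y1 + t * fst y2).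
{ simpl. ring. }
assert (Hmin : Rmin (fst y1) (fst y2) <= fst (y1 + RtoC t * (y2 - y1))%C).
{ rewrite E. assert (Ha := Rmin_l (fst y1) (fst y2)). assert (Hb := Rmin_r (fst y1) (fst y2)). nra. }
assert (Hpos : 0 < Rmin (fst y1) (fst y2)) by now apply Rmin_glb_lt.
split; [split|].
- intros E0. rewrite E0 in Hmin. simpl in Hmin. lra.
- rewrite E. replace (y1 + RtoC t * (y2 - y1))%C with
    (RtoC (1 - t) * y1 + RtoC t * y2)%C by (rewrite RtoC_minus; ring).
  apply Rle_trans with (c * ((1 - t) * Cmod y1 + t * Cmod y2)).
  + apply Rmult_le_compat_l; [lra|]. eapply Rle_trans; [apply Cmod_triangle|].
    rewrite !Cmod_mult, !Cmod_R, !Rabs_pos_eq by lra. lra.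
  + nra.
- eapply Rle_trans; [exact Hmin|]. eapply Rle_trans; [apply Rle_abs | apply Rabs_fst_le_Cmod].
Qed.

Lemma Cmod_chord (t rho : R) (y1 y2 : C) : 0 <= t <= 1 -> Cmod y1 <= rho -> Cmod y2 <= rho ->
  Cmod (y1 + RtoC t * (y2 - y1)) <= rho.
Proof.
intros Ht H1 H2.
replace (y1 + RtoC t * (y2 - y1))%C with
    (RtoC (1 - t) * y1 + RtoC t * y2)%C by (rewrite RtoC_minus; ring).
eapply Rle_trans; [apply Cmod_triangle|].
rewrite !Cmod_mult, !Cmod_R, !Rabs_pos_eq by lra. nra.
Qed.

(** Multiplied by [z], the term of index [n] is [ln n * q (n z) / n], and [z] times its derivative
    is [ln n * q_jet z 1 n]. So the derivative is [1 / z] times the quantity of [uniform_ln_q_sum],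
    with [Clog] coming from half its square. *)
Lemma Cderiv_lambert_reg (M X : nat) (F : R -> C) (t : R) (d : C) :
  0 < fst (F t) -> Cderiv F t d ->
  Cderiv (fun t => lambert_reg M (csum (fun n => lambert_log_term (F t) (S n)) X) (F t)) t
   (d / F t * (csum (fun n => RtoC (ln (INR (S n))) * q_jet (F t) 1 (INR (S n))) X - Clog (F t)
    - csum (fun k => RtoC (pow_ln_coeff k * pow_ln_const k) * F t ^ S k) M))%C.
Proof.
intros Ht HF. unfold lambert_reg.
assert (H0 : F t <> RtoC 0) by (intros E; rewrite E in Ht; simpl in Ht; lra).
apply (Cderiv_ext (fun t => csum (fun n => RtoC (ln (INR (S n))) *
    (F t * bose (RtoC (INR (S n)) * F t))) X - / 2 * (Clog (F t) * Clog (F t)) -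
  csum (fun k => RtoC (bern_fact (S k) * pow_ln_const k) * F t ^ S k) M)%C).
{ intros s. f_equal. f_equal; [|field].
  rewrite (csum_ext (fun n => lambert_log_term (F s) (S n)) (fun n => RtoC (ln (INR (S n))) *
    bose (RtoC (INR (S n)) * F s))%C) by reflexivity.
  rewrite <- csum_scal. apply csum_ext; intros; ring. }
eapply Cderiv_eq.
- apply Cderiv_minus; [apply Cderiv_minus|].
  + apply Cderiv_csum. intros n _. apply Cderiv_scal, Cderiv_mult; [exact HF|].
    apply (Cderiv_bose (fun t => RtoC (INR (S n)) * F t)%C).
    * rewrite fst_scal. apply Rmult_lt_0_compat; [apply INR_S_pos | exact Ht].
    * apply Cderiv_scal, HF.
  + apply Cderiv_scal, Cderiv_mult; apply (Cderiv_log F); eassumption.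
  + apply Cderiv_csum. intros k _. apply Cderiv_scal, Cderiv_pow, HF.
- cbv beta.
  rewrite (csum_ext (fun n => RtoC (ln (INR (S n))) * (d * bose _ + _))%C (fun n => d / F t *
    (RtoC (ln (INR (S n))) * q_jet (F t) 1 (INR (S n))))%C).
  2:{ intros n _. rewrite q_jet_1. field. exact H0. }
  rewrite (csum_ext (fun k => RtoC (bern_fact (S k) * pow_ln_const k) * _)%C (fun k => d / F t *
    (RtoC (pow_ln_coeff k * pow_ln_const k) * F t ^ S k))%C).
  2:{ intros k _. unfold pow_ln_coeff. rewrite Cpow_S, !RtoC_mult. field. exact H0. }
  rewrite !csum_scal. field. exact H0.
Qed.

Lemma lambert_reg_diff (M : nat) (S S' y : C) :
  (lambert_reg M S y - lambert_reg M S' y = y * (S - S'))%C.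
Proof. unfold lambert_reg. ring. Qed.

Lemma Rle_eps (a b : R) : (forall eps, 0 < eps -> a <= b + eps) -> a <= b.
Proof.
intros H. apply Rnot_lt_le. intros Hab. specialize (H ((a - b) / 2) ltac:(lra)). lra.
Qed.

(** Dividing by [z] costs one power, so the derivative along the chord is [O(rho^M)]. Partial sums
    are replaced by the series only at the two endpoints, at a cost of [eps / 4] each. *)
Lemma lambert_reg_lipschitz (c : R) (M : nat) : 0 < c -> exists K, 0 <= K /\
  forall rho y1 y2, rho <= 1 -> cone c y1 -> cone c y2 -> Cmod y1 <= rho -> Cmod y2 <= rho ->
  Cmod (lambert_reg M (lambert_log y2) y2 - lambert_reg M (lambert_log y1) y1)%C
    <= K * rho ^ M * Cmod (y2 - y1)%C.
Proof.
intros Hc. destruct (uniform_ln_q_sum c M Hc) as (K & HK & H).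
exists (2 * K); split; [lra|]. intros rho y1 y2 Hrho H1 H2 Hm1 Hm2.
assert (Hr1 := cone_re c y1 Hc H1). assert (Hr2 := cone_re c y2 Hc H2).
set (r := Rmin (fst y1) (fst y2)).
assert (Hr : 0 < r) by now apply Rmin_glb_lt.
set (d := (y2 - y1)%C).
assert (Hd := Cmod_ge_0 d).
assert (Hrho0 : 0 <= rho) by (generalize (Cmod_ge_0 y1); lra).
apply Rle_eps. intros eps He.
(* Keeps the contribution [2 * Cmod d * e1 / r] below [eps / 2]; the [+ 1] guards against
   [d = 0]. *)
set (e1 := eps * r / (2 * (2 * Cmod d + 1))).
assert (He1 : 0 < e1) by (apply Rdiv_lt_0_compat; nra).
destruct (H r e1 Hr He1) as [N HN].
destruct (lambert_log_small y1 (eps / 4) Hr1 ltac:(lra)) as [N1 HN1].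
destruct (lambert_log_small y2 (eps / 4) Hr2 ltac:(lra)) as [N2 HN2].
set (X := (N + N1 + N2)%nat).
specialize (HN1 X ltac:(unfold X; lia)). specialize (HN2 X ltac:(unfold X; lia)).
set (S1 := csum (fun n => lambert_log_term y1 (S n)) X) in *.
set (S2 := csum (fun n => lambert_log_term y2 (S n)) X) in *.
set (F := fun t => (y1 + RtoC t * d)%C).
assert (HF : forall t, Cderiv F t d).
{ intros t. eapply Cderiv_eq.
  - apply Cderiv_plus; [apply Cderiv_const | apply Cderiv_ray].
  - ring. }
assert (HM := Cderiv_MVT (fun t => lambert_reg M (csum (fun n => lambert_log_term (F t) (S n)) X) (F t))
  _ 0 1 (Cmod d * (K * rho ^ M + e1 / r)) Rle_0_1
  (fun t Ht => Cderiv_lambert_reg M X F t d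
    (cone_re c _ Hc (proj1 (cone_chord c t y1 y2 Hc Ht H1 H2))) (HF t))).
assert (HB : Cmod (lambert_reg M S2 y2 - lambert_reg M S1 y1) <=
  2 * (Cmod d * (K * rho ^ M + e1 / r)) * (1 - 0)).
{ replace y2 with (F 1) at 1 by (unfold F, d; ring).
  replace y1 with (F 0) at 1 by (unfold F; ring).
  replace S2 with (csum (fun n => lambert_log_term (F 1) (S n)) X)
    by (unfold S2; replace (F 1) with y2 by (unfold F, d; ring); reflexivity).
  replace S1 with (csum (fun n => lambert_log_term (F 0) (S n)) X)
    by (unfold S1; replace (F 0) with y1 by (unfold F; ring); reflexivity).
  apply HM. intros t Ht.
  destruct (cone_chord c t y1 y2 Hc Ht H1 H2) as [Hcone Hge].
  assert (Hle := Cmod_chord t rho y1 y2 Ht Hm1 Hm2).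
  fold d in Hcone, Hge, Hle. fold r in Hge.
  change (y1 + RtoC t * d)%C with (F t) in *.
  assert (Hz := proj1 Hcone).
  assert (Hz0 : 0 < Cmod (F t)) by lra.
  specialize (HN (F t) X Hcone Hge ltac:(lra) ltac:(unfold X; lia)).
  rewrite Cmod_mult, Cmod_div by exact Hz.
  unfold Rdiv at 1. rewrite Rmult_assoc. apply Rmult_le_compat_l; [exact Hd|].
  eapply Rle_trans.
  - apply Rmult_le_compat_l; [left; now apply Rinv_0_lt_compat | exact HN].
  - replace (/ Cmod (F t) * (K * Cmod (F t) ^ S M + e1)) with
      (K * Cmod (F t) ^ M + e1 * / Cmod (F t)) by (simpl; field; lra).
    apply Rplus_le_compat.
    + apply Rmult_le_compat_l; [exact HK|]. apply pow_incr; lra.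
    + apply Rmult_le_compat_l; [lra|]. now apply Rinv_le_contravar. }
assert (HE : 2 * (Cmod d * (K * rho ^ M + e1 / r)) * (1 - 0) <=
  2 * K * rho ^ M * Cmod d + eps / 2).
{ replace (2 * (Cmod d * (K * rho ^ M + e1 / r)) * (1 - 0)) with
    (2 * K * rho ^ M * Cmod d + eps / 2 * (2 * Cmod d / (2 * Cmod d + 1)))
    by (unfold e1; field; lra).
  apply Rplus_le_compat_l. rewrite <- (Rmult_1_r (eps / 2)) at 2.
  apply Rmult_le_compat_l; [lra|].
  apply (Rmult_le_reg_r (2 * Cmod d + 1)); [lra|].
  replace (2 * Cmod d / (2 * Cmod d + 1) * (2 * Cmod d + 1)) with (2 * Cmod d) by (field; lra).
  lra. }
assert (T1 := lambert_reg_diff M S1 (lambert_log y1) y1).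
assert (T2 := lambert_reg_diff M S2 (lambert_log y2) y2).
replace (lambert_reg M (lambert_log y2) y2 - lambert_reg M (lambert_log y1) y1)%C with
  ((lambert_reg M S2 y2 - lambert_reg M S1 y1) +
   ((lambert_reg M S1 y1 - lambert_reg M (lambert_log y1) y1) +
    - (lambert_reg M S2 y2 - lambert_reg M (lambert_log y2) y2)))%C by ring.
rewrite T1, T2.
eapply Rle_trans; [apply Cmod_triangle|].
assert (HT := Cmod_triangle (y1 * (S1 - lambert_log y1)) (- (y2 * (S2 - lambert_log y2)))).
rewrite Cmod_opp, !Cmod_mult in HT.
assert (Cmod y1 * Cmod (S1 - lambert_log y1) <= 1 * (eps / 4)).
{ apply Rmult_le_compat; [apply Cmod_ge_0 | apply Cmod_ge_0 | lra | exact HN1]. }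
assert (Cmod y2 * Cmod (S2 - lambert_log y2) <= 1 * (eps / 4)).
{ apply Rmult_le_compat; [apply Cmod_ge_0 | apply Cmod_ge_0 | lra | exact HN2]. }
fold d. lra.
Qed.

(** * Fourier series of the Bernoulli polynomials *)

Lemma is_derive_cos_lin (a b x : R) : is_derive (fun x => cos (a * x + b)) x (- a * sin (a * x + b)).
Proof. auto_derive; [trivial|]. ring. Qed.

Lemma is_derive_sin_lin (a b x : R) : is_derive (fun x => sin (a * x + b)) x (a * cos (a * x + b)).
Proof. auto_derive; [trivial|]. ring. Qed.

Lemma dirichlet_kernel (K : nat) (t : R) :
  2 * sin (t / 2) * (rsum (fun m => cos (INR (S m) * t)) K + 1 / 2) = sin ((INR K + 1 / 2) * t).
Proof.
induction K as [|K IH].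
- simpl. replace ((0 + 1 / 2) * t) with (t / 2) by field. lra.
- rewrite rsum_S, S_INR.
  replace ((INR K + 1 + 1 / 2) * t) with ((INR K + 1) * t + t / 2) by field.
  replace ((INR K + 1 / 2) * t) with ((INR K + 1) * t - t / 2) in IH by field.
  rewrite sin_plus. rewrite sin_minus in IH. lra.
Qed.

Lemma sin_sum_kernel (n : nat) (t : R) :
  2 * sin (t / 2) * (rsum (fun j => sin (INR j * t)) n + sin (INR n * t) / 2)
  = cos (t / 2) * (1 - cos (INR n * t)).
Proof.
assert (H : 2 * sin (t / 2) * rsum (fun j => sin (INR j * t)) n =
  cos (t / 2) - cos ((INR n - 1 / 2) * t)).
{ induction n as [|n IH].
  - simpl. replace ((0 - 1 / 2) * t) with (- (t / 2)) by field. rewrite cos_neg. lra.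
  - rewrite rsum_S, S_INR, Rmult_plus_distr_l, IH.
    replace ((INR n + 1 - 1 / 2) * t) with (INR n * t + t / 2) by field.
    replace ((INR n - 1 / 2) * t) with (INR n * t - t / 2) by field.
    rewrite cos_plus, cos_minus. lra. }
rewrite Rmult_plus_distr_l, H.
replace ((INR n - 1 / 2) * t) with (INR n * t - t / 2) by field.
rewrite cos_minus. lra.
Qed.

Lemma sin_half_pos (t : R) : 0 < t <= PI -> 0 < sin (t / 2).
Proof. intros Ht. apply sin_gt_0; generalize PI_RGT_0; lra. Qed.

Lemma sin_half_mono (t s : R) : 0 < t <= s -> s <= PI -> sin (t / 2) <= sin (s / 2).
Proof. intros Ht Hs. generalize PI_RGT_0; intros. apply sin_incr_1; lra. Qed.

Lemma cos_half_odd_pi (K : nat) : cos ((INR K + 1 / 2) * PI) = 0.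
Proof.
induction K as [|K IH].
- simpl. replace ((0 + 1 / 2) * PI) with (PI / 2) by field. apply cos_PI2.
- rewrite S_INR. replace ((INR K + 1 + 1 / 2) * PI) with ((INR K + 1 / 2) * PI + PI) by field.
  rewrite neg_cos, IH. ring.
Qed.

Lemma sin_nat_pi (n : nat) : sin (INR n * PI) = 0.
Proof.
induction n as [|n IH]; [simpl; rewrite Rmult_0_l; apply sin_0|].
rewrite S_INR. replace ((INR n + 1) * PI) with (INR n * PI + PI) by ring.
rewrite neg_sin, IH. ring.
Qed.

Lemma cos_nat_pi (n : nat) : cos (INR n * PI) = (-1) ^ n.
Proof.
induction n as [|n IH]; [simpl; rewrite Rmult_0_l; apply cos_0|].
rewrite S_INR. replace ((INR n + 1) * PI) with (INR n * PI + PI) by ring.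
rewrite neg_cos, IH. simpl. ring.
Qed.

(* Adding [cos ((K + 1/2) t) / ((2 K + 1) sin (t / 2))], which integrates the Dirichlet
   kernel by parts once, leaves a function with derivative of order [1 / K]. *)
Lemma sawtooth_bound (K : nat) (t : R) : 0 < t <= PI ->
  Rabs (rsum (fun m => sin (INR (S m) * t) / INR (S m)) K - (PI - t) / 2)
  <= (PI + 1) / sin (t / 2) ^ 2 / INR (2 * K + 1).
Proof.
intros Ht.
assert (HK : INR (2 * K + 1) = 2 * INR K + 1) by (rewrite plus_INR, mult_INR; simpl; ring).
assert (HK0 := pos_INR K). rewrite HK.
set (a := INR K + 1 / 2).
set (sg := sin (t / 2)). assert (Hsg : 0 < sg) by now apply sin_half_pos.
assert (Hsg1 : sg <= 1) by apply SIN_bound.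
set (G := fun s => rsum (fun m => sin (INR (S m) * s) / INR (S m)) K - (PI - s) / 2
  + cos (a * s + 0) / (2 * a * sin (/ 2 * s + 0))).
assert (HG : forall s, t <= s <= PI -> is_derive G s
  (- cos (a * s) * cos (s / 2) / (4 * a * sin (s / 2) ^ 2))).
{ intros s Hs. assert (Hss : 0 < sin (s / 2)) by (apply sin_half_pos; lra).
  eapply is_derive_eq.
  - apply is_derive_Rplus; [apply is_derive_Rminus|].
    + apply is_derive_rsum. intros m _.
      apply (is_derive_ext (fun s => sin (INR (S m) * s + 0) / INR (S m))).
      { intros; now rewrite Rplus_0_r. }
      apply is_derive_Rdiv; [apply is_derive_sin_lin | exact (is_derive_const (INR (S m)) s)
        | apply Rgt_not_eq, INR_S_pos].
    + instantiate (1 := - (1 / 2)). auto_derive; [trivial|]. field.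
    + apply is_derive_Rdiv; [apply is_derive_cos_lin | |].
      * instantiate (1 := 2 * a * (/ 2 * cos (/ 2 * s + 0))).
        eapply is_derive_eq.
        -- apply (is_derive_Rmult (fun _ => 2 * a)); [exact (is_derive_const (2 * a) s) |
           apply is_derive_sin_lin].
        -- change (@zero R_NormedModule) with 0. ring.
      * rewrite Rplus_0_r. replace (/ 2 * s) with (s / 2) by field. unfold a.
        apply Rgt_not_eq. nra.
  - cbv beta. rewrite !Rplus_0_r. replace (/ 2 * s) with (s / 2) by field.
    rewrite (rsum_ext _ (fun m => cos (INR (S m) * s))).
    2:{ intros m _. change (@zero R_NormedModule) with 0. rewrite Rplus_0_r.
        field. apply Rgt_not_eq, INR_S_pos. }
    assert (HD := dirichlet_kernel K s). fold a in HD.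
    set (D := rsum _ K) in *. rewrite <- HD. unfold a in *. field. split; lra. }
(* Sines and the auxiliary cosine all vanish at [PI], so this end serves as the base point of the
   mean value estimate. *)
assert (HGPI : G PI = 0).
{ unfold G. rewrite (rsum_0 _ K).
  - unfold a. rewrite Rplus_0_r, cos_half_odd_pi. unfold Rdiv; ring.
  - intros m _. rewrite sin_nat_pi. unfold Rdiv; ring. }
assert (Ha : 0 < a) by (unfold a; lra).
assert (HM := MVT_bound G _ t PI (/ (4 * a * sg ^ 2)) (proj2 Ht) HG).
assert (HB : Rabs (G PI - G t) <= / (4 * a * sg ^ 2) * (PI - t)).
{ apply HM. intros s Hs.
  assert (Hss : sg <= sin (s / 2)) by (apply sin_half_mono; lra).
  unfold Rdiv. rewrite !Rabs_mult, Rabs_Ropp.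
  assert (H1 : Rabs (cos (a * s)) <= 1) by (apply Rabs_le, COS_bound).
  assert (H2 : Rabs (cos (s * / 2)) <= 1) by (apply Rabs_le, COS_bound).
  assert (H3 : 0 < 4 * a * sg ^ 2) by (apply Rmult_lt_0_compat; [lra|]; now apply pow_lt).
  assert (H4 : 4 * a * sg ^ 2 <= 4 * a * sin (s * / 2) ^ 2).
  { apply Rmult_le_compat_l; [lra|]. apply pow_incr. unfold Rdiv in Hss. lra. }
  rewrite (Rabs_pos_eq (/ _)) by (left; apply Rinv_0_lt_compat; lra).
  assert (H5 := Rinv_le_contravar _ _ H3 H4).
  assert (H6 : 0 < / (4 * a * sin (s * / 2) ^ 2)) by (apply Rinv_0_lt_compat; lra).
  assert (Rabs (cos (a * s)) * Rabs (cos (s * / 2)) <= 1 * 1).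
  { apply Rmult_le_compat; (apply Rabs_pos || assumption). }
  nra. }
rewrite HGPI in HB.
set (S0 := rsum _ K - _).
assert (E : G t = S0 + cos (a * t) / (2 * a * sg)).
{ unfold G, S0, sg. rewrite !Rplus_0_r. now replace (/ 2 * t) with (t / 2) by field. }
rewrite E in HB.
assert (HC : Rabs (cos (a * t) / (2 * a * sg)) <= / (2 * a * sg ^ 2)).
{ unfold Rdiv. rewrite Rabs_mult.
  assert (H1 : Rabs (cos (a * t)) <= 1) by (apply Rabs_le, COS_bound).
  assert (H3 : 0 < 2 * a * sg ^ 2) by (apply Rmult_lt_0_compat; [lra|]; now apply pow_lt).
  rewrite (Rabs_pos_eq (/ _)) by (left; apply Rinv_0_lt_compat; nra).
  assert (H4 : / (2 * a * sg) <= / (2 * a * sg ^ 2)).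
  { apply Rinv_le_contravar; [exact H3|]. simpl. rewrite Rmult_1_r.
    apply Rmult_le_compat_l; [lra|]. nra. }
  assert (H5 := Rabs_pos (cos (a * t))). assert (0 < / (2 * a * sg)) by (apply Rinv_0_lt_compat; nra).
  nra. }
replace ((PI + 1) / sg ^ 2 / (2 * INR K + 1)) with (PI * / (2 * a * sg ^ 2) + / (2 * a * sg ^ 2))
  by (unfold a; field; split; lra).
assert (H7 : / (4 * a * sg ^ 2) * (PI - t) <= PI * / (2 * a * sg ^ 2)).
{ replace (/ (4 * a * sg ^ 2)) with (/ 2 * / (2 * a * sg ^ 2)) by (field; split; lra).
  assert (0 < / (2 * a * sg ^ 2)).
  { apply Rinv_0_lt_compat. apply Rmult_lt_0_compat; [lra|]; now apply pow_lt. }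
  assert (H8 := PI_RGT_0). nra. }
replace S0 with (- (0 - (S0 + cos (a * t) / (2 * a * sg))) + - (cos (a * t) / (2 * a * sg))) by ring.
eapply Rle_trans; [apply Rabs_triang|]. rewrite !Rabs_Ropp. lra.
Qed.

(** * The sum of inverse squares *)

Definition inv_sqr_sum : R := Series (fun n => / INR (S n) ^ 2).

Lemma inv_sqr_sum_lim : is_lim_seq (fun K => rsum (fun n => / INR (S n) ^ 2) K) inv_sqr_sum.
Proof. apply is_series_rsum, Series_correct, ex_series_inv_sqr. Qed.

Lemma is_lim_seq_zero (u v : nat -> R) : is_lim_seq v 0 -> (forall n, Rabs (u n) <= v n) ->
  is_lim_seq u 0.
Proof.
intros Hv H. apply (is_lim_seq_le_le (fun n => - v n) _ v); [| |exact Hv].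
- intros n. specialize (H n). apply Rabs_le_between in H. lra.
- replace (Finite 0) with (Rbar_opp 0) by (simpl; f_equal; ring).
  now apply -> is_lim_seq_opp.
Qed.

Lemma is_lim_seq_cst_div_odd (c : R) : is_lim_seq (fun K => c / INR (2 * K + 1)) 0.
Proof.
apply (is_lim_seq_zero _ (fun K => Rabs c * / INR (S K))).
- replace (Finite 0) with (Finite (Rabs c * 0)) by (f_equal; ring).
  apply is_lim_seq_mult'; [apply is_lim_seq_const | apply is_lim_seq_inv_INR_S].
- intros K. unfold Rdiv. rewrite Rabs_mult. apply Rmult_le_compat_l; [apply Rabs_pos|].
  assert (H := INR_S_pos K).
  assert (H1 : INR (S K) <= INR (2 * K + 1)) by (apply le_INR; lia).
  rewrite Rabs_pos_eq by (left; apply Rinv_0_lt_compat; lra).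
  now apply Rinv_le_contravar.
Qed.

Definition cos_sum (K : nat) (t : R) : R := rsum (fun m => cos (INR (S m) * t) / INR (S m) ^ 2) K.

(** [sawtooth_bound] is uniform on [[t, PI]] and can be integrated there, while it degenerates at 0;
    the end 0 is reached later by continuity. *)
Lemma cos_sum_diff (t : R) : 0 < t <= PI ->
  is_lim_seq (fun K => cos_sum K t - cos_sum K PI) ((PI - t) ^ 2 / 4).
Proof.
intros Ht. set (B := (PI + 1) / sin (t / 2) ^ 2).
assert (Hd : forall K s, is_derive (fun s => cos_sum K s - (PI - s) ^ 2 / 4) s
  (- (rsum (fun m => sin (INR (S m) * s) / INR (S m)) K - (PI - s) / 2))).
{ intros K s. eapply is_derive_eq.
  - apply is_derive_Rminus.
    + apply is_derive_rsum. intros m _.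
      apply (is_derive_ext (fun s => cos (INR (S m) * s + 0) / INR (S m) ^ 2)).
      { intros; now rewrite Rplus_0_r. }
      apply is_derive_Rdiv; [apply is_derive_cos_lin | exact (is_derive_const (INR (S m) ^ 2) s)
        | apply pow_nonzero, Rgt_not_eq, INR_S_pos].
    + instantiate (1 := - ((PI - s) / 2)). auto_derive; [trivial|]. field.
  - rewrite (rsum_ext _ (fun m => (-1) * (sin (INR (S m) * s) / INR (S m)))).
    + rewrite rsum_scal. ring.
    + intros m _. change (@zero R_NormedModule) with 0. rewrite Rplus_0_r.
      field. apply Rgt_not_eq, INR_S_pos. }
replace (Finite ((PI - t) ^ 2 / 4)) with (Finite ((PI - t) ^ 2 / 4 + 0)) by (f_equal; ring).
apply (is_lim_seq_ext (fun K => (PI - t) ^ 2 / 4 +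
  ((cos_sum K t - (PI - t) ^ 2 / 4) - (cos_sum K PI - (PI - PI) ^ 2 / 4)))).
{ intros K. field. }
apply is_lim_seq_plus'; [apply is_lim_seq_const|].
apply (is_lim_seq_zero _ (fun K => B * PI / INR (2 * K + 1))); [apply is_lim_seq_cst_div_odd|].
intros K. rewrite Rabs_minus_sym.
assert (HK : 0 < INR (2 * K + 1)) by (apply lt_0_INR; lia).
assert (Hs0 : 0 < sin (t / 2)) by now apply sin_half_pos.
assert (HP := PI_RGT_0).
assert (HB : 0 <= B) by (unfold B; left; apply Rdiv_lt_0_compat; [lra | now apply pow_lt]).
eapply Rle_trans.
- apply (MVT_bound _ _ t PI (B / INR (2 * K + 1)) (proj2 Ht) (fun s _ => Hd K s)).
  intros s Hs. rewrite Rabs_Ropp. eapply Rle_trans; [apply sawtooth_bound; lra|].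
  apply Rmult_le_compat_r; [left; now apply Rinv_0_lt_compat|].
  unfold B. apply Rmult_le_compat_l; [lra|].
  apply Rinv_le_contravar; [now apply pow_lt|]. apply pow_incr.
  split; [lra|]. apply sin_half_mono; lra.
- replace (B * PI / INR (2 * K + 1)) with (B / INR (2 * K + 1) * PI) by (field; lra).
  apply Rmult_le_compat_l; [|lra]. apply Rmult_le_pos; [exact HB|].
  left; now apply Rinv_0_lt_compat.
Qed.

Lemma cos_sum_tail (K L : nat) (t : R) :
  Rabs (cos_sum (K + L) t - cos_sum K t)
  <= rsum (fun n => / INR (S n) ^ 2) (K + L) - rsum (fun n => / INR (S n) ^ 2) K.
Proof.
unfold cos_sum. rewrite !rsum_app.
match goal with |- Rabs (?a + ?b - ?a) <= ?c + ?d - ?c =>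
  replace (a + b - a) with b by ring; replace (c + d - c) with d by ring end.
eapply Rle_trans; [apply Rabs_rsum|]. apply rsum_le; intros i _.
assert (H := INR_S_pos (K + i)).
assert (Hp : 0 < / INR (S (K + i)) ^ 2) by (apply Rinv_0_lt_compat, pow_lt, H).
unfold Rdiv. rewrite Rabs_mult, (Rabs_pos_eq (/ _)) by lra.
rewrite <- (Rmult_1_l (/ _)) at 2. apply Rmult_le_compat_r; [lra|].
apply Rabs_le, COS_bound.
Qed.

Lemma cos_sum_0 (K : nat) : cos_sum K 0 = rsum (fun n => / INR (S n) ^ 2) K.
Proof.
apply rsum_ext; intros m _. rewrite Rmult_0_r, cos_0. field.
apply Rgt_not_eq, INR_S_pos.
Qed.

Lemma cos_sum_pi_even (K : nat) :
  cos_sum (2 * K) PI = / 2 * rsum (fun n => / INR (S n) ^ 2) K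
    - rsum (fun n => / INR (S n) ^ 2) (2 * K).
Proof.
induction K as [|K IH]; [unfold cos_sum; simpl; ring|].
replace (2 * S K)%nat with (S (S (2 * K))) by lia.
change (cos_sum (S (S (2 * K))) PI) with (cos_sum (2 * K) PI +
  cos (INR (S (2 * K)) * PI) / INR (S (2 * K)) ^ 2 +
  cos (INR (S (S (2 * K))) * PI) / INR (S (S (2 * K))) ^ 2).
rewrite !rsum_S, IH, !cos_nat_pi.
replace ((-1) ^ S (2 * K)) with (-1) by (rewrite pow_1_odd; reflexivity).
replace ((-1) ^ S (S (2 * K))) with 1
  by (replace (S (S (2 * K))) with (2 * S K)%nat by lia; rewrite pow_1_even; reflexivity).
replace (INR (S (S (2 * K)))) with (2 * INR (S K))
  by (rewrite !S_INR, mult_INR; simpl; ring).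
assert (H := INR_S_pos K). assert (H1 := INR_S_pos (2 * K)). field. split; lra.
Qed.

Lemma is_lim_seq_subseq_double (u : nat -> R) (l : R) :
  is_lim_seq u l -> is_lim_seq (fun n => u (2 * n)%nat) l.
Proof.
intros H. apply (is_lim_seq_subseq u l (fun n => (2 * n)%nat)); [|exact H].
apply eventually_subseq. intros n; lia.
Qed.

Lemma is_lim_seq_unique_R (u : nat -> R) (a b : R) : is_lim_seq u a -> is_lim_seq u b -> a = b.
Proof.
intros Ha Hb. apply is_lim_seq_unique in Ha. apply is_lim_seq_unique in Hb. congruence.
Qed.

Lemma cos_sum_ex (t : R) : exists l : R, is_lim_seq (fun K => cos_sum K t) l.
Proof.
apply (ex_lim_of_increments _ 1). intros n.
eapply Rle_trans; [replace (S n) with (n + 1)%nat by lia; apply cos_sum_tail|].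
rewrite rsum_app. simpl. rewrite Nat.add_0_r. right.
assert (H := INR_S_pos n). simpl in H. field. lra.
Qed.

Lemma cos_sum_tail_lim (K : nat) (t l : R) : is_lim_seq (fun K => cos_sum K t) l ->
  Rabs (l - cos_sum K t) <= inv_sqr_sum - rsum (fun n => / INR (S n) ^ 2) K.
Proof.
intros H.
apply (is_lim_seq_le (fun L => Rabs (cos_sum (L + K) t - cos_sum K t))
  (fun L => rsum (fun n => / INR (S n) ^ 2) (L + K) - rsum (fun n => / INR (S n) ^ 2) K)
  (Rabs (l - cos_sum K t)) (inv_sqr_sum - rsum (fun n => / INR (S n) ^ 2) K)).
- intros L. rewrite Nat.add_comm. apply cos_sum_tail.
- apply (is_lim_seq_abs _ (Finite _)), is_lim_seq_minus'; [|apply is_lim_seq_const].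
  now apply is_lim_seq_incr_n.
- apply is_lim_seq_minus'; [|apply is_lim_seq_const].
  apply (is_lim_seq_incr_n (fun L => rsum (fun n => / INR (S n) ^ 2) L)), inv_sqr_sum_lim.
Qed.

(** At [PI] the series alternates, and separating even indices gives [- 1/2] times the still unknown
    sum of inverse squares; [cos_sum_diff] carries this to the other points. *)
Lemma cos_sum_limit_pos (t : R) : 0 < t <= PI ->
  is_lim_seq (fun K => cos_sum K t) (- (1 / 2) * inv_sqr_sum + (PI - t) ^ 2 / 4).
Proof.
intros Ht.
assert (HPI : is_lim_seq (fun K => cos_sum K PI) (- (1 / 2) * inv_sqr_sum)).
{ destruct (cos_sum_ex PI) as [l Hl].
  replace (- (1 / 2) * inv_sqr_sum) with l; [exact Hl|].
  apply (is_lim_seq_unique_R (fun K => cos_sum (2 * K) PI)); [now apply is_lim_seq_subseq_double|].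
  apply (is_lim_seq_ext (fun K => / 2 * rsum (fun n => / INR (S n) ^ 2) K
    - rsum (fun n => / INR (S n) ^ 2) (2 * K))); [intros; now rewrite cos_sum_pi_even|].
  replace (- (1 / 2) * inv_sqr_sum) with (/ 2 * inv_sqr_sum - inv_sqr_sum) by field.
  apply is_lim_seq_minus'.
  - apply is_lim_seq_mult'; [apply is_lim_seq_const | apply inv_sqr_sum_lim].
  - apply (is_lim_seq_subseq_double (fun K => rsum (fun n => / INR (S n) ^ 2) K)), inv_sqr_sum_lim. }
apply (is_lim_seq_ext (fun K => cos_sum K PI + (cos_sum K t - cos_sum K PI))); [intros; ring|].
apply is_lim_seq_plus'; [exact HPI | now apply cos_sum_diff].
Qed.

Lemma continuity_cos_sum (K : nat) (t : R) : continuous (cos_sum K) t.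
Proof.
apply (ex_derive_continuous (cos_sum K)). eexists. apply is_derive_rsum. intros m _.
apply (is_derive_ext (fun s => cos (INR (S m) * s + 0) / INR (S m) ^ 2)).
{ intros; now rewrite Rplus_0_r. }
apply is_derive_Rdiv; [apply is_derive_cos_lin | exact (is_derive_const (INR (S m) ^ 2) t)
  | apply pow_nonzero, Rgt_not_eq, INR_S_pos].
Qed.

(** The cosine series converges uniformly, so its sum is continuous at 0. Letting [t] tend to 0 in
    [cos_sum_limit_pos] gives [s = - s / 2 + PI^2 / 4] for the unknown sum [s]. *)
Lemma basel : inv_sqr_sum = PI ^ 2 / 6.
Proof.
assert (HP := PI_RGT_0).
set (d := inv_sqr_sum - (- (1 / 2) * inv_sqr_sum + PI ^ 2 / 4)).
assert (Hd : d = 0); [|unfold d in Hd; lra].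
assert (H : Rabs d <= 0); [|generalize (Rabs_pos d); intros; apply Rabs_eq_0; lra].
apply Rle_eps. intros eps He.
assert (HT : is_lim_seq (fun K => inv_sqr_sum - rsum (fun n => / INR (S n) ^ 2) K)
  (inv_sqr_sum - inv_sqr_sum)).
{ apply is_lim_seq_minus'; [apply is_lim_seq_const | apply inv_sqr_sum_lim]. }
rewrite Rminus_diag in HT.
destruct (is_lim_seq_small _ _ (eps / 4) HT ltac:(lra)) as [K HK].
specialize (HK K (le_n _)). rewrite Rminus_0_r in HK.
apply Rabs_le_between in HK.
destruct (continuity_cos_sum K 0 (ball (cos_sum K 0) (mkposreal (eps / 4) ltac:(lra)))) as [dl Hdl].
{ now exists (mkposreal (eps / 4) ltac:(lra)). }
(* Three demands on [t]: continuity of the partial sum at 0, the range of [cos_sum_limit_pos], and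
   closeness of the quadratic term to its value at 0. *)
set (t := Rmin (dl / 2) (Rmin PI (eps / (4 * PI)))).
assert (Ht0 : 0 < t).
{ unfold t. repeat apply Rmin_glb_lt; [generalize (cond_pos dl); lra | lra|].
  apply Rdiv_lt_0_compat; lra. }
assert (Ht1 : t <= dl / 2) by apply Rmin_l.
assert (Ht2 : t <= PI) by (eapply Rle_trans; [apply Rmin_r | apply Rmin_l]).
assert (Ht3 : t <= eps / (4 * PI)) by (eapply Rle_trans; [apply Rmin_r | apply Rmin_r]).
specialize (Hdl t).
assert (Hb : Rabs (cos_sum K t - cos_sum K 0) < eps / 4).
{ apply Hdl. change (Rabs (t - 0) < dl). rewrite Rminus_0_r, Rabs_pos_eq by lra.
  generalize (cond_pos dl); lra. }
assert (Hl := cos_sum_tail_lim K t _ (cos_sum_limit_pos t (conj Ht0 Ht2))).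
rewrite cos_sum_0 in Hb.
apply Rabs_def2 in Hb. apply Rabs_le_between in Hl.
assert (Hq : Rabs ((PI - t) ^ 2 / 4 - PI ^ 2 / 4) <= eps / 4).
{ replace ((PI - t) ^ 2 / 4 - PI ^ 2 / 4) with (- (t * (2 * PI - t) / 4)) by field.
  rewrite Rabs_Ropp, Rabs_pos_eq by nra.
  apply (Rmult_le_compat_r (4 * PI)) in Ht3; [|lra].
  replace (eps / (4 * PI) * (4 * PI)) with eps in Ht3 by (field; lra). nra. }
apply Rabs_le_between in Hq. apply Rabs_le. unfold d. lra.
Qed.

(* Bernoulli polynomial divided by [j!]. *)
Definition bern_poly (j : nat) (x : R) : R :=
  rsum (fun i => bern_fact i * (x ^ (j - i) / INR (fact (j - i)))) (S j).

Lemma bern_poly_at_0 (j : nat) : bern_poly j 0 = bern_fact j.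
Proof.
unfold bern_poly. rewrite rsum_S, rsum_0, Nat.sub_diag.
- simpl. field.
- intros i Hi. rewrite pow_i by lia. unfold Rdiv. ring.
Qed.

Lemma bern_poly_0 (x : R) : bern_poly 0 x = 1.
Proof. unfold bern_poly. simpl. rewrite bern_fact_0. field. Qed.

Lemma bern_poly_at_1 (j : nat) : (2 <= j)%nat -> bern_poly j 1 = bern_fact j.
Proof.
intros Hj. unfold bern_poly. rewrite rsum_S, Nat.sub_diag. destruct j as [|p]; [lia|].
rewrite (rsum_ext _ (fun i => bern_fact i / INR (fact (S p - i)))).
- rewrite bern_fact_rec by lia. simpl. field.
- intros i _. rewrite pow1. unfold Rdiv. ring.
Qed.

Lemma is_derive_bern_poly (j : nat) (x : R) : is_derive (bern_poly (S j)) x (bern_poly j x).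
Proof.
unfold bern_poly.
apply (is_derive_ext (fun x => rsum (fun i => bern_fact i *
  ((x - 0) ^ S (j - i) / INR (fact (S (j - i))))) (S j) + bern_fact (S j))).
- intros t. rewrite (rsum_S _ (S j)), Nat.sub_diag. f_equal; [|simpl; field].
  apply rsum_ext; intros i Hi. now replace (S j - i)%nat with (S (j - i)) by lia; rewrite Rminus_0_r.
- eapply is_derive_eq.
  + apply is_derive_Rplus; [|exact (is_derive_const (bern_fact (S j)) x)].
    apply is_derive_rsum. intros i _.
    apply (is_derive_Rmult (fun _ => bern_fact i)); [exact (is_derive_const (bern_fact i) x)|].
    exact (proj1 (Cderiv_monomial 0 x (j - i))).
  + change (@zero R_NormedModule) with 0. rewrite Rplus_0_r. apply rsum_ext. intros i _.
    simpl fst. rewrite Rminus_0_r. ring.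
Qed.

(** Partial Fourier sum of [bern_poly j] on [[0, 1]]. The phase [j * PI / 2] covers cosine and sine
    series alike, and differentiation lowers [j] by one. *)
Definition bern_trig (j K : nat) (x : R) : R :=
  rsum (fun m => - 2 * cos (2 * PI * INR (S m) * x - INR j * (PI / 2)) / (2 * PI * INR (S m)) ^ j) K.

Lemma two_pi_S_pos (m : nat) : 0 < 2 * PI * INR (S m).
Proof. generalize PI_RGT_0 (INR_S_pos m); intros; nra. Qed.

Lemma is_derive_bern_trig (j K : nat) (x : R) : is_derive (bern_trig (S j) K) x (bern_trig j K x).
Proof.
apply is_derive_rsum. intros m _.
assert (H := two_pi_S_pos m). set (a := 2 * PI * INR (S m)) in *.
apply (is_derive_ext (fun x => - 2 * cos (a * x + - (INR (S j) * (PI / 2))) / a ^ S j)).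
{ reflexivity. }
eapply is_derive_eq.
- apply is_derive_Rdiv.
  + apply (is_derive_Rmult (fun _ => -2)); [exact (is_derive_const (-2) x) | apply is_derive_cos_lin].
  + exact (is_derive_const (a ^ S j) x).
  + apply pow_nonzero; lra.
- change (@zero R_NormedModule) with 0.
  rewrite S_INR. replace (a * x + - ((INR j + 1) * (PI / 2))) with
    (- (PI / 2 - (a * x - INR j * (PI / 2)))) by field.
  rewrite cos_neg, sin_neg, cos_shift, sin_shift.
  assert (Hp : a ^ j <> 0) by (apply pow_nonzero; lra). simpl. field. split; lra.
Qed.

Lemma bern_trig_tail (j K L : nat) (x : R) : (2 <= j)%nat ->
  Rabs (bern_trig j (K + L) x - bern_trig j K x)
  <= rsum (fun n => / INR (S n) ^ 2) (K + L) - rsum (fun n => / INR (S n) ^ 2) K.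
Proof.
intros Hj. unfold bern_trig. rewrite !rsum_app.
match goal with |- Rabs (?a + ?b - ?a) <= ?c + ?d - ?c =>
  replace (a + b - a) with b by ring; replace (c + d - c) with d by ring end.
eapply Rle_trans; [apply Rabs_rsum|]. apply rsum_le; intros i _.
assert (H := INR_S_ge1 (K + i)). set (n := INR (S (K + i))) in *.
assert (H3 := PI2_3_2).
assert (Hn2 : 0 < n ^ 2) by (apply pow_lt; lra).
assert (Ha : 2 * n ^ 2 <= (2 * PI * n) ^ j).
{ apply Rle_trans with ((2 * PI * n) ^ 2).
  - rewrite Rpow_mult_distr. apply Rmult_le_compat_r; [lra|]. nra.
  - apply Rle_pow; [nra | exact Hj]. }
unfold Rdiv. rewrite Rabs_mult, Rabs_mult.
rewrite (Rabs_pos_eq (/ _)) by (left; apply Rinv_0_lt_compat; lra).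
replace (Rabs (-2)) with 2 by (rewrite Rabs_left; lra).
match goal with |- context [Rabs (cos ?a)] =>
  assert (Hc : Rabs (cos a) <= 1) by (apply Rabs_le, COS_bound) end.
replace (/ n ^ 2) with (2 * 1 * / (2 * n ^ 2)) by (field; lra).
apply Rmult_le_compat.
- apply Rmult_le_pos; [lra | apply Rabs_pos].
- left; apply Rinv_0_lt_compat; lra.
- apply Rmult_le_compat_l; [lra | exact Hc].
- apply Rinv_le_contravar; lra.
Qed.

Lemma bern_trig_ex (j : nat) (x : R) : (2 <= j)%nat ->
  exists l : R, is_lim_seq (fun K => bern_trig j K x) l.
Proof.
intros Hj. apply (ex_lim_of_increments _ 1). intros n.
eapply Rle_trans; [replace (S n) with (n + 1)%nat by lia; now apply bern_trig_tail|].
rewrite rsum_app. simpl. rewrite Nat.add_0_r. right.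
assert (H := INR_S_pos n). simpl in H. field. lra.
Qed.

Definition inv_sqr_tail (K : nat) : R := inv_sqr_sum - rsum (fun n => / INR (S n) ^ 2) K.

Lemma inv_sqr_tail_lim : is_lim_seq inv_sqr_tail 0.
Proof.
replace (Finite 0) with (Finite (inv_sqr_sum - inv_sqr_sum)) by (f_equal; ring).
apply is_lim_seq_minus'; [apply is_lim_seq_const | apply inv_sqr_sum_lim].
Qed.

Lemma bern_trig_tail_lim (j K : nat) (x l : R) : (2 <= j)%nat ->
  is_lim_seq (fun K => bern_trig j K x) l -> Rabs (l - bern_trig j K x) <= inv_sqr_tail K.
Proof.
intros Hj H.
apply (is_lim_seq_le (fun L => Rabs (bern_trig j (L + K) x - bern_trig j K x))
  (fun L => rsum (fun n => / INR (S n) ^ 2) (L + K) - rsum (fun n => / INR (S n) ^ 2) K)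
  (Rabs (l - bern_trig j K x)) (inv_sqr_sum - rsum (fun n => / INR (S n) ^ 2) K)).
- intros L. rewrite Nat.add_comm. now apply bern_trig_tail.
- apply (is_lim_seq_abs _ (Finite _)), is_lim_seq_minus'; [|apply is_lim_seq_const].
  now apply (is_lim_seq_incr_n (fun K => bern_trig j K x)).
- apply is_lim_seq_minus'; [|apply is_lim_seq_const].
  apply (is_lim_seq_incr_n (fun L => rsum (fun n => / INR (S n) ^ 2) L)), inv_sqr_sum_lim.
Qed.

Lemma primitive_limit (F f : nat -> R -> R) (G g : R -> R) (e : nat -> R) (a b : R) :
  a <= b -> (forall K x, a <= x <= b -> is_derive (F K) x (f K x)) ->
  (forall x, a <= x <= b -> is_derive G x (g x)) ->
  (forall K x, a <= x <= b -> Rabs (f K x - g x) <= e K) -> is_lim_seq e 0 ->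
  is_lim_seq (fun K => F K b - F K a) (G b - G a).
Proof.
intros Hab HF HG He Hl.
replace (Finite (G b - G a)) with (Finite (0 + (G b - G a))) by (f_equal; ring).
apply (is_lim_seq_ext (fun K => ((F K b - G b) - (F K a - G a)) + (G b - G a))); [intros; ring|].
apply is_lim_seq_plus'; [|apply is_lim_seq_const].
apply (is_lim_seq_zero _ (fun K => e K * (b - a))).
- replace (Finite 0) with (Finite (0 * (b - a))) by (f_equal; ring).
  apply is_lim_seq_mult'; [exact Hl | apply is_lim_seq_const].
- intros K. apply (MVT_bound (fun x => F K x - G x) (fun x => f K x - g x)); [exact Hab| |].
  + intros x Hx. apply is_derive_Rminus; [now apply HF | now apply HG].
  + intros x Hx. now apply He.
Qed.

(** The substitution [t = 2 * PI * x] leads to [cos_sum], whose limit is known on [(0, PI]]. The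
    reflection [t -> 2 * PI - t] covers [x > 1/2], and at [x = 0] and [x = 1] the value is that of
    [basel]. *)
Lemma bern_trig_lim_2 (x : R) : 0 <= x <= 1 -> is_lim_seq (fun K => bern_trig 2 K x) (bern_poly 2 x).
Proof.
intros Hx. assert (HP := PI_RGT_0).
assert (E : forall K, bern_trig 2 K x = / (2 * PI ^ 2) * cos_sum K (2 * PI * x)).
{ intros K. unfold bern_trig, cos_sum. rewrite <- rsum_scal. apply rsum_ext; intros m _.
  replace (2 * PI * INR (S m) * x - INR 2 * (PI / 2)) with
    (INR (S m) * (2 * PI * x) - PI) by (simpl; field).
  rewrite <- cos_neg. replace (- (INR (S m) * (2 * PI * x) - PI)) with
    (- (INR (S m) * (2 * PI * x)) + PI) by ring.
  rewrite neg_cos, cos_neg. assert (H := INR_S_pos m). field. split; lra. }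
apply (is_lim_seq_ext _ _ _ (fun K => eq_sym (E K))).
assert (Eb : bern_poly 2 x = / (2 * PI ^ 2) * (- (1 / 2) * inv_sqr_sum + (PI - 2 * PI * x) ^ 2 / 4)).
{ rewrite basel. unfold bern_poly. simpl. rewrite bern_fact_0, bern_fact_1, bern_fact_2.
  field. lra. }
rewrite Eb. apply is_lim_seq_mult'; [apply is_lim_seq_const|].
destruct (Req_dec x 0) as [->|Hx0].
{ rewrite Rmult_0_r. apply (is_lim_seq_ext _ _ _ (fun K => eq_sym (cos_sum_0 K))).
  replace (- (1 / 2) * inv_sqr_sum + (PI - 0) ^ 2 / 4) with inv_sqr_sum by (rewrite basel; field).
  apply inv_sqr_sum_lim. }
destruct (Rle_dec x (1 / 2)) as [H|H].
{ apply cos_sum_limit_pos. nra. }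
assert (Es : forall K t, cos_sum K (2 * PI - t) = cos_sum K t).
{ intros K t. apply rsum_ext; intros m _. f_equal.
  rewrite Rmult_minus_distr_l.
  replace (INR (S m) * (2 * PI) - INR (S m) * t) with (- (INR (S m) * t) + 2 * INR (S m) * PI) by ring.
  rewrite cos_period. apply cos_neg. }
destruct (Req_dec x 1) as [->|Hx1].
{ apply (is_lim_seq_ext (fun K => cos_sum K 0)).
  { intros K. rewrite <- Es. f_equal. ring. }
  apply (is_lim_seq_ext _ _ _ (fun K => eq_sym (cos_sum_0 K))).
  replace (- (1 / 2) * inv_sqr_sum + (PI - 2 * PI * 1) ^ 2 / 4) with inv_sqr_sum
    by (rewrite basel; field).
  apply inv_sqr_sum_lim. }
apply (is_lim_seq_ext (fun K => cos_sum K (2 * PI - 2 * PI * x))); [intros; apply Es|].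
replace ((PI - 2 * PI * x) ^ 2) with ((PI - (2 * PI - 2 * PI * x)) ^ 2) by ring.
apply cos_sum_limit_pos. nra.
Qed.

Lemma bern_trig_period (j K n : nat) (x : R) : bern_trig j K (x + INR n) = bern_trig j K x.
Proof.
apply rsum_ext; intros m _. f_equal. f_equal.
replace (2 * PI * INR (S m) * (x + INR n) - INR j * (PI / 2)) with
  (2 * PI * INR (S m) * x - INR j * (PI / 2) + 2 * INR (S m * n) * PI)
  by (rewrite mult_INR; ring).
apply cos_period.
Qed.

(** Uniform convergence integrates order [j] to order [j + 1] up to a constant [c]. Integrating once
    more over [[0, 1]] isolates [c], and it is 0: the trigonometric sums are periodic and
    [bern_poly] takes equal values at both ends. *)
Lemma bern_trig_lim (j : nat) (x : R) : (2 <= j)%nat -> 0 <= x <= 1 ->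
  is_lim_seq (fun K => bern_trig j K x) (bern_poly j x).
Proof.
intros Hj; revert x. induction j as [|j IH]; intros x Hx; [lia|].
destruct (Nat.eq_dec j 1) as [->|Hne]; [now apply bern_trig_lim_2|].
specialize (IH ltac:(lia)).
destruct (bern_trig_ex (S j) 0 Hj) as [l0 Hl0].
set (c := l0 - bern_poly (S j) 0).
assert (Hlim : forall x, 0 <= x <= 1 ->
  is_lim_seq (fun K => bern_trig (S j) K x) (bern_poly (S j) x + c)).
{ clear x Hx. intros x Hx.
  apply (is_lim_seq_ext (fun K => (bern_trig (S j) K x - bern_trig (S j) K 0) + bern_trig (S j) K 0));
    [intros; ring|].
  replace (bern_poly (S j) x + c) with ((bern_poly (S j) x - bern_poly (S j) 0) + l0)
    by (unfold c; ring).
  apply is_lim_seq_plus'; [|exact Hl0].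
  apply (primitive_limit (bern_trig (S j)) (bern_trig j) _ (bern_poly j) inv_sqr_tail);
    [lra | | | |apply inv_sqr_tail_lim].
  - intros; apply is_derive_bern_trig.
  - intros; apply is_derive_bern_poly.
  - intros K t Ht. rewrite Rabs_minus_sym. apply bern_trig_tail_lim; [lia | apply IH; lra]. }
assert (Hc : c = 0).
{ assert (H : is_lim_seq (fun K => bern_trig (S (S j)) K 1 - bern_trig (S (S j)) K 0)
    ((bern_poly (S (S j)) 1 + c * 1) - (bern_poly (S (S j)) 0 + c * 0))).
  { apply (primitive_limit (bern_trig (S (S j))) (bern_trig (S j)) (fun x => bern_poly (S (S j)) x + c * x)
      (fun x => bern_poly (S j) x + c) inv_sqr_tail); [lra | | | |apply inv_sqr_tail_lim].
    - intros; apply is_derive_bern_trig.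
    - intros K t. apply is_derive_Rplus; [apply is_derive_bern_poly|].
      eapply is_derive_eq; [apply (is_derive_Rmult (fun _ => c));
        [exact (is_derive_const c K) | exact (is_derive_id K)]|].
      change (@zero R_NormedModule) with 0. change (@one R_AbsRing) with 1. ring.
    - intros K t Ht. rewrite Rabs_minus_sym. apply bern_trig_tail_lim; [lia | apply Hlim; lra]. }
  rewrite bern_poly_at_0, bern_poly_at_1 in H by lia.
  replace (bern_fact (S (S j)) + c * 1 - (bern_fact (S (S j)) + c * 0)) with c in H by ring.
  apply (is_lim_seq_unique_R _ _ _ H).
  apply (is_lim_seq_ext (fun _ => 0)); [|apply is_lim_seq_const].
  intros K. rewrite <- (bern_trig_period _ K 1 0), Rplus_0_l. simpl (INR 1). ring. }
replace (bern_poly (S j) x) with (bern_poly (S j) x + c) by (rewrite Hc; ring).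
now apply Hlim.
Qed.

(** At [x = 0] every term of the odd-order Fourier series is a cosine at an odd multiple of
    [PI / 2]. *)
Lemma bern_fact_odd (k : nat) : (1 <= k)%nat -> bern_fact (2 * k + 1) = 0.
Proof.
intros Hk. rewrite <- bern_poly_at_0.
apply (is_lim_seq_unique_R _ _ _ (bern_trig_lim (2 * k + 1) 0 ltac:(lia) ltac:(lra))).
apply (is_lim_seq_ext (fun _ => 0)); [|apply is_lim_seq_const].
intros K. symmetry. apply rsum_0. intros m _.
rewrite Rmult_0_r, Rminus_0_l, cos_neg, plus_INR, mult_INR.
replace ((INR 2 * INR k + INR 1) * (PI / 2)) with ((INR k + 1 / 2) * PI) by (simpl; field).
rewrite cos_half_odd_pi. unfold Rdiv. ring.
Qed.

Definition fourier_coeff (k m : nat) : R := (-1) ^ S k * 2 / (2 * PI * INR (S m)) ^ (2 * k).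

Lemma bern_trig_even (k K : nat) (x : R) :
  bern_trig (2 * k) K x = rsum (fun m => fourier_coeff k m * cos (2 * PI * INR (S m) * x)) K.
Proof.
apply rsum_ext; intros m _. unfold fourier_coeff.
replace (2 * PI * INR (S m) * x - INR (2 * k) * (PI / 2)) with
  (- (INR k * PI - 2 * PI * INR (S m) * x)) by (rewrite mult_INR; simpl; field).
rewrite cos_neg, cos_minus, sin_nat_pi, cos_nat_pi.
assert (H := two_pi_S_pos m). simpl ((-1) ^ S k). field. apply pow_nonzero. lra.
Qed.

Lemma fourier_coeff_bound (k m : nat) : (1 <= k)%nat -> Rabs (fourier_coeff k m) <= 1 / INR (S m) ^ (2 * k).
Proof.
intros Hk. unfold fourier_coeff, Rdiv.
rewrite Rabs_mult, Rabs_mult, pow_1_abs, (Rabs_pos_eq 2) by lra.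
assert (H := INR_S_ge1 m). assert (H3 := PI2_3_2).
rewrite Rabs_pos_eq by (left; apply Rinv_0_lt_compat, pow_lt; nra).
rewrite Rpow_mult_distr.
assert (H2 : 2 <= (2 * PI) ^ (2 * k)).
{ apply Rle_trans with ((2 * PI) ^ 1); [nra|]. apply Rle_pow; [lra|lia]. }
assert (Hn : 0 < INR (S m) ^ (2 * k)) by (apply pow_lt; lra).
rewrite Rinv_mult. rewrite Rmult_1_l, <- Rmult_assoc. apply Rmult_le_compat_r.
- left; now apply Rinv_0_lt_compat.
- apply (Rmult_le_reg_r ((2 * PI) ^ (2 * k))); [lra|]. rewrite Rmult_assoc, Rinv_l by lra. lra.
Qed.

Lemma fourier_coeff_sum (k : nat) : (1 <= k)%nat ->
  is_lim_seq (rsum (fourier_coeff k)) (bern_fact (2 * k)).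
Proof.
intros Hk. rewrite <- bern_poly_at_0.
apply (is_lim_seq_ext (fun K => bern_trig (2 * k) K 0)); [|apply bern_trig_lim; [lia|lra]].
intros K. rewrite bern_trig_even. apply rsum_ext; intros m _.
rewrite Rmult_0_r, cos_0. ring.
Qed.

(** * Euler's constant and the cosine integral *)

Lemma ln_le_minus_one (x : R) : 0 < x -> ln x <= x - 1.
Proof. intros Hx. generalize (exp_ineq1_le (ln x)). rewrite exp_ln by exact Hx. lra. Qed.

Lemma ln_incr_bounds (x : R) : 0 < x -> / (x + 1) <= ln (x + 1) - ln x <= / x.
Proof.
intros Hx. rewrite <- ln_div by lra. split.
- assert (H := ln_le_minus_one (x / (x + 1)) ltac:(apply Rdiv_lt_0_compat; lra)).
  rewrite ln_div in * by lra.
  replace (/ (x + 1)) with (- (x / (x + 1) - 1)) by (field; lra). lra.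
- assert (H := ln_le_minus_one ((x + 1) / x) ltac:(apply Rdiv_lt_0_compat; lra)).
  replace (/ x) with ((x + 1) / x - 1) by (field; lra). exact H.
Qed.

(** With [ln (n + 1)] in place of [ln n] the sequence increases from 0, so its distance to
    [euler_gamma] has a sign. *)
Definition gamma_seq (n : nat) : R := harmonic n - ln (INR (S n)).

Lemma gamma_seq_step (n : nat) :
  0 <= gamma_seq (S n) - gamma_seq n <= / INR (S n) - / INR (S (S n)).
Proof.
unfold gamma_seq. rewrite harmonic_S.
assert (H := ln_incr_bounds (INR (S n)) (INR_S_pos n)).
rewrite <- (S_INR (S n)) in H. lra.
Qed.

Lemma harmonic_ln_lim : is_lim_seq (fun n => harmonic n - ln (INR n)) euler_gamma.
Proof.
destruct (ex_lim_of_increments gamma_seq 1) as [l Hl].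
{ intros n. assert (H := gamma_seq_step n). assert (Hn := INR_S_ge1 n).
  rewrite Rabs_pos_eq by lra. eapply Rle_trans; [apply H|].
  rewrite (S_INR (S n)). set (a := INR (S n)) in *.
  replace (/ a - / (a + 1)) with (1 / (a * (a + 1))) by (field; lra).
  apply Rmult_le_compat_l; [lra|]. apply Rinv_le_contravar; nra. }
assert (H : is_lim_seq (fun n => harmonic n - ln (INR n)) l).
{ apply is_lim_seq_incr_1. apply (is_lim_seq_ext (fun n => gamma_seq n + / INR (S n))).
  - intros n. unfold gamma_seq. rewrite harmonic_S. ring.
  - replace (Finite l) with (Finite (l + 0)) by (f_equal; ring).
    apply is_lim_seq_plus'; [exact Hl | apply is_lim_seq_inv_INR_S]. }
unfold euler_gamma. now rewrite (is_lim_seq_unique _ _ H).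
Qed.

Lemma gamma_seq_lim : is_lim_seq gamma_seq euler_gamma.
Proof.
apply (is_lim_seq_ext (fun n => (harmonic (S n) - ln (INR (S n))) - / INR (S n))).
{ intros n. unfold gamma_seq. rewrite harmonic_S. ring. }
replace (Finite euler_gamma) with (Finite (euler_gamma - 0)) by (f_equal; ring).
apply is_lim_seq_minus'; [|apply is_lim_seq_inv_INR_S].
apply (is_lim_seq_incr_1 (fun n => harmonic n - ln (INR n))), harmonic_ln_lim.
Qed.

Lemma gamma_seq_error (n : nat) : 0 <= euler_gamma - gamma_seq n <= / INR (S n).
Proof.
assert (H : forall k, 0 <= gamma_seq (k + n) - gamma_seq n <= / INR (S n) - / INR (S (k + n))).
{ intros k; induction k as [|k IH]; [simpl (0 + n)%nat; lra|].
  assert (H := gamma_seq_step (k + n)). simpl (S k + n)%nat. lra. }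
assert (HL : is_lim_seq (fun k => gamma_seq (k + n) - gamma_seq n) (euler_gamma - gamma_seq n)).
{ apply is_lim_seq_minus'; [|apply is_lim_seq_const].
  apply is_lim_seq_incr_n, gamma_seq_lim. }
split.
- apply (is_lim_seq_le (fun _ => 0) _ 0 (euler_gamma - gamma_seq n) (fun k => proj1 (H k)));
    [apply is_lim_seq_const | exact HL].
- assert (H2 : forall k, gamma_seq (k + n) - gamma_seq n <= / INR (S n)).
  { intros k. generalize (H k) (Rinv_0_lt_compat _ (INR_S_pos (k + n))); lra. }
  apply (is_lim_seq_le _ (fun _ => / INR (S n)) (euler_gamma - gamma_seq n) (/ INR (S n)) H2);
    [exact HL | apply is_lim_seq_const].
Qed.

(** * The cosine integral *)

Definition cin_integrand (t : R) : R := (1 - cos t) / t.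

(** The entire cosine integral, [Cin t = euler_gamma + ln t - Ci t]. Division by 0 does no harm in
    the integrand: the numerator makes it 0 there, which is the continuous value. *)
Definition Cin (t : R) : R := RInt cin_integrand 0 t.

Lemma one_minus_cos_bounds (t : R) : 0 <= 1 - cos t <= t ^ 2 / 2.
Proof.
replace (cos t) with (cos (2 * (t / 2))) by (f_equal; field).
rewrite cos_2a_sin.
assert (H : forall u, sin u ^ 2 <= u ^ 2).
{ assert (Hp : forall u, 0 <= u -> Rabs (sin u) <= u).
  { intros u Hu.
    assert (HM := MVT_bound sin cos 0 u 1 Hu (fun t _ => is_derive_sin t)
      (fun t _ => Rabs_le _ _ (COS_bound t))).
    rewrite sin_0, !Rminus_0_r in HM. lra. }
  intros u. rewrite <- (pow2_abs (sin u)), <- (pow2_abs u).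
  apply pow_incr. split; [apply Rabs_pos|].
  destruct (Rle_dec 0 u) as [Hu|Hu].
  - rewrite (Rabs_pos_eq u) by exact Hu. now apply Hp.
  - rewrite <- (Rabs_Ropp u), <- (Rabs_Ropp (sin u)), <- sin_neg, (Rabs_pos_eq (- u)) by lra.
    apply Hp; lra. }
specialize (H (t / 2)). nra.
Qed.

Lemma cin_integrand_bound (t : R) : Rabs (cin_integrand t) <= Rabs t.
Proof.
unfold cin_integrand. destruct (Req_dec t 0) as [->|H].
- rewrite cos_0, Rminus_diag. unfold Rdiv. rewrite Rmult_0_l. lra.
- unfold Rdiv. rewrite Rabs_mult, Rabs_inv by exact H.
  assert (Hb := one_minus_cos_bounds t). rewrite (Rabs_pos_eq (1 - _)) by lra.
  assert (Ht := Rabs_pos_lt t H).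
  apply (Rmult_le_reg_r (Rabs t)); [exact Ht|]. rewrite Rmult_assoc, Rinv_l by lra.
  rewrite <- Rabs_mult, Rabs_pos_eq by nra. nra.
Qed.

Lemma cin_integrand_bound_1 (t : R) : 0 <= t -> Rabs (cin_integrand t) <= 1.
Proof.
intros Ht. destruct (Rle_dec t 1) as [H|H].
- eapply Rle_trans; [apply cin_integrand_bound|]. rewrite Rabs_pos_eq; lra.
- unfold cin_integrand. rewrite Rabs_pos_eq.
  + apply (Rmult_le_reg_r t); [lra|]. unfold Rdiv. rewrite Rmult_assoc, Rinv_l by lra.
    destruct (Rle_dec 2 t) as [H2|H2].
    * generalize (COS_bound t); lra.
    * assert (Hb := one_minus_cos_bounds t). nra.
  + apply Rmult_le_pos; [|left; apply Rinv_0_lt_compat; lra]. generalize (COS_bound t); lra.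
Qed.

Lemma continuous_cin_integrand (t : R) : continuous cin_integrand t.
Proof.
destruct (Req_dec t 0) as [->|H].
- intros P [eps HP]. exists eps. intros s Hs. apply HP.
  change (Rabs (s - 0) < eps) in Hs. change (Rabs (cin_integrand s - cin_integrand 0) < eps).
  assert (H0 : cin_integrand 0 = 0).
  { unfold cin_integrand. rewrite cos_0, Rminus_diag. unfold Rdiv; ring. }
  rewrite H0, Rminus_0_r in *. eapply Rle_lt_trans; [apply cin_integrand_bound | exact Hs].
- apply (ex_derive_continuous cin_integrand). unfold cin_integrand. auto_derive. exact H.
Qed.

Lemma is_derive_Cin (t : R) : is_derive Cin t (cin_integrand t).
Proof.
apply (is_derive_RInt cin_integrand Cin 0).
- apply filter_forall. intros s. apply (RInt_correct cin_integrand), ex_RInt_continuous.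
  intros u _. apply continuous_cin_integrand.
- apply continuous_cin_integrand.
Qed.

Lemma Cin_0 : Cin 0 = 0.
Proof. exact (RInt_point 0 cin_integrand). Qed.

Lemma Cin_bound (t : R) : 0 <= t -> Rabs (Cin t) <= t.
Proof.
intros Ht. assert (H := MVT_bound Cin _ 0 t 1 Ht (fun s _ => is_derive_Cin s)
  (fun s Hs => cin_integrand_bound_1 s (proj1 Hs))).
rewrite Cin_0, !Rminus_0_r in H. lra.
Qed.

Lemma sin_lower (s : R) : 0 <= s -> s - s ^ 3 / 6 <= sin s.
Proof.
intros Hs.
destruct (MVT_gen (fun s => sin s - s + s ^ 3 / 6) 0 s (fun s => cos s - 1 + s ^ 2 / 2)) as (u & Hu & E).
- intros x _. auto_derive; [trivial|]. field.
- intros x _. apply continuity_pt_filterlim.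
  apply (ex_derive_continuous (fun s => sin s - s + s ^ 3 / 6)). auto_derive; trivial.
- rewrite sin_0 in E. assert (H := one_minus_cos_bounds u).
  replace (0 ^ 3 / 6) with 0 in E by field. nra.
Qed.

Lemma sin_upper (s : R) : 0 <= s -> sin s <= s.
Proof.
intros Hs. assert (HM := MVT_bound sin cos 0 s 1 Hs (fun t _ => is_derive_sin t)
  (fun t _ => Rabs_le _ _ (COS_bound t))).
rewrite sin_0, !Rminus_0_r in HM. generalize (Rle_abs (sin s)); lra.
Qed.

Lemma third_le_sin (s : R) : 0 <= s <= PI / 2 -> s / 3 <= sin s.
Proof.
intros Hs. assert (H := sin_lower s (proj1 Hs)). assert (H4 := PI_4).
assert (s ^ 2 <= 4) by nra. nra.
Qed.

Lemma cot_remainder_derivative_bound (t : R) : 0 < t <= PI ->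
  Rabs (- / t ^ 2 + / (4 * sin (t / 2) ^ 2)) <= 1.
Proof.
intros Ht. set (s := t / 2).
assert (Hs : 0 < s <= PI / 2) by (unfold s; lra).
replace t with (2 * s) by (unfold s; field).
assert (H1 := third_le_sin s ltac:(lra)). assert (H2 := sin_upper s ltac:(lra)).
assert (H3 := sin_lower s ltac:(lra)).
set (S := sin s) in *.
replace (- / (2 * s) ^ 2 + / (4 * S ^ 2)) with ((s - S) * (s + S) / (4 * (s ^ 2 * S ^ 2)))
  by (field; lra).
assert (Hp : 0 < 4 * (s ^ 2 * S ^ 2)).
{ apply Rmult_lt_0_compat; [lra|]. apply Rmult_lt_0_compat; apply pow_lt; lra. }
rewrite Rabs_pos_eq.
- apply (Rmult_le_reg_r (4 * (s ^ 2 * S ^ 2))); [exact Hp|].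
  unfold Rdiv. rewrite Rmult_assoc, Rinv_l by lra. rewrite Rmult_1_r, Rmult_1_l.
  (* The numerator is at most [s^4 / 3], the denominator at least [4 * s^4 / 9] because
     [sin s >= s / 3]. *)
  assert ((s - S) * (s + S) <= s ^ 3 / 6 * (2 * s)) by (apply Rmult_le_compat; lra).
  assert ((s / 3) ^ 2 <= S ^ 2) by (apply pow_incr; lra).
  assert (s ^ 2 * (s / 3) ^ 2 <= s ^ 2 * S ^ 2).
  { apply Rmult_le_compat_l; [apply pow_le; lra | assumption]. }
  replace (s ^ 2 * (s / 3) ^ 2) with (s ^ 4 / 9) in * by field.
  replace (s ^ 3 / 6 * (2 * s)) with (s ^ 4 / 3) in * by field.
  assert (0 <= s ^ 4) by (apply pow_le; lra). lra.
- apply Rmult_le_pos; [apply Rmult_le_pos; lra | left; now apply Rinv_0_lt_compat].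
Qed.

(** The kernel [1 / t] of the integral minus the kernel [cot (t / 2) / 2] of the discrete sum; the
    poles at 0 cancel. *)
Definition cot_rem (t : R) : R := / t - cos (t / 2) / (2 * sin (t / 2)).

Lemma cot_rem_bound (t : R) : 0 < t <= PI -> Rabs (cot_rem t) <= 3.
Proof.
intros Ht. unfold cot_rem. set (s := t / 2).
assert (Hs : 0 < s <= PI / 2) by (unfold s; lra).
replace t with (2 * s) by (unfold s; field).
assert (H1 := third_le_sin s ltac:(lra)). assert (H2 := sin_upper s ltac:(lra)).
assert (H3 := sin_lower s ltac:(lra)). assert (H4 := one_minus_cos_bounds s). assert (H5 := PI_4).
set (S := sin s) in *. set (c := cos s) in *.
replace (/ (2 * s) - c / (2 * S)) with ((S - s * c) / (2 * (s * S))) by (field; lra).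
assert (Hp : 0 < 2 * (s * S)) by nra.
unfold Rdiv. rewrite Rabs_mult, (Rabs_pos_eq (/ _)) by (left; now apply Rinv_0_lt_compat).
apply (Rmult_le_reg_r (2 * (s * S))); [exact Hp|].
rewrite Rmult_assoc, Rinv_l by lra. rewrite Rmult_1_r.
assert (s * (s / 3) <= s * S) by (apply Rmult_le_compat_l; lra).
apply Rle_trans with (s ^ 2 * 2); [|lra].
assert (Hs2 : s * (1 - c) <= s * (s ^ 2 / 2)) by (apply Rmult_le_compat_l; lra).
assert (Hs3 : s ^ 3 <= 2 * s ^ 2).
{ replace (s ^ 3) with (s * s ^ 2) by ring. apply Rmult_le_compat_r; [apply pow_le|]; lra. }
assert (0 <= s * (1 - c)) by (apply Rmult_le_pos; lra).
assert (0 <= s ^ 2) by (apply pow_le; lra).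
apply Rabs_le. lra.
Qed.

Definition cin_defect (p : nat) (t : R) : R :=
  Cin (INR (S p) * t) - rsum (fun j => (1 - cos (INR (S j) * t)) / INR (S j)) p
  - (1 - cos (INR (S p) * t)) / (2 * INR (S p)) - (ln t - ln (sin (t / 2)))
  + sin (INR (S p) * t) / INR (S p) * cot_rem t.

Lemma is_derive_cos_term (n x : R) : n <> 0 ->
  is_derive (fun t => (1 - cos (n * t)) / n) x (sin (n * x)).
Proof. intros Hn. auto_derive; [trivial|]. field. exact Hn. Qed.

(* The summands integrate [sum_(j < n) sin (j t) + sin (n t) / 2 = cot (t / 2) (1 - cos (n t)) / 2];
   the last one removes the oscillating part of the integral of [cot_rem]. *)
Lemma is_derive_cin_defect (p : nat) (t : R) : 0 < t <= PI ->
  is_derive (cin_defect p) t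
    (sin (INR (S p) * t) / INR (S p) * (- / t ^ 2 + / (4 * sin (t / 2) ^ 2))).
Proof.
intros Ht. assert (Hs := sin_half_pos t Ht). assert (Hn := INR_S_pos p).
assert (HK := sin_sum_kernel (S p) t). rewrite rsum_shift in HK.
rewrite Rmult_0_l, sin_0, Rplus_0_l in HK.
unfold cin_defect. set (n := INR (S p)) in *. clearbody n.
eapply is_derive_eq.
- apply is_derive_Rplus; [apply is_derive_Rminus; [apply is_derive_Rminus;
    [apply is_derive_Rminus|]|]|].
  + apply (is_derive_Rcomp Cin); [apply is_derive_Cin|]. instantiate (1 := n).
    auto_derive; [trivial|]. ring.
  + apply is_derive_rsum. intros j _. apply is_derive_cos_term, Rgt_not_eq, INR_S_pos.
  + instantiate (1 := sin (n * t) / 2). auto_derive; [trivial|]. field. lra.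
  + instantiate (1 := cot_rem t). unfold cot_rem. auto_derive; [repeat split; lra|].
    fold (t / 2). field. lra.
  + apply (is_derive_Rmult (fun t => sin (n * t) / n)).
    * instantiate (1 := cos (n * t)). auto_derive; [trivial|]. field. lra.
    * unfold cot_rem. instantiate (1 := - / t ^ 2 + / (4 * sin (t / 2) ^ 2)).
      auto_derive; [repeat split; lra|]. fold (t / 2).
      assert (Hc : cos (t / 2) * cos (t / 2) = 1 - sin (t / 2) * sin (t / 2)).
      { generalize (sin2_cos2 (t / 2)). unfold Rsqr. lra. }
      field_simplify; [|lra|lra].
      replace (cos (t / 2) ^ 2) with (1 - sin (t / 2) ^ 2) by lra.
      field. lra.
- cbv beta. set (D := rsum _ p) in *.
  assert (HD : D = cos (t / 2) * (1 - cos (n * t)) / (2 * sin (t / 2)) - sin (n * t) / 2).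
  { rewrite <- HK. field. lra. }
  rewrite HD. unfold cin_integrand, cot_rem. field. lra.
Qed.

Lemma is_lim_seq_cst_inv (c : R) : is_lim_seq (fun i => c * / INR (S i)) 0.
Proof.
replace (Finite 0) with (Finite (c * 0)) by (f_equal; ring).
apply is_lim_seq_mult'; [apply is_lim_seq_const | apply is_lim_seq_inv_INR_S].
Qed.

Lemma inv_INR_S_range (i : nat) : 0 < / INR (S i) <= 1.
Proof.
split; [apply Rinv_0_lt_compat, INR_S_pos|].
rewrite <- Rinv_1. apply Rinv_le_contravar; [lra | apply INR_S_ge1].
Qed.

(** As [t] tends to 0 everything vanishes except [ln (sin (t / 2)) - ln t]. *)
Lemma cin_defect_lim (p : nat) : is_lim_seq (fun i => cin_defect p (/ INR (S i))) (- ln 2).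
Proof.
assert (HP := PI2_3_2).
assert (Hcos : forall n d, 0 < n -> 0 < d ->
  is_lim_seq (fun i => (1 - cos (n * / INR (S i))) / d) 0).
{ intros n d Hn Hd.
  replace (Finite 0) with (Finite ((1 - cos 0) * / d)) by (rewrite cos_0; f_equal; ring).
  apply is_lim_seq_mult'; [|apply is_lim_seq_const].
  apply is_lim_seq_minus'; [apply is_lim_seq_const|].
  apply (is_lim_seq_continuous cos).
  - apply continuity_cos.
  - apply is_lim_seq_cst_inv. }
replace (Finite (- ln 2)) with (Finite (0 - rsum (fun _ => 0) p - 0 - (- ln (/ 2)) + 0)).
2:{ rewrite rsum_0 by reflexivity. rewrite ln_Rinv by lra. f_equal; ring. }
unfold cin_defect. assert (Hn := INR_S_pos p).
apply is_lim_seq_plus'; [apply is_lim_seq_minus'; [apply is_lim_seq_minus';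
  [apply is_lim_seq_minus'|]|]|].
- apply (is_lim_seq_zero _ _ (is_lim_seq_cst_inv (INR (S p)))). intros i.
  apply Cin_bound, Rmult_le_pos; [lra|]. apply Rlt_le, inv_INR_S_range.
- apply is_lim_seq_rsum. intros j _. apply Hcos; apply INR_S_pos.
- apply Hcos; lra.
- apply (is_lim_seq_ext (fun i => - ln ((sin (/ INR (S i) / 2) - sin (0 / 2)) * INR (S i)))).
  { intros i. replace (0 / 2) with 0 by field. rewrite sin_0, Rminus_0_r.
    assert (Hi := inv_INR_S_range i). assert (Hp := INR_S_pos i).
    assert (Hs := sin_half_pos (/ INR (S i)) ltac:(lra)).
    rewrite ln_mult, ln_Rinv by lra. ring. }
  apply (proj1 (is_lim_seq_opp _ (Finite (ln (/ 2))))). apply (is_lim_seq_continuous ln).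
  + apply continuity_pt_filterlim, (ex_derive_continuous ln). exists (/ / 2). apply is_derive_ln. lra.
  + apply (derive_lim_seq (fun t => sin (t / 2))). auto_derive; [trivial|].
    rewrite Rmult_0_l, cos_0. field.
- apply (is_lim_seq_zero _ _ (is_lim_seq_cst_inv 3)). intros i.
  assert (Hi := inv_INR_S_range i).
  assert (H1 := cot_rem_bound (/ INR (S i)) ltac:(lra)).
  set (n := INR (S p)) in *. set (t := / INR (S i)) in *.
  assert (H2 : Rabs (sin (n * t)) <= n * t).
  { assert (Hnt : 0 <= n * t) by nra.
    assert (HM := MVT_bound sin cos 0 (n * t) 1 Hnt (fun t _ => is_derive_sin t)
      (fun t _ => Rabs_le _ _ (COS_bound t))).
    rewrite sin_0, !Rminus_0_r in HM. lra. }
  rewrite Rabs_mult. unfold Rdiv. rewrite Rabs_mult, Rabs_inv, (Rabs_pos_eq n) by lra.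
  replace (3 * t) with (n * t * / n * 3) by (field; lra).
  apply Rmult_le_compat; [|apply Rabs_pos| |exact H1].
  + apply Rmult_le_pos; [apply Rabs_pos | left; apply Rinv_0_lt_compat; lra].
  + apply Rmult_le_compat_r; [left; apply Rinv_0_lt_compat; lra | exact H2].
Qed.

(** The derivative is at most [1 / n] with [n = S p], over an interval of length below [PI]; the
    value near 0 is known from [cin_defect_lim]. *)
Lemma cin_defect_pi (p : nat) : Rabs (cin_defect p PI + ln 2) <= PI / INR (S p).
Proof.
assert (HP := PI2_3_2). assert (Hn := INR_S_pos p).
assert (H : forall i, Rabs (cin_defect p PI - cin_defect p (/ INR (S i))) <= PI / INR (S p)).
{ intros i. assert (Hi := inv_INR_S_range i).
  eapply Rle_trans.
  - apply (MVT_bound (cin_defect p) (fun t => sin (INR (S p) * t) / INR (S p)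
      * (- / t ^ 2 + / (4 * sin (t / 2) ^ 2))) _ _ (/ INR (S p))); [lra| |].
    + intros t Ht. apply is_derive_cin_defect. lra.
    + intros t Ht. unfold Rdiv at 1. rewrite Rabs_mult, Rabs_mult.
      assert (H1 := cot_remainder_derivative_bound t ltac:(lra)).
      assert (H2 : Rabs (sin (INR (S p) * t)) <= 1) by (apply Rabs_le, SIN_bound).
      assert (H3 : 0 < / INR (S p)) by now apply Rinv_0_lt_compat.
      rewrite (Rabs_pos_eq (/ INR (S p))) by lra.
      replace (/ INR (S p)) with (1 * / INR (S p) * 1) at 2 by ring.
      apply Rmult_le_compat; [|apply Rabs_pos| |exact H1].
      * apply Rmult_le_pos; [apply Rabs_pos | lra].
      * apply Rmult_le_compat_r; lra.
  - unfold Rdiv. rewrite Rmult_comm. apply Rmult_le_compat_r; [|lra].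
    left; now apply Rinv_0_lt_compat. }
apply (is_lim_seq_le _ (fun _ => PI / INR (S p)) (Rabs (cin_defect p PI + ln 2)) (PI / INR (S p)) H);
  [|apply is_lim_seq_const].
replace (cin_defect p PI + ln 2) with (cin_defect p PI - - ln 2) by ring.
apply (is_lim_seq_abs _ (Finite _)), is_lim_seq_minus'; [apply is_lim_seq_const | apply cin_defect_lim].
Qed.

Lemma odd_harmonic (N : nat) :
  rsum (fun j => (1 - cos (INR (S j) * PI)) / INR (S j)) (2 * N)
  = 2 * harmonic (2 * N) - harmonic N.
Proof.
induction N as [|N IH]; [simpl; rewrite harmonic_0; ring|].
replace (2 * S N)%nat with (S (S (2 * N))) by lia.
rewrite !rsum_S, IH, !harmonic_S, !cos_nat_pi.
replace ((-1) ^ S (2 * N)) with (-1) by (rewrite pow_1_odd; reflexivity).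
replace ((-1) ^ S (S (2 * N))) with 1
  by (replace (S (S (2 * N))) with (2 * S N)%nat by lia; rewrite pow_1_even; reflexivity).
replace (INR (S (S (2 * N)))) with (2 * INR (S N))
  by (rewrite !S_INR, mult_INR; simpl; ring).
assert (H := INR_S_pos N). assert (H1 := INR_S_pos (2 * N)). field. split; lra.
Qed.

(** [cin_defect] is evaluated at [t = PI] with [n = 2 * m] and [m = N + 1]. The oscillating terms
    vanish, the sum is [2 * harmonic (2 * m) - harmonic m], and [2 * euler_gamma - euler_gamma]
    remains. *)
Lemma Cin_lim : is_lim_seq (fun N => Cin (2 * PI * INR (S N)) - ln (2 * PI * INR (S N))) euler_gamma.
Proof.
assert (HP := PI_RGT_0).
apply (is_lim_seq_ext (fun N => (cin_defect (S (2 * N)) PI + ln 2)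
  + 2 * (harmonic (2 * S N) - ln (INR (2 * S N))) - (harmonic (S N) - ln (INR (S N))))).
- intros N. unfold cin_defect.
  replace (S (S (2 * N))) with (2 * S N)%nat by lia.
  assert (E : rsum (fun j => (1 - cos (INR (S j) * PI)) / INR (S j)) (S (2 * N)) =
    2 * harmonic (2 * S N) - harmonic (S N)).
  { rewrite <- odd_harmonic. replace (2 * S N)%nat with (S (S (2 * N))) by lia.
    rewrite (rsum_S _ (S (2 * N))).
    replace (S (S (2 * N))) with (2 * S N)%nat by lia.
    rewrite cos_nat_pi, pow_1_even. unfold Rdiv. ring. }
  rewrite E, sin_nat_pi, cos_nat_pi, pow_1_even, sin_PI2, ln_1, mult_INR.
  assert (Hn := INR_S_pos N). change (INR 2) with 2.
  rewrite !ln_mult by nra.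
  replace (2 * INR (S N) * PI) with (2 * PI * INR (S N)) by ring.
  unfold Rdiv. ring.
- replace (Finite euler_gamma) with (Finite (0 + 2 * euler_gamma - euler_gamma)) by (f_equal; ring).
  apply is_lim_seq_minus'; [apply is_lim_seq_plus'|].
  + apply (is_lim_seq_zero _ _ (is_lim_seq_cst_inv PI)). intros N.
    eapply Rle_trans; [apply cin_defect_pi|]. apply Rmult_le_compat_l; [lra|].
    apply Rinv_le_contravar; [apply INR_S_pos | apply le_INR; lia].
  + apply is_lim_seq_mult'; [apply is_lim_seq_const|].
    apply (is_lim_seq_incr_1 (fun N => harmonic (2 * N) - ln (INR (2 * N)))).
    apply (is_lim_seq_subseq_double (fun n => harmonic n - ln (INR n))), harmonic_ln_lim.
  + apply (is_lim_seq_incr_1 (fun n => harmonic n - ln (INR n))), harmonic_ln_lim.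
Qed.

(** * The constants of odd order and [zeta'(2 k)] *)

(** Repeated integration by parts against Bernoulli polynomials on a unit interval starting at [x0].
    It is an antiderivative of the Euler-Maclaurin remainder kernel, and its end values are
    Euler-Maclaurin expressions, up to one summand at the left end. *)
Definition bern_parts (p P : nat) (x0 x : R) : R :=
  rsum (fun i => (-1) ^ i * bern_poly i (x - x0) * pow_ln_jet p i x) (S P).

Lemma is_derive_bern_poly_shift (i : nat) (x0 x : R) :
  is_derive (fun x => bern_poly (S i) (x - x0)) x (bern_poly i (x - x0)).
Proof.
assert (H : is_derive (fun x => x - x0) x 1) by (auto_derive; [trivial | ring]).
eapply is_derive_eq.
- apply (is_derive_Rcomp (bern_poly (S i)) (fun x => x - x0)); [apply is_derive_bern_poly | exact H].
- ring.
Qed.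

Lemma is_derive_bern_parts (p P : nat) (x0 x : R) : 0 < x ->
  is_derive (bern_parts p P x0) x ((-1) ^ P * bern_poly P (x - x0) * pow_ln_jet p (S P) x).
Proof.
intros Hx. induction P as [|P IH].
- apply (is_derive_ext (pow_ln_jet p 0)).
  + intros t. unfold bern_parts. simpl. rewrite bern_poly_0. ring.
  + eapply is_derive_eq; [now apply is_derive_pow_ln_jet|]. rewrite bern_poly_0. simpl. ring.
- apply (is_derive_ext (fun x => bern_parts p P x0 x +
    (-1) ^ S P * (bern_poly (S P) (x - x0) * pow_ln_jet p (S P) x))).
  + intros t. unfold bern_parts. rewrite (rsum_S _ (S P)).
    match goal with |- @eq _ ?a ?b => change (@eq R a b) end. ring.
  + eapply is_derive_eq.
    * apply is_derive_Rplus; [exact IH|].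
      apply (is_derive_Rmult (fun _ => (-1) ^ S P)); [exact (is_derive_const ((-1) ^ S P) x)|].
      apply is_derive_Rmult; [apply is_derive_bern_poly_shift | now apply is_derive_pow_ln_jet].
    * change (@zero R_NormedModule) with 0. cbv beta.
      change ((-1) ^ S P) with (-1 * (-1) ^ P). ring.
Qed.

Lemma bern_fact_sign (i : nat) : i <> 1%nat -> (-1) ^ i * bern_fact i = bern_fact i.
Proof.
intros Hi. destruct (Nat.Even_or_Odd i) as [[k ->]|[k ->]].
- rewrite pow_1_even. ring.
- rewrite bern_fact_odd by lia. ring.
Qed.

Lemma bern_parts_right (p P : nat) (x : R) :
  bern_parts p P x (x + 1) = euler_maclaurin_R P (fun i => pow_ln_jet p i (x + 1)).
Proof.
apply rsum_ext; intros i _. replace (x + 1 - x) with 1 by ring. f_equal.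
destruct i as [|[|i]].
- rewrite bern_poly_0, bern_fact_0. simpl. ring.
- unfold bern_poly. simpl. rewrite bern_fact_0, bern_fact_1. field.
- rewrite bern_poly_at_1 by lia. apply bern_fact_sign. lia.
Qed.

(** The first Bernoulli polynomial is [-1/2] at 0 and [1/2] at 1, and this jump produces the summand
    at the left end. All other orders agree at both ends. *)
Lemma bern_parts_left (p P : nat) (x : R) : (1 <= P)%nat ->
  bern_parts p P x x = euler_maclaurin_R P (fun i => pow_ln_jet p i x) + pow_ln_jet p 1 x.
Proof.
intros HP. unfold bern_parts, euler_maclaurin_R. destruct P as [|P]; [lia|].
rewrite !(rsum_shift _ (S P)), !(rsum_shift _ P), Rminus_diag, !bern_poly_at_0.
rewrite (rsum_ext (fun i => _ * bern_poly (S (S i)) _ * _)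
  (fun i => bern_fact (S (S i)) * pow_ln_jet p (S (S i)) x)).
- rewrite bern_fact_1. simpl. field.
- intros i _. rewrite bern_poly_at_0, bern_fact_sign by lia. reflexivity.
Qed.

(** An antiderivative of [fourier_coeff k m * cos (a x) / x] with [a = 2 * PI * (m + 1)]; the
    bracket is [Ci (a x) - euler_gamma]. *)
Definition ci_term (k : nat) (x : R) (m : nat) : R :=
  fourier_coeff k m * (ln (2 * PI * INR (S m) * x) - Cin (2 * PI * INR (S m) * x)).

Definition ci_sum (k : nat) (x : R) : R := Series (ci_term k x).

Lemma fourier_coeff_bound_4 (k m : nat) : (2 <= k)%nat ->
  Rabs (fourier_coeff k m) * INR (S m) <= / INR (S m) ^ 2.
Proof.
intros Hk. assert (H := INR_S_ge1 m). set (x := INR (S m)) in *.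
assert (Hx4 : 0 < x ^ 4) by (apply pow_lt; lra).
assert (H4 : x ^ 4 <= x ^ (2 * k)) by (apply Rle_pow; [lra|lia]).
assert (Hb := fourier_coeff_bound k m ltac:(lia)). fold x in Hb.
assert (H5 : 1 / x ^ (2 * k) <= / x ^ 4).
{ unfold Rdiv. rewrite Rmult_1_l. now apply Rinv_le_contravar. }
apply Rle_trans with (/ x ^ 4 * x).
- apply Rmult_le_compat_r; lra.
- replace (/ x ^ 4 * x) with (/ x ^ 3) by (field; lra).
  apply Rinv_le_contravar; [apply pow_lt; lra | apply Rle_pow; [lra|lia]].
Qed.

Lemma ln_abs_bound (a x : R) : 1 <= a -> 0 < x -> Rabs (ln (a * x)) <= a * (1 + Rabs (ln x)).
Proof.
intros Ha Hx. rewrite ln_mult by lra. eapply Rle_trans; [apply Rabs_triang|].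
rewrite (Rabs_pos_eq (ln a)) by now apply ln_ge_0.
assert (H := ln_le_self a ltac:(lra)). assert (H1 := Rabs_pos (ln x)). nra.
Qed.

Lemma two_pi_S_ge1 (m : nat) : 1 <= 2 * PI * INR (S m).
Proof. generalize PI2_3_2 (INR_S_ge1 m); intros; nra. Qed.

Lemma ci_sum_correct (k : nat) (x : R) : (2 <= k)%nat -> 0 < x -> is_series (ci_term k x) (ci_sum k x).
Proof.
intros Hk Hx. apply Series_correct.
apply (ex_series_le_inv_sqr _ (2 * PI * (1 + Rabs (ln x) + x))). intros m.
unfold ci_term. rewrite Rabs_mult.
assert (H := fourier_coeff_bound_4 k m Hk). assert (Ha := two_pi_S_ge1 m).
assert (HS := INR_S_ge1 m). assert (HP := PI_RGT_0).
set (a := 2 * PI * INR (S m)) in *.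
assert (H1 := ln_abs_bound a x Ha Hx).
assert (H2 := Cin_bound (a * x) ltac:(nra)).
apply Rle_trans with (Rabs (fourier_coeff k m) * (a * (1 + Rabs (ln x) + x))).
- apply Rmult_le_compat_l; [apply Rabs_pos|]. unfold Rminus.
  eapply Rle_trans; [apply Rabs_triang|]. rewrite Rabs_Ropp. lra.
- replace (Rabs (fourier_coeff k m) * (a * (1 + Rabs (ln x) + x))) with
    (2 * PI * (1 + Rabs (ln x) + x) * (Rabs (fourier_coeff k m) * INR (S m))) by (unfold a; ring).
  apply Rmult_le_compat_l; [|exact H].
  apply Rmult_le_pos; [lra|]. generalize (Rabs_pos (ln x)); lra.
Qed.

Lemma is_derive_ci_partial (k K : nat) (x : R) : 0 < x ->
  is_derive (fun x => rsum (ci_term k x) K) x (bern_trig (2 * k) K x / x).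
Proof.
intros Hx. rewrite bern_trig_even. unfold Rdiv. rewrite Rmult_comm, <- rsum_scal.
apply (is_derive_rsum (fun m x => ci_term k x m)). intros m _.
assert (Ha := two_pi_S_pos m). unfold ci_term. set (a := 2 * PI * INR (S m)) in *. clearbody a.
eapply is_derive_eq.
- apply (is_derive_Rmult (fun _ => fourier_coeff k m)); [exact (is_derive_const (fourier_coeff k m) x)|].
  apply is_derive_Rminus.
  + instantiate (1 := / x). auto_derive; [nra|]. field. lra.
  + apply (is_derive_Rcomp Cin); [apply is_derive_Cin|].
    instantiate (1 := a). auto_derive; [trivial|]. ring.
- change (@zero R_NormedModule) with 0. unfold cin_integrand. field. lra.
Qed.

(** For [p = 2k - 1] the [2k]-th derivative of [x^p * ln x] is [p! / x], so the remainder kernel is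
    [p! * bern_poly (2k) (x - n) / x]. Its Fourier series converges uniformly and is integrated
    termwise; by periodicity the same [ci_sum] serves every [n]. *)
Lemma bern_parts_diff (k n : nat) (a b : R) : (2 <= k)%nat -> 0 < a <= b ->
  INR n <= a -> b <= INR n + 1 ->
  bern_parts (2 * k - 1) (2 * k) (INR n) b - bern_parts (2 * k - 1) (2 * k) (INR n) a
  = INR (fact (2 * k - 1)) * (ci_sum k b - ci_sum k a).
Proof.
intros Hk Hab Ha Hb. set (p := (2 * k - 1)%nat).
set (f := INR (fact p)). assert (Hf : 0 < f) by (apply lt_0_INR, lt_O_fact).
assert (H1 : is_lim_seq (fun K => f * rsum (ci_term k b) K - f * rsum (ci_term k a) K)
  (bern_parts p (2 * k) (INR n) b - bern_parts p (2 * k) (INR n) a)).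
{ apply (primitive_limit (fun K x => f * rsum (ci_term k x) K)
    (fun K x => f * (bern_trig (2 * k) K x / x)) (bern_parts p (2 * k) (INR n))
    (fun x => f * (bern_poly (2 * k) (x - INR n) / x)) (fun K => f * / a * inv_sqr_tail K));
    [lra | | | |].
  - intros K x Hx. eapply is_derive_eq.
    + apply (is_derive_Rmult (fun _ => f)); [exact (is_derive_const f x)|].
      apply is_derive_ci_partial; lra.
    + change (@zero R_NormedModule) with 0. ring.
  - intros x Hx. eapply is_derive_eq; [apply is_derive_bern_parts; lra|].
    replace (S (2 * k)) with (p + 2 + 0)%nat by (unfold p; lia).
    rewrite pow_ln_jet_gt, pow_1_even. fold f. simpl. field. lra.
  - intros K x Hx.
    assert (HT := bern_trig_tail_lim (2 * k) K (x - INR n) _ ltac:(lia)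
      (bern_trig_lim (2 * k) (x - INR n) ltac:(lia) ltac:(lra))).
    rewrite <- (bern_trig_period _ K n (x - INR n)) in HT.
    replace (x - INR n + INR n) with x in HT by ring.
    rewrite Rabs_minus_sym in HT.
    replace (f * (bern_trig (2 * k) K x / x) - f * (bern_poly (2 * k) (x - INR n) / x)) with
      (f * / x * (bern_trig (2 * k) K x - bern_poly (2 * k) (x - INR n))) by (field; lra).
    assert (Hx0 : 0 < / x) by (apply Rinv_0_lt_compat; lra).
    assert (Hxa : / x <= / a) by (apply Rinv_le_contravar; lra).
    rewrite Rabs_mult, (Rabs_pos_eq (f * / x)) by (apply Rmult_le_pos; lra).
    apply Rmult_le_compat; [apply Rmult_le_pos; lra | apply Rabs_pos | | exact HT].
    apply Rmult_le_compat_l; lra.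
  - replace (Finite 0) with (Finite (f * / a * 0)) by (f_equal; ring).
    apply is_lim_seq_mult'; [apply is_lim_seq_const | apply inv_sqr_tail_lim]. }
apply (is_lim_seq_unique_R _ _ _ H1).
rewrite Rmult_minus_distr_l.
apply is_lim_seq_minus'; apply is_lim_seq_mult'; try apply is_lim_seq_const;
  apply is_series_rsum, ci_sum_correct; lra || exact Hk.
Qed.

(** Unit steps add up to the kernel integral over [[1, X + 1]]. The base case prolongs it down to
    [e] inside the unit interval with [x0 = 0], where letting [e] tend to 0 will evaluate the lower
    end. *)
Lemma pow_ln_defect_ci (k X : nat) (e : R) : (2 <= k)%nat -> 0 < e <= 1 ->
  pow_ln_defect (2 * k - 1) (2 * k) X = - bern_parts (2 * k - 1) (2 * k) 0 e
    - INR (fact (2 * k - 1)) * (ci_sum k (INR (S X)) - ci_sum k e).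
Proof.
intros Hk He. set (p := (2 * k - 1)%nat).
induction X as [|X IH].
- unfold pow_ln_defect. simpl (rsum _ 0).
  assert (HR := bern_parts_right p (2 * k) 0). rewrite Rplus_0_l in HR.
  change (INR 1) with 1. rewrite <- HR.
  assert (HD := bern_parts_diff k 0 e 1 Hk He ltac:(simpl; lra) ltac:(simpl; lra)).
  fold p in HD. simpl (INR 0) in HD. lra.
- assert (HD := bern_parts_diff k (S X) (INR (S X)) (INR (S X) + 1) Hk
    ltac:(generalize (INR_S_pos X); lra) ltac:(lra) ltac:(lra)).
  fold p in HD. rewrite bern_parts_right, bern_parts_left in HD by lia.
  rewrite <- (S_INR (S X)), pow_ln_jet_1 in HD.
  unfold pow_ln_defect in *. rewrite rsum_S. lra.
Qed.

Lemma fourier_coeff_abs_sum (k K : nat) : (2 <= k)%nat ->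
  rsum (fun m => Rabs (fourier_coeff k m) * INR (S m)) K <= 2.
Proof.
intros Hk. eapply Rle_trans; [|apply (rsum_inv_sqr_le K)].
apply rsum_le; intros m _. now apply fourier_coeff_bound_4.
Qed.

Lemma fourier_coeff_series (k : nat) : (2 <= k)%nat ->
  is_series (fourier_coeff k) (bern_fact (2 * k)).
Proof. intros Hk. apply is_series_rsum, fourier_coeff_sum. lia. Qed.

Lemma is_series_bound (a : nat -> R) (l B : R) : is_series a l ->
  (forall K, Rabs (rsum a K) <= B) -> Rabs l <= B.
Proof.
intros H HB. apply is_series_rsum in H.
apply (is_lim_seq_le _ (fun _ => B) (Rabs l) B HB); [|apply is_lim_seq_const].
now apply (is_lim_seq_abs _ (Finite l)).
Qed.

(** At integers the arguments of [Cin] are multiples of [2 * PI], so [Cin_lim] applies and each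
    bracket tends to [- euler_gamma]. *)
Lemma ci_sum_infinity (k : nat) : (2 <= k)%nat ->
  is_lim_seq (fun X => ci_sum k (INR (S X))) (- (euler_gamma * bern_fact (2 * k))).
Proof.
intros Hk. apply is_lim_seq_Reals. intros eps He.
destruct (is_lim_seq_small _ _ (eps / 4) Cin_lim ltac:(lra)) as [N HN].
exists N. intros X HX. unfold Rdist.
apply Rle_lt_trans with (eps / 4 * 2); [|lra].
apply (is_series_bound (fun m => ci_term k (INR (S X)) m + euler_gamma * fourier_coeff k m)).
- replace (ci_sum k (INR (S X)) - - (euler_gamma * bern_fact (2 * k))) with
    (plus (ci_sum k (INR (S X))) (scal euler_gamma (bern_fact (2 * k))))
    by (unfold plus, scal; simpl; unfold mult; simpl; ring).
  apply (is_series_plus (ci_term k (INR (S X)))).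
  + apply ci_sum_correct; [exact Hk | apply INR_S_pos].
  + apply (is_series_scal euler_gamma (fourier_coeff k)), fourier_coeff_series, Hk.
- intros K. eapply Rle_trans; [apply Rabs_rsum|].
  apply Rle_trans with (rsum (fun m => eps / 4 * (Rabs (fourier_coeff k m) * INR (S m))) K).
  + apply rsum_le; intros m _. unfold ci_term.
    (* The product [(m + 1) * (X + 1)] as a successor: it is at least [X + 1], so one [N] serves all
       [m]. *)
    replace (2 * PI * INR (S m) * INR (S X)) with (2 * PI * INR (S (m + X + m * X)))
      by (rewrite !S_INR, !plus_INR, mult_INR; ring).
    specialize (HN (m + X + m * X)%nat ltac:(lia)).
    set (A := ln _) in *. set (B := Cin _) in *.
    replace (fourier_coeff k m * (A - B) + euler_gamma * fourier_coeff k m) with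
      (- (fourier_coeff k m * (B - A - euler_gamma))) by ring.
    rewrite Rabs_Ropp, Rabs_mult.
    assert (H1 := INR_S_ge1 m). assert (H2 := Rabs_pos (fourier_coeff k m)).
    assert (H3 := Rabs_pos (B - A - euler_gamma)).
    apply Rle_trans with (Rabs (fourier_coeff k m) * (eps / 4)); [nra|].
    replace (eps / 4 * (Rabs (fourier_coeff k m) * INR (S m))) with
      (Rabs (fourier_coeff k m) * (eps / 4) * INR (S m)) by ring.
    rewrite <- (Rmult_1_r (Rabs (fourier_coeff k m) * (eps / 4))) at 1.
    apply Rmult_le_compat_l; [nra | exact H1].
  + rewrite rsum_scal. apply Rmult_le_compat_l; [lra|]. now apply fourier_coeff_abs_sum.
Qed.

Definition fourier_ln_sum (k : nat) : R := Series (fun m => fourier_coeff k m * ln (INR (S m))).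

Lemma fourier_ln_series (k : nat) : (2 <= k)%nat ->
  is_series (fun m => fourier_coeff k m * ln (INR (S m))) (fourier_ln_sum k).
Proof.
intros Hk. apply Series_correct, (ex_series_le_inv_sqr _ 1). intros m.
rewrite Rabs_mult. assert (H := fourier_coeff_bound_4 k m Hk).
assert (H1 := ln_ge_0 _ (INR_S_ge1 m)). assert (H2 := ln_le_self _ (INR_S_pos m)).
rewrite (Rabs_pos_eq (ln _)) by exact H1. unfold Rdiv. rewrite Rmult_1_l.
eapply Rle_trans; [|exact H]. apply Rmult_le_compat_l; [apply Rabs_pos | exact H2].
Qed.

(** Near 0 only the logarithm counts; it splits into [ln (m + 1)], [ln (2 * PI)] and [ln e]. The
    error is linear in [e] since [Cin t <= t] and the coefficients weighted by [m + 1] have absolute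
    sum at most 2. *)
Lemma ci_sum_zero (k : nat) (e : R) : (2 <= k)%nat -> 0 < e ->
  Rabs (ci_sum k e - (fourier_ln_sum k + (ln (2 * PI) + ln e) * bern_fact (2 * k))) <= 4 * PI * e.
Proof.
intros Hk He. assert (HP := PI_RGT_0).
apply (is_series_bound (fun m => ci_term k e m -
  (fourier_coeff k m * ln (INR (S m)) + (ln (2 * PI) + ln e) * fourier_coeff k m))).
- apply (is_series_minus (ci_term k e)); [now apply ci_sum_correct|].
  apply (is_series_plus (fun m => fourier_coeff k m * ln (INR (S m)))).
  + now apply fourier_ln_series.
  + apply (is_series_scal (ln (2 * PI) + ln e) (fourier_coeff k)), fourier_coeff_series, Hk.
- intros K. eapply Rle_trans; [apply Rabs_rsum|].
  apply Rle_trans with (rsum (fun m => 2 * PI * e * (Rabs (fourier_coeff k m) * INR (S m))) K).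
  + apply rsum_le; intros m _. unfold ci_term. assert (Hm := INR_S_pos m).
    rewrite !ln_mult by nra.
    replace (fourier_coeff k m * (ln 2 + ln PI + ln (INR (S m)) + ln e - Cin (2 * PI * INR (S m) * e)) -
      (fourier_coeff k m * ln (INR (S m)) + (ln 2 + ln PI + ln e) * fourier_coeff k m)) with
      (- (fourier_coeff k m * Cin (2 * PI * INR (S m) * e))) by ring.
    rewrite Rabs_Ropp, Rabs_mult.
    replace (2 * PI * e * (Rabs (fourier_coeff k m) * INR (S m))) with
      (Rabs (fourier_coeff k m) * (2 * PI * INR (S m) * e)) by ring.
    apply Rmult_le_compat_l; [apply Rabs_pos|]. apply Cin_bound.
    generalize (two_pi_S_pos m); intros; nra.
  + rewrite rsum_scal. replace (4 * PI * e) with (2 * PI * e * 2) by ring.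
    apply Rmult_le_compat_l; [nra|]. now apply fourier_coeff_abs_sum.
Qed.

Lemma inv_ln_inv_lim : is_lim_seq (fun i => / INR (S i) * ln (/ INR (S i))) 0.
Proof.
apply (is_lim_seq_ext (fun i => - (ln (INR (S i)) / INR (S i)))).
{ intros i. rewrite ln_Rinv by apply INR_S_pos. unfold Rdiv. ring. }
replace (Finite 0) with (Rbar_opp 0) by (simpl; f_equal; ring).
apply (proj1 (is_lim_seq_opp _ (Finite 0))).
apply (is_lim_seq_incr_1 (fun i => ln (INR i) / INR i)).
apply (is_lim_comp_seq (fun x => ln x / x) INR p_infty 0).
- exact is_lim_div_ln_p.
- exists O. intros; discriminate.
- apply is_lim_seq_INR.
Qed.

(** All terms carry a positive power of [x] except the last, where [ln x] meets [bern_poly (2k) x],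
    which differs from [bern_fact (2k)] by [O(x)]. *)
Lemma bern_parts_zero (k : nat) : (2 <= k)%nat ->
  is_lim_seq (fun i => bern_parts (2 * k - 1) (2 * k) 0 (/ INR (S i))
    - INR (fact (2 * k - 1)) * bern_fact (2 * k) * (ln (/ INR (S i)) + harmonic (2 * k - 1))) 0.
Proof.
intros Hk. set (p := (2 * k - 1)%nat). replace (2 * k)%nat with (S p) by (unfold p; lia).
assert (Hsmall : forall c, is_lim_seq (fun i => / INR (S i) * (ln (/ INR (S i)) + c)) 0).
{ intros c. apply (is_lim_seq_ext (fun i => / INR (S i) * ln (/ INR (S i)) + c * / INR (S i)));
    [intros; ring|].
  replace (Finite 0) with (Finite (0 + 0)) by (f_equal; ring).
  apply is_lim_seq_plus'; [apply inv_ln_inv_lim | apply is_lim_seq_cst_inv]. }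
assert (Hpoly : forall j, is_lim_seq (fun i => bern_poly j (/ INR (S i))) (bern_poly j 0)).
{ intros [|j].
  - apply (is_lim_seq_ext (fun _ => 1)); [intros; now rewrite bern_poly_0|].
    rewrite bern_poly_0. apply is_lim_seq_const.
  - apply (is_lim_seq_continuous (bern_poly (S j))); [|apply is_lim_seq_inv_INR_S].
    apply continuity_pt_filterlim, (ex_derive_continuous (bern_poly (S j))).
    eexists; apply is_derive_bern_poly. }
(* Each term becomes a convergent factor times [x * (ln x + c)]; for the last one the factor is the
   difference quotient of [bern_poly] at 0. *)
apply (is_lim_seq_ext (fun i => rsum (fun j => (-1) ^ j * bern_poly j (/ INR (S i)) *
    (INR (fact p) / INR (fact (S p - j)) * (/ INR (S i)) ^ (p - j)) *
    (/ INR (S i) * (ln (/ INR (S i)) + (harmonic p - harmonic (S p - j))))) (S p)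
  + INR (fact p) * ((bern_poly (S p) (/ INR (S i)) - bern_poly (S p) 0) * INR (S i)) *
    (/ INR (S i) * (ln (/ INR (S i)) + harmonic p)))).
- intros i. unfold bern_parts. rewrite (rsum_S _ (S p)).
  assert (Hi := INR_S_pos i). set (e := / INR (S i)).
  assert (He : INR (S i) * e = 1) by (unfold e; field; lra).
  replace (pow_ln_jet p (S p) e) with (INR (fact p) * (ln e + harmonic p)).
  2:{ transitivity (pow_ln_jet p (S p - 0) e); [|f_equal; lia].
      rewrite pow_ln_jet_le, harmonic_0 by lia. simpl. field. }
  replace ((-1) ^ S p) with 1.
  2:{ replace (S p) with (2 * k)%nat by (unfold p; lia). now rewrite pow_1_even. }
  rewrite Rminus_0_r, <- bern_poly_at_0.
  rewrite (rsum_ext _ (fun i => (-1) ^ i * bern_poly i e * pow_ln_jet p i e)).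
  + replace (INR (fact p) * ((bern_poly (S p) e - bern_poly (S p) 0) * INR (S i)) * (e * (ln e + harmonic p)))
      with (INR (fact p) * (bern_poly (S p) e - bern_poly (S p) 0) * (INR (S i) * e) * (ln e + harmonic p))
      by ring.
    rewrite He. ring.
  + intros j Hj.
    replace (pow_ln_jet p j e) with (pow_ln_jet p (S p - (S p - j)) e) by (f_equal; lia).
    rewrite pow_ln_jet_le by lia.
    replace (S p - j)%nat with (S (p - j)) by lia. simpl (e ^ S _). unfold Rdiv. ring.
- replace (Finite 0) with (Finite (rsum (fun j => (-1) ^ j * bern_poly j 0 *
      (INR (fact p) / INR (fact (S p - j)) * 0 ^ (p - j)) * 0) (S p)
    + INR (fact p) * bern_poly p 0 * 0)) by (rewrite rsum_0 by (intros; ring); f_equal; ring).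
  apply is_lim_seq_plus'.
  + apply is_lim_seq_rsum. intros j _.
    apply is_lim_seq_mult'; [apply is_lim_seq_mult'; apply is_lim_seq_mult'|].
    * apply is_lim_seq_const.
    * apply Hpoly.
    * apply is_lim_seq_const.
    * generalize (p - j)%nat; intros d. induction d as [|d IH]; simpl; [apply is_lim_seq_const|].
      apply is_lim_seq_mult'; [apply is_lim_seq_inv_INR_S | exact IH].
    * apply Hsmall.
  + apply is_lim_seq_mult'; [apply is_lim_seq_mult'; [apply is_lim_seq_const|]|apply Hsmall].
    apply derive_lim_seq, is_derive_bern_poly.
Qed.

(** The divergent [ln e] of the boundary term and of [ci_sum] cancel as [e] tends to 0.
    [euler_gamma] comes from infinity, [ln (2 * PI)] and [fourier_ln_sum] from [ci_sum] at 0, and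
    the harmonic number from the boundary term. *)
Lemma pow_ln_const_odd (k : nat) : (2 <= k)%nat ->
  pow_ln_const (2 * k - 1) = INR (fact (2 * k - 1)) *
    (bern_fact (2 * k) * (euler_gamma - harmonic (2 * k - 1) + ln (2 * PI)) + fourier_ln_sum k).
Proof.
intros Hk. set (p := (2 * k - 1)%nat). set (f := INR (fact p)). set (B := bern_fact (2 * k)).
assert (HC : forall e, 0 < e <= 1 -> pow_ln_const p =
  - bern_parts p (2 * k) 0 e - f * (- (euler_gamma * B) - ci_sum k e)).
{ intros e He. apply (is_lim_seq_unique_R (pow_ln_defect p (2 * k))).
  - apply pow_ln_const_lim. unfold p; lia.
  - apply (is_lim_seq_ext (fun X => - bern_parts p (2 * k) 0 e
      - f * (ci_sum k (INR (S X)) - ci_sum k e))).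
    + intros X. symmetry. now apply pow_ln_defect_ci.
    + apply is_lim_seq_minus'; [apply is_lim_seq_const|].
      apply is_lim_seq_mult'; [apply is_lim_seq_const|].
      apply is_lim_seq_minus'; [now apply ci_sum_infinity | apply is_lim_seq_const]. }
assert (H1 := bern_parts_zero k Hk). fold p f B in H1.
assert (H2 : is_lim_seq (fun i => ci_sum k (/ INR (S i)) -
  (fourier_ln_sum k + (ln (2 * PI) + ln (/ INR (S i))) * B)) 0).
{ apply (is_lim_seq_zero _ _ (is_lim_seq_cst_inv (4 * PI))). intros i.
  apply ci_sum_zero; [exact Hk | apply inv_INR_S_range]. }
apply (is_lim_seq_unique_R (fun _ => pow_ln_const p)); [apply is_lim_seq_const|].
apply (is_lim_seq_ext (fun i => f * (B * (euler_gamma - harmonic p + ln (2 * PI)) + fourier_ln_sum k)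
  - (bern_parts p (2 * k) 0 (/ INR (S i)) - f * B * (ln (/ INR (S i)) + harmonic p))
  + f * (ci_sum k (/ INR (S i)) - (fourier_ln_sum k + (ln (2 * PI) + ln (/ INR (S i))) * B)))).
- intros i. rewrite (HC _ (inv_INR_S_range i)). ring.
- set (L := f * _). replace (Finite L) with (Finite (L - 0 + f * 0)) by (f_equal; ring).
  apply is_lim_seq_plus'; [apply is_lim_seq_minus'; [apply is_lim_seq_const | exact H1]|].
  apply is_lim_seq_mult'; [apply is_lim_seq_const | exact H2].
Qed.

(** * The derivative of zeta at even integers *)

Lemma exp_taylor_2 (u : R) : Rabs (exp u - 1 - u) <= u ^ 2 * exp (Rabs u).
Proof.
assert (H1 : forall v, Rabs (exp v - 1) <= Rabs v * exp (Rabs v)).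
{ intros v. assert (H := bounded_variation exp exp (exp (Rabs v)) 0 v).
  rewrite exp_0, Rminus_0_r in H. rewrite Rmult_comm. apply H. intros t Ht.
  rewrite Rminus_0_r in Ht. split; [apply is_derive_exp|].
  rewrite Rabs_pos_eq by (left; apply exp_pos).
  assert (Hle : t <= Rabs v) by (generalize (Rle_abs t); lra).
  destruct Hle as [Hlt| ->]; [left; now apply exp_increasing | lra]. }
assert (H := bounded_variation (fun v => exp v - 1 - v) (fun v => exp v - 1)
  (Rabs u * exp (Rabs u)) 0 u).
cbv beta in H. rewrite exp_0, Rminus_0_r in H. replace (1 - 1 - 0) with 0 in H by ring.
rewrite Rminus_0_r in H.
rewrite <- (pow2_abs u). replace (Rabs u ^ 2 * exp (Rabs u)) with (Rabs u * exp (Rabs u) * Rabs u) by ring.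
apply H. intros t Ht. rewrite Rminus_0_r in Ht. split.
- auto_derive; [trivial|]. ring.
- eapply Rle_trans; [apply H1|].
  apply Rmult_le_compat; [apply Rabs_pos | left; apply exp_pos | exact Ht |].
  destruct Ht as [Hlt| ->]; [left; now apply exp_increasing | lra].
Qed.

Lemma is_derive_of_quadratic (f : R -> R) (x l K : R) : 0 <= K ->
  (forall h, Rabs h <= 1 -> Rabs (f (x + h) - f x - h * l) <= K * h ^ 2) -> is_derive f x l.
Proof.
intros HK H. apply is_derive_Reals. intros eps He.
assert (Hd : 0 < Rmin 1 (eps / (K + 1))).
{ apply Rmin_glb_lt; [lra|]. apply Rdiv_lt_0_compat; lra. }
exists (mkposreal _ Hd). intros h Hh Hhd. simpl in Hhd.
assert (H1 : Rabs h <= 1) by (generalize (Rmin_l 1 (eps / (K + 1))); lra).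
assert (H2 : Rabs h < eps / (K + 1)) by (generalize (Rmin_r 1 (eps / (K + 1))); lra).
specialize (H h H1).
assert (Hh0 := Rabs_pos_lt h Hh).
replace ((f (x + h) - f x) / h - l) with ((f (x + h) - f x - h * l) / h) by (field; exact Hh).
unfold Rdiv. rewrite Rabs_mult, Rabs_inv by exact Hh.
apply (Rmult_lt_reg_r (Rabs h)); [exact Hh0|]. rewrite Rmult_assoc, Rinv_l, Rmult_1_r by lra.
eapply Rle_lt_trans; [exact H|]. rewrite <- (pow2_abs h).
apply (Rmult_lt_compat_r (K + 1)) in H2; [|lra].
replace (eps / (K + 1) * (K + 1)) with eps in H2 by (field; lra). nra.
Qed.

Lemma ln_sqr_le (x : R) : 1 <= x -> ln x ^ 2 <= 4 * x.
Proof.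
intros Hx. assert (Hs : 0 < sqrt x) by (apply sqrt_lt_R0; lra).
assert (E : ln x = 2 * ln (sqrt x)).
{ rewrite <- (sqrt_sqrt x) at 1 by lra. rewrite ln_mult by lra. ring. }
assert (H := ln_le_self _ Hs). assert (H0 := ln_ge_0 x Hx).
assert (H2 : ln x ^ 2 <= (2 * sqrt x) ^ 2) by (apply pow_incr; lra).
rewrite Rpow_mult_distr in H2. rewrite <- (Rsqr_pow2 (sqrt x)), Rsqr_sqrt in H2 by lra. lra.
Qed.

(** Termwise, the error of the linearization in [h] is [n^(-2k) * |e^u - 1 - u|] with
    [u = - h * ln n]. For [|h| <= 1], the bounds [e^|u| <= n], [(ln n)^2 <= 4 * n] and [2k >= 4]
    leave [4 * h^2 / n^2], in total at most [8 * h^2]. *)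
Lemma zeta_derive (k : nat) : (2 <= k)%nat ->
  Derive zeta (INR (2 * k)) = - Series (fun m => ln (INR (S m)) / INR (S m) ^ (2 * k)).
Proof.
intros Hk. apply is_derive_unique.
assert (Hpow : forall m, Rpower (INR (S m)) (INR (2 * k)) = INR (S m) ^ (2 * k))
  by (intros m; apply Rpower_pow, INR_S_pos).
assert (Hterm : forall m h, / Rpower (INR (S m)) (INR (2 * k) + h) =
  / INR (S m) ^ (2 * k) * exp (- (h * ln (INR (S m))))).
{ intros m h. rewrite Rpower_plus, Hpow, Rinv_mult. f_equal.
  unfold Rpower. now rewrite exp_Ropp. }
assert (Hx4 : forall m, / INR (S m) ^ (2 * k) <= / INR (S m) ^ 4).
{ intros m. apply Rinv_le_contravar; [apply pow_lt, INR_S_pos|].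
  apply Rle_pow; [apply INR_S_ge1 | lia]. }
assert (Hpos : forall m, 0 < / INR (S m) ^ (2 * k)) by (intros; apply Rinv_0_lt_compat, pow_lt, INR_S_pos).
assert (Hex : forall h, Rabs h <= 1 -> ex_series (fun m => / Rpower (INR (S m)) (INR (2 * k) + h))).
{ intros h Hh. apply (ex_series_le_inv_sqr _ 1). intros m. rewrite Hterm.
  assert (Hx := INR_S_ge1 m). assert (Hl := ln_ge_0 _ Hx).
  specialize (Hx4 m). specialize (Hpos m). set (x := INR (S m)) in *.
  assert (Hexp : exp (- (h * ln x)) <= x).
  { rewrite <- (exp_ln x) at 2 by lra. apply Rabs_le_between in Hh.
    destruct (Rle_lt_or_eq (- (h * ln x)) (ln x)) as [H|H]; [nra| |].
    - left; now apply exp_increasing.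
    - right; now rewrite H. }
  assert (Hexp0 := exp_pos (- (h * ln x))).
  rewrite Rabs_pos_eq by nra.
  apply Rle_trans with (/ x ^ 4 * x).
  - apply Rmult_le_compat; lra.
  - replace (/ x ^ 4 * x) with (/ x ^ 3) by (field; lra). unfold Rdiv. rewrite Rmult_1_l.
    apply Rinv_le_contravar; [apply pow_lt; lra | apply Rle_pow; [lra | lia]]. }
assert (Hexl : ex_series (fun m => ln (INR (S m)) / INR (S m) ^ (2 * k))).
{ apply (ex_series_le_inv_sqr _ 1). intros m.
  assert (Hx := INR_S_ge1 m). assert (Hl := ln_ge_0 _ Hx). assert (Hl2 := ln_le_self _ (INR_S_pos m)).
  specialize (Hx4 m). specialize (Hpos m). set (x := INR (S m)) in *.
  unfold Rdiv. rewrite Rabs_pos_eq by nra.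
  apply Rle_trans with (x * / x ^ 4).
  - apply Rmult_le_compat; lra.
  - replace (x * / x ^ 4) with (/ x ^ 3) by (field; lra). rewrite Rmult_1_l.
    apply Rinv_le_contravar; [apply pow_lt; lra | apply Rle_pow; [lra | lia]]. }
apply (is_derive_of_quadratic _ _ _ 8); [lra|]. intros h Hh.
assert (Hs1 := Series_correct _ (Hex h Hh)).
assert (Hs0 := Series_correct _ (Hex 0 ltac:(rewrite Rabs_R0; lra))).
rewrite Rplus_0_r in Hs0.
assert (Hsl := Series_correct _ Hexl).
change (zeta (INR (2 * k) + h)) with (Series (fun m => / Rpower (INR (S m)) (INR (2 * k) + h))).
change (zeta (INR (2 * k))) with (Series (fun m => / Rpower (INR (S m)) (INR (2 * k)))).
set (L := Series (fun m => ln (INR (S m)) / INR (S m) ^ (2 * k))) in *.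
apply (is_series_bound (fun m => / Rpower (INR (S m)) (INR (2 * k) + h) - / Rpower (INR (S m)) (INR (2 * k))
  - (- h) * (ln (INR (S m)) / INR (S m) ^ (2 * k)))).
- replace (h * - L) with ((- h) * L) by ring.
  apply (is_series_minus (fun m => / Rpower (INR (S m)) (INR (2 * k) + h) - / Rpower (INR (S m)) (INR (2 * k)))).
  + apply (is_series_minus (fun m => / Rpower (INR (S m)) (INR (2 * k) + h))); assumption.
  + apply (is_series_scal (- h) (fun m => ln (INR (S m)) / INR (S m) ^ (2 * k))). exact Hsl.
- intros K. eapply Rle_trans; [apply Rabs_rsum|].
  apply Rle_trans with (rsum (fun m => 4 * h ^ 2 * / INR (S m) ^ 2) K).
  2:{ rewrite rsum_scal. replace (8 * h ^ 2) with (4 * h ^ 2 * 2) by ring.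
      apply Rmult_le_compat_l; [nra | apply rsum_inv_sqr_le]. }
  apply rsum_le; intros m _. rewrite Hterm, Hpow.
  assert (Hx := INR_S_ge1 m). assert (Hl := ln_ge_0 _ Hx). assert (Hl2 := ln_sqr_le _ Hx).
  specialize (Hx4 m). specialize (Hpos m). set (x := INR (S m)) in *.
  set (u := - (h * ln x)).
  replace (/ x ^ (2 * k) * exp u - / x ^ (2 * k) - - h * (ln x / x ^ (2 * k))) with
    (/ x ^ (2 * k) * (exp u - 1 - u)) by (unfold u, Rdiv; ring).
  rewrite Rabs_mult, (Rabs_pos_eq (/ _)) by lra.
  assert (H2 := exp_taylor_2 u).
  assert (Hexp : exp (Rabs u) <= x).
  { rewrite <- (exp_ln x) at 1 by lra. unfold u. rewrite Rabs_Ropp, Rabs_mult, (Rabs_pos_eq (ln x)) by lra.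
    assert (Hle : Rabs h * ln x <= ln x) by nra.
    destruct Hle as [H| ->]; [left; now apply exp_increasing | lra]. }
  assert (Hexp0 := exp_pos (Rabs u)).
  assert (Hu : u ^ 2 <= 4 * h ^ 2 * x).
  { unfold u. replace ((- (h * ln x)) ^ 2) with (h ^ 2 * ln x ^ 2) by ring.
    replace (4 * h ^ 2 * x) with (h ^ 2 * (4 * x)) by ring.
    apply Rmult_le_compat_l; [nra | exact Hl2]. }
  apply Rle_trans with (/ x ^ 4 * (4 * h ^ 2 * x * x)).
  + apply Rmult_le_compat; [lra | apply Rabs_pos | exact Hx4 |].
    eapply Rle_trans; [exact H2|]. apply Rmult_le_compat; [nra | lra | exact Hu | exact Hexp].
  + right. field. lra.
Qed.

Lemma fourier_ln_sum_zeta (k : nat) : (2 <= k)%nat ->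
  fourier_ln_sum k = (-1) ^ k * 2 * Derive zeta (INR (2 * k)) / (2 * PI) ^ (2 * k).
Proof.
intros Hk. rewrite zeta_derive by exact Hk. unfold fourier_ln_sum.
rewrite (Series_ext _ (fun m => (-1) ^ S k * 2 / (2 * PI) ^ (2 * k) *
  (ln (INR (S m)) / INR (S m) ^ (2 * k)))).
- rewrite Series_scal_l. simpl ((-1) ^ S k). unfold Rdiv. ring.
- intros m. unfold fourier_coeff. rewrite Rpow_mult_distr. unfold Rdiv.
  rewrite Rinv_mult. ring.
Qed.

Lemma lambert_log_coeff_pow_ln (k : nat) : (2 <= k)%nat ->
  bern_fact (2 * k) * pow_ln_const (2 * k - 1) = lambert_log_coeff k.
Proof.
intros Hk. rewrite pow_ln_const_odd, fourier_ln_sum_zeta by exact Hk.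
unfold lambert_log_coeff, bern_fact.
set (G := euler_gamma - harmonic (2 * k - 1) + ln (2 * PI)).
assert (E : INR (fact (2 * k)) = 2 * INR k * INR (fact (2 * k - 1))).
{ replace (2 * k)%nat with (S (2 * k - 1)) at 1 by lia. rewrite fact_simpl, mult_INR.
  replace (S (2 * k - 1)) with (2 * k)%nat by lia. rewrite mult_INR. simpl (INR 2). ring. }
rewrite E. assert (Hf := INR_fact_neq_0 (2 * k - 1)).
assert (Hk0 : INR k <> 0) by (apply not_0_INR; lia).
assert (HP : (2 * PI) ^ (2 * k) <> 0) by (apply pow_nonzero; generalize PI_RGT_0; lra).
field. repeat split; assumption.
Qed.

(** * Stirling's constant from the Wallis integrals *)

Definition wallis (n : nat) : R := RInt (fun x => sin x ^ n) 0 (PI / 2).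

Lemma continuous_sin_pow (n : nat) (x : R) : continuous (fun x => sin x ^ n) x.
Proof. apply (ex_derive_continuous (fun x => sin x ^ n)). auto_derive. trivial. Qed.

Lemma wallis_correct (n : nat) : is_RInt (fun x => sin x ^ n) 0 (PI / 2) (wallis n).
Proof.
apply (RInt_correct (fun x => sin x ^ n)), ex_RInt_continuous.
intros; apply continuous_sin_pow.
Qed.

Lemma wallis_rec (n : nat) : INR (S (S n)) * wallis (S (S n)) = INR (S n) * wallis n.
Proof.
assert (H1 : is_RInt (fun x => INR (S (S n)) * sin x ^ S (S n) - INR (S n) * sin x ^ n) 0 (PI / 2)
  (INR (S (S n)) * wallis (S (S n)) - INR (S n) * wallis n)).
{ apply (is_RInt_minus (V := R_NormedModule) (fun x => INR (S (S n)) * sin x ^ S (S n))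
    (fun x => INR (S n) * sin x ^ n)).
  - apply (is_RInt_scal (V := R_NormedModule) (fun x => sin x ^ S (S n))), wallis_correct.
  - apply (is_RInt_scal (V := R_NormedModule) (fun x => sin x ^ n)), wallis_correct. }
assert (H2 : is_RInt (fun x => INR (S (S n)) * sin x ^ S (S n) - INR (S n) * sin x ^ n) 0 (PI / 2)
  (minus (- cos (PI / 2) * sin (PI / 2) ^ S n) (- cos 0 * sin 0 ^ S n))).
{ apply (is_RInt_derive (V := R_CompleteNormedModule) (fun x => - cos x * sin x ^ S n)).
  - intros x _. eapply is_derive_eq.
    + apply (is_derive_Rmult (fun x => - cos x)).
      * apply is_derive_Ropp, is_derive_cos.
      * exact (is_derive_pow sin (S n) x _ (is_derive_sin x)).
    + simpl Nat.pred. assert (Hc := sin2_cos2 x). unfold Rsqr in Hc.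
      rewrite (S_INR (S n)). simpl (sin x ^ S _).
      replace (- cos x * (INR (S n) * cos x * sin x ^ n)) with
        (- (INR (S n) * (cos x * cos x) * sin x ^ n)) by ring.
      replace (cos x * cos x) with (1 - sin x * sin x) by lra. ring.
  - intros x _. apply (ex_derive_continuous (fun x =>
      INR (S (S n)) * sin x ^ S (S n) - INR (S n) * sin x ^ n)). auto_derive. trivial. }
assert (Ev : minus (- cos (PI / 2) * sin (PI / 2) ^ S n) (- cos 0 * sin 0 ^ S n) = 0).
{ rewrite cos_PI2, sin_0. unfold minus, plus, opp. simpl. ring. }
rewrite Ev in H2.
assert (E := is_RInt_unique _ _ _ _ H1). rewrite (is_RInt_unique _ _ _ _ H2) in E. lra.
Qed.

Lemma wallis_0 : wallis 0 = PI / 2.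
Proof.
unfold wallis. rewrite (RInt_ext _ (fun _ => 1)) by (intros; reflexivity).
rewrite RInt_const. unfold scal; simpl; unfold mult; simpl. ring.
Qed.

Lemma wallis_1 : wallis 1 = 1.
Proof.
assert (H : is_RInt (fun x => sin x ^ 1) 0 (PI / 2) (minus (- cos (PI / 2)) (- cos 0))).
{ apply (is_RInt_derive (V := R_CompleteNormedModule) (fun x => - cos x)).
  - intros x _. auto_derive; [trivial|]. ring.
  - intros x _. apply continuous_sin_pow. }
unfold wallis. rewrite (is_RInt_unique _ _ _ _ H), cos_PI2, cos_0.
unfold minus, plus, opp; simpl. ring.
Qed.

Lemma wallis_decr (n : nat) : wallis (S n) <= wallis n.
Proof.
assert (HP := PI_RGT_0).
apply RInt_le; [lra | eexists; apply wallis_correct | eexists; apply wallis_correct|].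
intros x Hx. assert (H0 : 0 < sin x) by (apply sin_gt_0; lra).
assert (H1 : sin x <= 1) by apply SIN_bound.
assert (H2 : 0 < sin x ^ n) by now apply pow_lt. simpl. nra.
Qed.

Lemma wallis_pos_prod (n : nat) : 0 < wallis n /\ INR (S n) * wallis (S n) * wallis n = PI / 2.
Proof.
assert (HP := PI_RGT_0).
assert (Hpos : forall n, 0 < wallis n /\ 0 < wallis (S n)).
{ clear n; intros n; induction n as [|n [IH1 IH2]].
  - rewrite wallis_0, wallis_1. lra.
  - split; [exact IH2|]. assert (H := wallis_rec n).
    assert (H1 := INR_S_pos n). assert (H2 := INR_S_pos (S n)).
    assert (0 < INR (S n) * wallis n) by now apply Rmult_lt_0_compat.
    apply (Rmult_lt_reg_l (INR (S (S n)))); [exact H2|]. lra. }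
split; [exact (proj1 (Hpos n))|].
induction n as [|n IH].
- rewrite wallis_0, wallis_1. simpl. ring.
- rewrite wallis_rec, <- IH. ring.
Qed.

(** By monotonicity the square of [wallis (S n)] lies between its products with the two neighbours,
    both of which are given by [wallis_pos_prod]. *)
Lemma ln_wallis_bounds (n : nat) :
  0 <= 2 * ln (wallis (S n)) + ln (INR (S (S n))) - ln (PI / 2)
    <= ln (INR (S (S n))) - ln (INR (S n)).
Proof.
assert (HP := PI_RGT_0).
destruct (wallis_pos_prod n) as [H0 E0]. destruct (wallis_pos_prod (S n)) as [H1 E1].
destruct (wallis_pos_prod (S (S n))) as [H2 _].
assert (D0 := wallis_decr n). assert (D1 := wallis_decr (S n)).
assert (P1 := INR_S_pos n). assert (P2 := INR_S_pos (S n)).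
set (a := wallis n) in *. set (b := wallis (S n)) in *. set (c := wallis (S (S n))) in *.
assert (L1 : ln (PI / 2) <= ln (INR (S (S n)) * b * b)).
{ apply Rcomplements.ln_le; [lra|]. rewrite <- E1.
  apply Rmult_le_compat_r; [lra|]. apply Rmult_le_compat_l; lra. }
assert (L2 : ln (INR (S n) * b * b) <= ln (PI / 2)).
{ apply Rcomplements.ln_le.
  - apply Rmult_lt_0_compat; [apply Rmult_lt_0_compat|]; lra.
  - rewrite <- E0. apply Rmult_le_compat_l; [|exact D0]. apply Rmult_le_pos; lra. }
rewrite !ln_mult in L1 by (try apply Rmult_lt_0_compat; lra).
rewrite !ln_mult in L2 by (try apply Rmult_lt_0_compat; lra).
lra.
Qed.

Definition ln_fact (X : nat) : R := rsum (fun n => ln (INR (S n))) X.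

Lemma ln_fact_wallis (X : nat) :
  ln_fact (2 * X) - 2 * ln_fact X - 2 * INR X * ln 2 = ln (wallis (2 * X)) - ln (PI / 2).
Proof.
induction X as [|X IH].
- unfold ln_fact. simpl. rewrite wallis_0. ring.
- replace (2 * S X)%nat with (S (S (2 * X))) by lia.
  unfold ln_fact in *. rewrite !rsum_S.
  assert (Hw := wallis_rec (2 * X)). destruct (wallis_pos_prod (2 * X)) as [H0 _].
  destruct (wallis_pos_prod (S (S (2 * X)))) as [H2 _].
  assert (P1 := INR_S_pos (2 * X)). assert (P2 := INR_S_pos X).
  assert (E : INR (S (S (2 * X))) = 2 * INR (S X)) by (rewrite !S_INR, mult_INR; simpl; ring).
  rewrite E in *. apply (f_equal ln) in Hw.
  rewrite !ln_mult in Hw by lra. rewrite ln_mult by lra.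
  rewrite (S_INR X) at 3. lra.
Qed.

Lemma pow_ln_const_0 : pow_ln_const 0 = ln (2 * PI) / 2.
Proof.
assert (HP := PI_RGT_0).
assert (HD : forall X, pow_ln_defect 0 1 X =
  ln_fact X - (INR X + / 2) * ln (INR (S X)) + INR (S X)).
{ intros X. unfold pow_ln_defect, euler_maclaurin_R, ln_fact.
  rewrite (rsum_ext (fun n => INR (S n) ^ 0 * _) (fun n => ln (INR (S n)))) by (intros; simpl; ring).
  cbn [rsum]. rewrite pow_ln_jet_1, bern_fact_0, bern_fact_1. unfold pow_ln_jet.
  cbn [Nat.leb Nat.sub fact Nat.mul Nat.add]. rewrite harmonic_S, harmonic_0.
  rewrite (S_INR X). simpl (INR 1). simpl (_ ^ 1). simpl (_ ^ 0). field. }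
assert (H1 := pow_ln_const_lim 0 1 (le_n _)).
(* The combination [2 * D(n) - D(2n)] of the defects has the same limit as [D], and contains
   [2 * ln n! - ln (2n)!], which the Wallis integrals evaluate. *)
assert (H2 : is_lim_seq (fun N => 2 * pow_ln_defect 0 1 (S N) - pow_ln_defect 0 1 (2 * S N))
  (2 * pow_ln_const 0 - pow_ln_const 0)).
{ apply is_lim_seq_minus'.
  - apply is_lim_seq_mult'; [apply is_lim_seq_const|].
    now apply (is_lim_seq_incr_1 (pow_ln_defect 0 1)).
  - apply (is_lim_seq_incr_1 (fun N => pow_ln_defect 0 1 (2 * N))).
    now apply is_lim_seq_subseq_double. }
replace (2 * pow_ln_const 0 - pow_ln_const 0) with (pow_ln_const 0) in H2 by ring.
apply (is_lim_seq_unique_R _ _ _ H2). clear H1 H2.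
assert (E : forall N, 2 * pow_ln_defect 0 1 (S N) - pow_ln_defect 0 1 (2 * S N) - ln (2 * PI) / 2 =
  - (2 * ln (wallis (2 * S N)) + ln (INR (S (2 * S N))) - ln (PI / 2)) / 2
  + (1 - INR (S (2 * S N)) * (ln (INR (S (2 * S N)) + 1) - ln (INR (S (2 * S N)))))).
{ intros N. rewrite !HD. assert (HW := ln_fact_wallis (S N)).
  assert (P := INR_S_pos N). assert (P2 := INR_S_pos (S N)).
  replace (ln (2 * PI)) with (2 * ln 2 + ln (PI / 2)).
  2:{ rewrite ln_div, ln_mult by lra. ring. }
  assert (E1 : INR (S (S N)) = INR (S N) + 1) by apply S_INR.
  assert (E2 : INR (2 * S N) = 2 * INR (S N)) by (rewrite mult_INR; reflexivity).
  assert (E3 : INR (S (2 * S N)) = 2 * INR (S N) + 1) by (rewrite (S_INR (2 * S N)), E2; reflexivity).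
  rewrite E2, E3. replace (2 * INR (S N) + 1 + 1) with (2 * INR (S (S N))) by (rewrite E1; ring).
  rewrite (ln_mult 2) by lra.
  set (L := ln (INR (S (S N)))). set (L' := ln (2 * INR (S N) + 1)). rewrite E1.
  set (A1 := ln_fact (S N)) in *. set (A2 := ln_fact (2 * S N)) in *.
  set (w := ln (wallis (2 * S N))) in *. set (x := INR (S N)) in *.
  replace A2 with (w - ln (PI / 2) + 2 * A1 + 2 * x * ln 2) by lra.
  clearbody A1 A2 w x L L'. field. }
apply (is_lim_seq_ext (fun N => ln (2 * PI) / 2 +
  (- (2 * ln (wallis (2 * S N)) + ln (INR (S (2 * S N))) - ln (PI / 2)) / 2
  + (1 - INR (S (2 * S N)) * (ln (INR (S (2 * S N)) + 1) - ln (INR (S (2 * S N)))))))).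
{ intros N. rewrite <- E. ring. }
replace (Finite (ln (2 * PI) / 2)) with (Finite (ln (2 * PI) / 2 + 0)) by (f_equal; ring).
apply is_lim_seq_plus'; [apply is_lim_seq_const|].
apply (is_lim_seq_zero _ _ (is_lim_seq_cst_inv 2)). intros N.
assert (HB := ln_wallis_bounds (2 * N + 1)).
replace (S (2 * N + 1)) with (2 * S N)%nat in HB by lia.
assert (P := INR_S_pos N).
assert (Ex : INR (S (2 * S N)) = INR (2 * S N) + 1) by apply S_INR.
assert (Ex2 : INR (2 * S N) = 2 * INR (S N)) by (rewrite mult_INR; reflexivity).
assert (HL := ln_incr_bounds (INR (2 * S N)) ltac:(lra)).
assert (HL2 := ln_incr_bounds (INR (S (2 * S N))) ltac:(lra)).
rewrite <- Ex in HL. rewrite Ex2 in *. set (x := INR (S N)) in *.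
set (y := INR (S (2 * S N))) in *.
assert (Hi : / (2 * x) <= / x) by (apply Rinv_le_contravar; lra).
assert (Hy : 1 - / x <= y * (ln (y + 1) - ln y) <= 1).
{ split.
  - apply Rle_trans with (y * / (y + 1)).
    + replace (y * / (y + 1)) with (1 - / (y + 1)) by (field; lra).
      assert (/ (y + 1) <= / x) by (apply Rinv_le_contravar; lra). lra.
    + apply Rmult_le_compat_l; lra.
  - apply Rle_trans with (y * / y); [apply Rmult_le_compat_l; lra | right; field; lra]. }
apply Rabs_le. lra.
Qed.

(** * The constant of the leading term *)

Definition rbose (x : R) : R := / (exp x - 1).
Definition rlog (x : R) : R := ln (1 - exp (- x)).

Lemma exp_minus_1_pos (x : R) : 0 < x -> 0 < exp x - 1.
Proof. intros Hx. generalize (exp_ineq1 x); lra. Qed.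

Lemma rbose_pos (x : R) : 0 < x -> 0 < rbose x.
Proof. intros Hx. now apply Rinv_0_lt_compat, exp_minus_1_pos. Qed.

Lemma rbose_pow_bound (s : nat) (x : R) : 0 < x -> rbose x <= INR (fact (S s)) / x ^ S s.
Proof.
intros Hx. assert (H := exp_ge_pow s x (Rlt_le _ _ Hx)).
assert (Hp : 0 < x ^ S s) by now apply pow_lt.
assert (Hf : 0 < INR (fact (S s))) by apply lt_0_INR, lt_O_fact.
unfold rbose. replace (INR (fact (S s)) / x ^ S s) with (/ (x ^ S s / INR (fact (S s)))) by (field; lra).
apply Rinv_le_contravar; [now apply Rdiv_lt_0_compat | exact H].
Qed.

Lemma one_minus_exp_neg_pos (x : R) : 0 < x -> 0 < 1 - exp (- x).
Proof. intros Hx. assert (H : exp (- x) < exp 0) by (apply exp_increasing; lra). rewrite exp_0 in H. lra. Qed.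

Lemma is_derive_rlog (x : R) : 0 < x -> is_derive rlog x (rbose x).
Proof.
intros Hx. unfold rlog. assert (H := one_minus_exp_neg_pos x Hx).
auto_derive; [lra|]. unfold rbose. rewrite exp_Ropp in *.
assert (He := exp_pos x). assert (H1 := exp_minus_1_pos x Hx). field. repeat split; lra.
Qed.

Lemma rbose_decr (x z : R) : 0 < x <= z -> rbose z <= rbose x.
Proof.
intros H. unfold rbose. apply Rinv_le_contravar; [apply exp_minus_1_pos; lra|].
destruct (proj2 H) as [Hl| ->]; [|lra]. apply exp_increasing in Hl. lra.
Qed.

Lemma rlog_neg (x : R) : 0 < x -> rlog x <= 0.
Proof.
intros Hx. unfold rlog. assert (H := ln_le_minus_one _ (one_minus_exp_neg_pos x Hx)).
generalize (exp_pos (- x)); lra.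
Qed.

Lemma rlog_ln_bounds (x : R) : 0 < x -> - x <= rlog x - ln x <= 0.
Proof.
intros Hx. assert (H := one_minus_exp_neg_pos x Hx). unfold rlog. split.
- assert (H1 : ln (x * exp (- x)) <= ln (1 - exp (- x))).
  { apply Rcomplements.ln_le; [apply Rmult_lt_0_compat; [lra | apply exp_pos]|].
    assert (H1 := exp_ineq1_le x). assert (H2 := exp_pos (- x)).
    assert (H3 : exp (- x) * exp x = 1) by (rewrite <- exp_plus, Rplus_opp_l; apply exp_0). nra. }
  rewrite ln_mult, ln_exp in H1 by (lra || apply exp_pos). lra.
- assert (H1 : ln (1 - exp (- x)) <= ln x).
  { apply Rcomplements.ln_le; [exact H|]. generalize (exp_ineq1_le (- x)); lra. }
  lra.
Qed.

Lemma mul_rbose_bounds (x : R) : 0 < x -> 1 - x <= x * rbose x <= 1.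
Proof.
intros Hx. assert (H := exp_minus_1_pos x Hx). unfold rbose. split.
- apply (Rmult_le_reg_r (exp x - 1)); [exact H|]. rewrite Rmult_assoc, Rinv_l, Rmult_1_r by lra.
  assert (H1 := exp_ineq1_le (- x)). rewrite exp_Ropp in H1.
  assert (H2 := exp_pos x). apply (Rmult_le_compat_r (exp x)) in H1; [|lra].
  rewrite Rinv_l in H1 by lra. nra.
- apply (Rmult_le_reg_r (exp x - 1)); [exact H|]. rewrite Rmult_assoc, Rinv_l by lra.
  generalize (exp_ineq1_le x); lra.
Qed.

(* [4 sinh^2 (x / 2) >= x^2], which makes [rbose x - 1 / x] increasing. *)
Lemma sqr_exp_le (x : R) : 0 <= x -> x ^ 2 * exp x <= (exp x - 1) ^ 2.
Proof.
intros Hx.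
assert (H : x <= exp (x / 2) - exp (- (x / 2))).
{ set (f := fun u => exp (u / 2) - exp (- (u / 2)) - u).
  destruct (MVT_gen f 0 x (fun u => (exp (u / 2) + exp (- (u / 2))) / 2 - 1)) as (u & _ & E).
  - intros u _. unfold f. auto_derive; [trivial|]. unfold Rdiv. field.
  - intros u _. apply continuity_pt_filterlim, (ex_derive_continuous f). unfold f. auto_derive. trivial.
  - assert (H0 : f 0 = 0).
    { unfold f. replace (0 / 2) with 0 by field. rewrite Ropp_0. ring. }
    assert (H1 := exp_ineq1_le (u / 2)). assert (H2 := exp_ineq1_le (- (u / 2))).
    assert (0 <= ((exp (u / 2) + exp (- (u / 2))) / 2 - 1) * (x - 0)) by (apply Rmult_le_pos; lra).
    unfold f in *. lra. }
assert (E1 : exp (x / 2) * exp (x / 2) = exp x) by (rewrite <- exp_plus; f_equal; field).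
assert (E2 : exp (x / 2) * exp (- (x / 2)) = 1) by (rewrite <- exp_plus, Rplus_opp_r; apply exp_0).
assert (Hp := exp_pos (x / 2)).
replace (x ^ 2 * exp x) with ((x * exp (x / 2)) ^ 2) by (rewrite <- E1; ring).
apply pow_incr. split; [apply Rmult_le_pos; lra|].
apply (Rmult_le_compat_r (exp (x / 2))) in H; [|lra]. lra.
Qed.

Lemma rbose_regular_incr (x z : R) : 0 < x <= z -> rbose x - / x <= rbose z - / z.
Proof.
intros H.
destruct (MVT_gen (fun u => rbose u - / u) x z (fun u => / u ^ 2 - exp u / (exp u - 1) ^ 2)) as (u & Hu & E).
- rewrite Rmin_left, Rmax_right by lra. intros u Hu.
  assert (Hp := exp_minus_1_pos u ltac:(lra)). unfold rbose. auto_derive; [lra|]. field. lra.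
- rewrite Rmin_left, Rmax_right by lra. intros u Hu.
  assert (Hp := exp_minus_1_pos u ltac:(lra)).
  apply continuity_pt_filterlim, (ex_derive_continuous (fun u => rbose u - / u)).
  unfold rbose. auto_derive. lra.
- rewrite Rmin_left, Rmax_right in Hu by lra.
  assert (Hp := exp_minus_1_pos u ltac:(lra)).
  assert (H1 := sqr_exp_le u ltac:(lra)).
  assert (H2 : exp u / (exp u - 1) ^ 2 <= / u ^ 2).
  { assert (Hu2 : 0 < u ^ 2) by (apply pow_lt; lra).
    assert (He2 : 0 < (exp u - 1) ^ 2) by now apply pow_lt.
    apply (Rmult_le_reg_r (u ^ 2 * (exp u - 1) ^ 2)); [now apply Rmult_lt_0_compat|].
    replace (exp u / (exp u - 1) ^ 2 * (u ^ 2 * (exp u - 1) ^ 2)) with (u ^ 2 * exp u) by (field; lra).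
    replace (/ u ^ 2 * (u ^ 2 * (exp u - 1) ^ 2)) with ((exp u - 1) ^ 2) by (field; lra). exact H1. }
  assert (0 <= (/ u ^ 2 - exp u / (exp u - 1) ^ 2) * (z - x)) by (apply Rmult_le_pos; lra).
  lra.
Qed.

Lemma rlog_MVT (x z : R) : 0 < x <= z -> exists u, x <= u <= z /\ rlog z - rlog x = rbose u * (z - x).
Proof.
intros H. destruct (MVT_gen rlog x z rbose) as (u & Hu & E).
- rewrite Rmin_left, Rmax_right by lra. intros u Hu. apply is_derive_rlog. lra.
- rewrite Rmin_left, Rmax_right by lra. intros u Hu.
  apply continuity_pt_filterlim, (ex_derive_continuous rlog). exists (rbose u). apply is_derive_rlog. lra.
- rewrite Rmin_left, Rmax_right in Hu by lra. now exists u.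
Qed.

Lemma rlog_regular_MVT (x z : R) : 0 < x <= z -> exists u, x <= u <= z /\
  (rlog z - ln z) - (rlog x - ln x) = (rbose u - / u) * (z - x).
Proof.
intros H. destruct (MVT_gen (fun u => rlog u - ln u) x z (fun u => rbose u - / u)) as (u & Hu & E).
- rewrite Rmin_left, Rmax_right by lra. intros u Hu.
  apply is_derive_Rminus; [apply is_derive_rlog | apply is_derive_ln]; lra.
- rewrite Rmin_left, Rmax_right by lra. intros u Hu.
  apply continuity_pt_filterlim, (ex_derive_continuous (fun u => rlog u - ln u)). eexists.
  apply is_derive_Rminus; [apply is_derive_rlog | apply is_derive_ln]; lra.
- rewrite Rmin_left, Rmax_right in Hu by lra. now exists u.
Qed.

Lemma rlog_lim_infinity (y : R) : 0 < y -> is_lim_seq (fun n => rlog (INR (S n) * y)) 0.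
Proof.
intros Hy. apply (is_lim_seq_zero _ _ (is_lim_seq_cst_inv (/ y))). intros n.
assert (Hn := INR_S_pos n). set (x := INR (S n) * y).
assert (Hx : 0 < x) by (apply Rmult_lt_0_compat; lra).
rewrite Rabs_left1 by now apply rlog_neg. unfold rlog.
assert (H := one_minus_exp_neg_pos x Hx). rewrite <- ln_Rinv by exact H.
eapply Rle_trans; [apply ln_le_minus_one; now apply Rinv_0_lt_compat|].
replace (/ (1 - exp (- x)) - 1) with (rbose x).
- replace (/ y * / INR (S n)) with (1 * / x) by (unfold x; field; lra).
  apply (Rmult_le_reg_l x); [exact Hx|]. replace (x * (1 * / x)) with 1 by (field; lra).
  apply mul_rbose_bounds, Hx.
- unfold rbose. rewrite exp_Ropp in *. assert (H1 := exp_minus_1_pos x Hx).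
  assert (H2 := exp_pos x). field. repeat split; lra.
Qed.

Lemma ln_series (r : R) : 0 < r < 1 -> is_lim_seq (rsum (fun n => r ^ S n / INR (S n))) (- ln (1 - r)).
Proof.
intros Hr.
assert (Hd : forall X t, 0 <= t <= r -> is_derive (fun t => rsum (fun n => t ^ S n / INR (S n)) X + ln (1 - t)) t
  (- (t ^ X / (1 - t)))).
{ intros X t Ht. eapply is_derive_eq.
  - apply is_derive_Rplus.
    + apply is_derive_rsum. intros n _. instantiate (1 := fun n => t ^ n).
      assert (Hn := INR_S_pos n). set (c := INR (S n)) in *.
      apply (is_derive_ext (fun t => t ^ S n * / c)); [reflexivity|].
      eapply is_derive_eq.
      * apply (is_derive_Rmult (fun t => t ^ S n) (fun _ => / c)).
        -- exact (is_derive_pow (fun t => t) (S n) t 1 (is_derive_id t)).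
        -- exact (is_derive_const (/ c) t).
      * change (@zero R_NormedModule) with 0. simpl Nat.pred. fold c. cbv beta. field. lra.
    + instantiate (1 := - / (1 - t)). auto_derive; [lra|]. field. lra.
  - assert (Hg : rsum (fun n => t ^ n) X = (1 - t ^ X) / (1 - t)).
    { induction X as [|X IH]; [simpl; field; lra|]. rewrite rsum_S, IH. simpl. field. lra. }
    rewrite Hg. field. lra. }
apply (is_lim_seq_ext (fun X => (rsum (fun n => r ^ S n / INR (S n)) X + ln (1 - r)) - ln (1 - r)));
  [intros; ring|].
replace (Finite (- ln (1 - r))) with (Finite (0 - ln (1 - r))) by (f_equal; ring).
apply is_lim_seq_minus'; [|apply is_lim_seq_const].
apply (is_lim_seq_zero _ (fun X => / (1 - r) * r * r ^ X)).
- replace (Finite 0) with (Finite (/ (1 - r) * r * 0)) by (f_equal; ring).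
  apply is_lim_seq_mult'; [apply is_lim_seq_const|]. apply is_lim_seq_geom. rewrite Rabs_pos_eq; lra.
- intros X. assert (HM := MVT_bound _ _ 0 r (/ (1 - r) * r ^ X) ltac:(lra) (Hd X)).
  assert (H0 : rsum (fun n => 0 ^ S n / INR (S n)) X + ln (1 - 0) = 0).
  { rewrite rsum_0, Rminus_0_r, ln_1; [ring|]. intros n _. rewrite pow_i by lia. unfold Rdiv; ring. }
  cbv beta in HM. rewrite H0, !Rminus_0_r in HM.
  eapply Rle_trans; [apply HM|right; ring].
  intros t Ht. rewrite Rabs_Ropp. unfold Rdiv.
  assert (0 <= t ^ X) by (apply pow_le; lra).
  assert (Hi : 0 < / (1 - t)) by (apply Rinv_0_lt_compat; lra).
  rewrite Rabs_pos_eq by (apply Rmult_le_pos; lra). rewrite Rmult_comm.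
  apply Rmult_le_compat; [lra | lra | |apply pow_incr; lra].
  apply Rinv_le_contravar; lra.
Qed.

Lemma harmonic_pos (n : nat) : 0 <= harmonic n.
Proof.
rewrite harmonic_rsum. apply rsum_pos. intros i _. left. apply Rinv_0_lt_compat, INR_S_pos.
Qed.

Lemma harmonic_le (n : nat) : harmonic n <= INR n.
Proof.
induction n as [|n IH]; [rewrite harmonic_0; simpl; lra|].
rewrite harmonic_S, S_INR. assert (H := inv_INR_S_range n). rewrite S_INR in H. lra.
Qed.

Lemma exp_nat_mult (x : R) (n : nat) : exp (- (INR n * x)) = exp (- x) ^ n.
Proof.
induction n as [|n IH]; [simpl; rewrite Rmult_0_l, Ropp_0; apply exp_0|].
rewrite S_INR. replace (- ((INR n + 1) * x)) with (- x + - (INR n * x)) by ring.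
rewrite exp_plus, IH. reflexivity.
Qed.

Lemma exp_neg_le_inv_sqr (x : R) : 0 < x -> exp (- x) <= 2 / x ^ 2.
Proof.
intros Hx. rewrite exp_Ropp. assert (H := exp_ge_pow 1 x (Rlt_le _ _ Hx)). simpl in H.
assert (H2 : 0 < x ^ 2) by now apply pow_lt.
replace (2 / x ^ 2) with (/ (x ^ 2 / 2)) by (field; lra).
apply Rinv_le_contravar; [lra|]. simpl. lra.
Qed.

(** Summation by parts: multiplied by [1 - r] with [r = e^(-x)], the partial sums become [r] times
    those of the logarithmic series, up to a vanishing boundary term. The factor [r / (1 - r)] is
    [rbose x]. *)
Lemma harmonic_gf (x : R) : 0 < x ->
  is_series (fun n => harmonic n * exp (- x) ^ S n) (- rlog x * rbose x).
Proof.
intros Hx. set (r := exp (- x)).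
assert (Hr0 : 0 < r) by apply exp_pos.
assert (Hr1 : 0 < 1 - r) by now apply one_minus_exp_neg_pos.
apply is_series_rsum.
assert (HA : forall X, rsum (fun n => harmonic n * r ^ S n) X =
  / (1 - r) * (r * rsum (fun n => r ^ S n / INR (S n)) X - harmonic X * r ^ S X)).
{ intros X. apply (Rmult_eq_reg_l (1 - r)); [|lra].
  rewrite <- Rmult_assoc, Rinv_r, Rmult_1_l by lra.
  induction X as [|X IH]; [simpl; rewrite harmonic_0; ring|].
  rewrite !rsum_S, Rmult_plus_distr_l, IH, harmonic_S. assert (Hn := INR_S_pos X).
  change (r ^ S (S X)) with (r * r ^ S X). field. lra. }
apply (is_lim_seq_ext _ _ _ (fun X => eq_sym (HA X))).
replace (- rlog x * rbose x) with (/ (1 - r) * (r * - ln (1 - r) - 0)).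
2:{ unfold rlog, rbose. fold r. replace (exp x) with (/ r).
    - field. lra.
    - unfold r. rewrite exp_Ropp, Rinv_inv. reflexivity. }
apply is_lim_seq_mult'; [apply is_lim_seq_const|]. apply is_lim_seq_minus'.
- apply is_lim_seq_mult'; [apply is_lim_seq_const | apply ln_series; lra].
- apply (is_lim_seq_zero _ _ (is_lim_seq_cst_inv (2 / x ^ 2))). intros X.
  assert (Hn := INR_S_pos X). assert (HH := harmonic_pos X). assert (HL := harmonic_le X).
  assert (Hp : 0 < r ^ S X) by now apply pow_lt.
  rewrite Rabs_pos_eq by (apply Rmult_le_pos; lra).
  unfold r. rewrite <- exp_nat_mult.
  assert (HE := exp_neg_le_inv_sqr (INR (S X) * x) ltac:(apply Rmult_lt_0_compat; lra)).
  apply Rle_trans with (INR (S X) * (2 / (INR (S X) * x) ^ 2)).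
  + apply Rmult_le_compat; [exact HH | left; apply exp_pos | rewrite S_INR; lra | exact HE].
  + right. field. lra.
Qed.

Lemma rbose_geom (s : R) (K : nat) : 0 < s ->
  rsum (fun m => exp (- s) ^ S m) K = rbose s * (1 - exp (- s) ^ K).
Proof.
intros Hs. assert (H1 := one_minus_exp_neg_pos s Hs). assert (H0 := exp_pos (- s)).
assert (E : rbose s = exp (- s) / (1 - exp (- s))).
{ unfold rbose. rewrite exp_Ropp in *. assert (H2 := exp_pos s). assert (H3 := exp_minus_1_pos s Hs).
  field. repeat split; lra. }
rewrite E. set (r := exp (- s)) in *.
induction K as [|K IH]; [simpl; field; lra|]. rewrite rsum_S, IH. simpl. field. lra.
Qed.

Lemma is_series_fin_rsum (a : nat -> nat -> R) (l : nat -> R) (K : nat) :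
  (forall m, is_series (a m) (l m)) -> is_series (fun n => rsum (fun m => a m n) K) (rsum l K).
Proof.
intros H. induction K as [|K IH]; simpl.
- apply is_series_rsum. apply (is_lim_seq_ext (fun _ => 0)); [|apply is_lim_seq_const].
  intros n. symmetry. now apply rsum_0.
- apply (is_series_plus (fun n => rsum (fun m => a m n) K)); [exact IH | apply H].
Qed.

Lemma harmonic_rbose_ex (y : R) : 0 < y -> ex_series (fun n => harmonic n * rbose (INR (S n) * y)).
Proof.
intros Hy. apply (ex_series_le_inv_sqr _ (6 / y ^ 3)). intros n.
assert (Hn := INR_S_pos n). assert (Hx : 0 < INR (S n) * y) by now apply Rmult_lt_0_compat.
assert (H := rbose_pow_bound 2 _ Hx). assert (Hp := rbose_pos _ Hx).
assert (HH := harmonic_pos n). assert (HL := harmonic_le n).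
rewrite Rabs_pos_eq by (apply Rmult_le_pos; lra).
apply Rle_trans with (INR (S n) * (INR (fact 3) / (INR (S n) * y) ^ 3)).
- apply Rmult_le_compat; [exact HH | lra | rewrite S_INR; lra | exact H].
- right. replace (INR (fact 3)) with 6 by (simpl; ring). field. lra.
Qed.

(* Summing the generating function at [e^(-m y)] over [m] inverts the double sum. *)
Lemma harmonic_rbose_series (y : R) : 0 < y ->
  is_series (fun m => - rlog (INR (S m) * y) * rbose (INR (S m) * y))
    (Series (fun n => harmonic n * rbose (INR (S n) * y))).
Proof.
intros Hy. set (A := Series _).
assert (HA : is_series (fun n => harmonic n * rbose (INR (S n) * y)) A)
  by (apply Series_correct, harmonic_rbose_ex, Hy).
assert (Hx : forall n, 0 < INR (S n) * y) by (intros; apply Rmult_lt_0_compat; [apply INR_S_pos | exact Hy]).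
set (q := exp (- y)). assert (Hq0 : 0 < q) by apply exp_pos.
assert (Hq1 := one_minus_exp_neg_pos y Hy). fold q in Hq1.
apply is_series_rsum.
(* Truncating the geometric sum over [m] at [K] multiplies it by [1 - e^(-(n+1) K y)], so the error
   is at most [q^K] times the full sum. *)
assert (HB : forall K, Rabs (A - rsum (fun m => - rlog (INR (S m) * y) * rbose (INR (S m) * y)) K) <= A * q ^ K).
{ intros K.
  assert (HK : is_series (fun n => harmonic n * (rbose (INR (S n) * y) * (1 - exp (- (INR (S n) * y)) ^ K)))
    (rsum (fun m => - rlog (INR (S m) * y) * rbose (INR (S m) * y)) K)).
  { apply (is_series_ext (fun n => rsum (fun m => harmonic n * exp (- (INR (S m) * y)) ^ S n) K)).
    - intros n. rewrite <- rbose_geom, <- rsum_scal by apply Hx. apply rsum_ext; intros m _.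
      f_equal. rewrite !exp_nat_mult, <- !pow_mult. f_equal. ring.
    - apply is_series_fin_rsum. intros m. apply harmonic_gf, Hx. }
  apply (is_series_bound (fun n => harmonic n * rbose (INR (S n) * y) -
    harmonic n * (rbose (INR (S n) * y) * (1 - exp (- (INR (S n) * y)) ^ K)))).
  - now apply (is_series_minus (fun n => harmonic n * rbose (INR (S n) * y))).
  - intros X. eapply Rle_trans; [apply Rabs_rsum|].
    apply Rle_trans with (q ^ K * rsum (fun n => harmonic n * rbose (INR (S n) * y)) X).
    + rewrite <- rsum_scal. apply rsum_le; intros n _.
      assert (HH := harmonic_pos n). assert (Hb := rbose_pos _ (Hx n)).
      set (b := rbose (INR (S n) * y)) in *.
      replace (harmonic n * b - harmonic n * (b * (1 - exp (- (INR (S n) * y)) ^ K))) with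
        (exp (- (INR (S n) * y)) ^ K * (harmonic n * b)) by ring.
      assert (He : 0 <= exp (- (INR (S n) * y)) ^ K) by (apply pow_le; left; apply exp_pos).
      rewrite Rabs_pos_eq by (apply Rmult_le_pos; [exact He | apply Rmult_le_pos; lra]).
      apply Rmult_le_compat_r; [apply Rmult_le_pos; lra|].
      apply pow_incr. split; [left; apply exp_pos|].
      rewrite exp_nat_mult. fold q.
      assert (Hqn : q ^ n <= 1) by (rewrite <- (pow1 n); apply pow_incr; lra).
      change (q ^ S n) with (q * q ^ n). nra.
    + rewrite Rmult_comm. apply Rmult_le_compat_r; [apply pow_le; lra|].
      apply is_series_rsum in HA.
      apply (is_lim_seq_incr_compare _ _ HA). intros n. rewrite rsum_S.
      assert (0 <= harmonic n * rbose (INR (S n) * y)); [|lra].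
      apply Rmult_le_pos; [apply harmonic_pos | left; apply rbose_pos, Hx]. }
apply (is_lim_seq_ext (fun K => A -
  (A - rsum (fun m => - rlog (INR (S m) * y) * rbose (INR (S m) * y)) K))); [intros; ring|].
replace (Finite A) with (Finite (A - 0)) by (f_equal; ring).
apply is_lim_seq_minus'; [apply is_lim_seq_const|].
apply (is_lim_seq_zero _ (fun K => A * q ^ K)).
- replace (Finite 0) with (Finite (A * 0)) by (f_equal; ring).
  apply is_lim_seq_mult'; [apply is_lim_seq_const|]. apply is_lim_seq_geom. rewrite Rabs_pos_eq; lra.
- exact HB.
Qed.

Lemma dominated_series_lim (a : nat -> nat -> R) (l M : nat -> R) :
  (forall j n, Rabs (a j n) <= M n) -> ex_series M ->
  (forall n, is_lim_seq (fun j => a j n) (l n)) ->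
  is_lim_seq (fun j => Series (a j)) (Series l).
Proof.
intros Hdom HM Hl.
assert (Hlb : forall n, Rabs (l n) <= M n).
{ intros n. apply (is_lim_seq_le (fun j => Rabs (a j n)) (fun _ => M n) (Rabs (l n)) (M n) (fun j => Hdom j n)).
  - apply (is_lim_seq_abs _ (Finite _)), Hl.
  - apply is_lim_seq_const. }
assert (Htail : forall b, (forall n, Rabs (b n) <= M n) -> forall N,
  Rabs (Series b - rsum b N) <= Series M - rsum M N).
{ intros b Hb N. assert (Hexb : ex_series b) by (apply (ex_series_le b M); [exact Hb | exact HM]).
  assert (H1 := Series_correct _ Hexb). assert (H2 := Series_correct _ HM).
  apply is_series_rsum in H1. apply is_series_rsum in H2.
  apply (is_lim_seq_le (fun L => Rabs (rsum b (L + N) - rsum b N)) (fun L => rsum M (L + N) - rsum M N)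
    (Rabs (Series b - rsum b N)) (Series M - rsum M N)).
  - intros L. rewrite Nat.add_comm, !rsum_app.
    match goal with |- Rabs (?a + ?b - ?a) <= ?c + ?d - ?c =>
      replace (a + b - a) with b by ring; replace (c + d - c) with d by ring end.
    eapply Rle_trans; [apply Rabs_rsum|]. apply rsum_le; intros i _. apply Hb.
  - apply (is_lim_seq_abs _ (Finite _)), is_lim_seq_minus'; [|apply is_lim_seq_const].
    now apply (is_lim_seq_incr_n (rsum b)).
  - apply is_lim_seq_minus'; [|apply is_lim_seq_const]. now apply (is_lim_seq_incr_n (rsum M)). }
apply is_lim_seq_Reals. intros eps He.
assert (H2 := Series_correct _ HM). apply is_series_rsum in H2.
destruct (is_lim_seq_small _ _ (eps / 4) H2 ltac:(lra)) as [N HN].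
specialize (HN N (le_n _)). apply Rabs_le_between in HN.
assert (H3 : is_lim_seq (fun j => rsum (a j) N) (rsum l N)).
{ apply (is_lim_seq_rsum (fun i j => a j i)). intros i _. apply Hl. }
destruct (is_lim_seq_small _ _ (eps / 4) H3 ltac:(lra)) as [J HJ].
exists J. intros j Hj. specialize (HJ j Hj). unfold Rdist.
assert (T1 := Htail (a j) (Hdom j) N). assert (T2 := Htail l Hlb N).
apply Rabs_le_between in HJ. apply Rabs_le_between in T1. apply Rabs_le_between in T2.
apply Rabs_def1; lra.
Qed.

(** * Riemann sums for the increments of ln (1 - e^(-x)) *)

Definition rnode (y : R) (n : nat) : R := INR (S n) * y.
Definition rweight (y : R) (n : nat) : R := y * rbose (rnode y n).
Definition rstep (y : R) (n : nat) : R := rlog (rnode y (S n)) - rlog (rnode y n).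
(** The error of one left rectangle for the integral of [rbose]. For small [y] it is close to
    [/ INR (S n) - ln_step n], and these add up to [euler_gamma]. *)
Definition rdefect (y : R) (n : nat) : R := rweight y n - rstep y n.
Definition ln_step (n : nat) : R := ln (INR (S (S n))) - ln (INR (S n)).

Lemma rnode_pos (y : R) (n : nat) : 0 < y -> 0 < rnode y n.
Proof. intros Hy. apply Rmult_lt_0_compat; [apply INR_S_pos | exact Hy]. Qed.

Lemma rnode_S (y : R) (n : nat) : rnode y (S n) = rnode y n + y.
Proof. unfold rnode. rewrite (S_INR (S n)). ring. Qed.

Lemma rweight_bounds (y : R) (n : nat) : 0 < y -> 0 <= rweight y n <= / INR (S n).
Proof.
intros Hy. assert (Hx := rnode_pos y n Hy). assert (Hn := INR_S_pos n).
assert (H := mul_rbose_bounds _ Hx). assert (Hb := rbose_pos _ Hx). unfold rweight.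
split; [apply Rmult_le_pos; lra|].
apply (Rmult_le_reg_l (INR (S n))); [exact Hn|]. rewrite Rinv_r by lra.
unfold rnode in *. lra.
Qed.

Lemma rweight_lim (y : R) (n : nat) : 0 < y -> Rabs (rweight y n - / INR (S n)) <= y.
Proof.
intros Hy. assert (Hx := rnode_pos y n Hy). assert (Hn := INR_S_pos n).
assert (H := mul_rbose_bounds _ Hx).
replace (rweight y n - / INR (S n)) with (- ((1 - rnode y n * rbose (rnode y n)) * / INR (S n)))
  by (unfold rweight, rnode; field; lra).
rewrite Rabs_Ropp, Rabs_pos_eq.
- apply (Rmult_le_reg_r (INR (S n))); [exact Hn|]. rewrite Rmult_assoc, Rinv_l by lra.
  replace (y * INR (S n)) with (rnode y n) by (unfold rnode; ring). lra.
- apply Rmult_le_pos; [lra | left; now apply Rinv_0_lt_compat].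
Qed.

Lemma rstep_bounds (y : R) (n : nat) : 0 < y -> 0 <= rstep y n <= rweight y n.
Proof.
intros Hy. assert (Hx := rnode_pos y n Hy). unfold rstep, rweight. rewrite rnode_S.
destruct (rlog_MVT (rnode y n) (rnode y n + y)) as (u & Hu & E); [lra|]. rewrite E.
assert (Hb := rbose_pos u ltac:(lra)). assert (Hd := rbose_decr (rnode y n) u ltac:(lra)).
replace (rnode y n + y - rnode y n) with y by ring. split; [|rewrite Rmult_comm];
  [apply Rmult_le_pos | apply Rmult_le_compat_l]; lra.
Qed.

Lemma ln_rnode (y : R) (n : nat) : 0 < y -> ln (rnode y n) = ln (INR (S n)) + ln y.
Proof. intros Hy. apply ln_mult; [apply INR_S_pos | exact Hy]. Qed.

(** [rbose x] is [1 / x] plus an increasing function. The first part contributes the rectangle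
    errors of [1 / x], which do not depend on the scale [y]; the second errs by at most [y] times
    its increment over the step, which telescopes in the sum. *)
Lemma rdefect_bounds (y : R) (n : nat) : 0 < y ->
  y * ((rbose (rnode y n) - / rnode y n) - (rbose (rnode y (S n)) - / rnode y (S n)))
  <= rdefect y n - (/ INR (S n) - ln_step n) <= 0.
Proof.
intros Hy. assert (Hx := rnode_pos y n Hy). assert (Hn := INR_S_pos n).
destruct (rlog_regular_MVT (rnode y n) (rnode y (S n))) as (u & Hu & E); [rewrite rnode_S; lra|].
assert (H1 := rbose_regular_incr (rnode y n) u ltac:(lra)).
assert (H2 := rbose_regular_incr u (rnode y (S n)) ltac:(lra)).
replace (rnode y (S n) - rnode y n) with y in E by (rewrite rnode_S; ring).
rewrite !ln_rnode in E by exact Hy.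
replace (rdefect y n - (/ INR (S n) - ln_step n)) with
  (y * ((rbose (rnode y n) - / rnode y n) - (rbose u - / u))).
- split; [apply Rmult_le_compat_l; lra|].
  rewrite <- (Rmult_0_r y). apply Rmult_le_compat_l; lra.
- unfold rdefect, rstep, rweight, ln_step.
  replace (/ INR (S n)) with (y * / rnode y n) by (unfold rnode; field; lra).
  lra.
Qed.

Lemma ln_step_bounds (n : nat) : / INR (S (S n)) <= ln_step n <= / INR (S n).
Proof.
unfold ln_step. rewrite (S_INR (S n)). apply ln_incr_bounds, INR_S_pos.
Qed.

Lemma rdefect_range (y : R) (n : nat) : 0 < y -> 0 <= rdefect y n <= / INR (S n) ^ 2.
Proof.
intros Hy. split; [unfold rdefect; generalize (rstep_bounds y n Hy); lra|].
assert (H := rdefect_bounds y n Hy). assert (H1 := ln_step_bounds n).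
assert (Hn := INR_S_ge1 n).
assert (/ INR (S n) - / INR (S (S n)) <= / INR (S n) ^ 2); [|lra].
rewrite (S_INR (S n)). set (a := INR (S n)) in *.
replace (/ a - / (a + 1)) with (/ (a * (a + 1))) by (field; lra).
apply Rinv_le_contravar; [apply pow_lt; lra | nra].
Qed.

Lemma rdefect_ex (y : R) : 0 < y -> ex_series (rdefect y).
Proof.
intros Hy. apply (ex_series_le_inv_sqr _ 1). intros n.
assert (H := rdefect_range y n Hy). rewrite Rabs_pos_eq by lra. lra.
Qed.

Lemma rdefect_sum (y : R) : 0 < y -> Rabs (Series (rdefect y) - euler_gamma) <= y.
Proof.
intros Hy. assert (HS := Series_correct _ (rdefect_ex y Hy)).
apply is_series_rsum in HS.
assert (HG : forall X, rsum (fun n => / INR (S n) - ln_step n) X = gamma_seq X).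
{ intros X. rewrite rsum_minus, (rsum_telescope (fun n => ln (INR (S n)))), <- harmonic_rsum.
  change (INR 1) with 1. rewrite ln_1. unfold gamma_seq. ring. }
assert (HB : forall X, Rabs (rsum (rdefect y) X - gamma_seq X) <= y).
{ intros X. rewrite <- HG, <- rsum_minus.
  set (h := fun n => rbose (rnode y n) - / rnode y n).
  assert (Hh : forall n, -1 <= h n <= 0).
  { intros n. unfold h. assert (Hx := rnode_pos y n Hy). assert (H := mul_rbose_bounds _ Hx).
    set (x := rnode y n) in *.
    split; apply (Rmult_le_reg_l x); try exact Hx; rewrite Rmult_minus_distr_l, Rinv_r by lra; lra. }
  assert (HL : y * (h O - h X) <= rsum (fun i => rdefect y i - (/ INR (S i) - ln_step i)) X <= 0).
  { induction X as [|X IH]; [simpl; lra|]. rewrite rsum_S.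
    assert (H := rdefect_bounds y X Hy).
    change (rbose (rnode y X) - / rnode y X) with (h X) in H.
    change (rbose (rnode y (S X)) - / rnode y (S X)) with (h (S X)) in H. lra. }
  assert (H0 := Hh O). assert (HX := Hh X).
  assert (y * -1 <= y * (h O - h X)) by (apply Rmult_le_compat_l; lra).
  apply Rabs_le. lra. }
apply (is_lim_seq_le _ (fun _ => y) (Rabs (Series (rdefect y) - euler_gamma)) y HB);
  [|apply is_lim_seq_const].
apply (is_lim_seq_abs _ (Finite _)), is_lim_seq_minus'; [exact HS | apply gamma_seq_lim].
Qed.

Lemma rlog_minus_ln_bounds (y : R) (n : nat) : 0 < y <= 1 ->
  -1 <= rlog (rnode y n) - ln y <= ln (INR (S n)).
Proof.
intros Hy. assert (Hx := rnode_pos y n (proj1 Hy)).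
assert (H := rlog_ln_bounds _ Hx). rewrite ln_rnode in H by lra.
split; [|lra].
assert (H0 := rlog_ln_bounds y (proj1 Hy)).
assert (Hm : rlog y <= rlog (rnode y n)).
{ assert (Hle : y <= rnode y n) by (unfold rnode; generalize (INR_S_ge1 n); nra).
  destruct (rlog_MVT y (rnode y n) ltac:(lra)) as (u & Hu & E).
  assert (Hb := rbose_pos u ltac:(lra)).
  assert (0 <= rbose u * (rnode y n - y)) by (apply Rmult_le_pos; lra). lra. }
lra.
Qed.

Lemma rlog_minus_ln_lim (y : R) (n : nat) : 0 < y ->
  Rabs (rlog (rnode y n) - ln y - ln (INR (S n))) <= INR (S n) * y.
Proof.
intros Hy. assert (H := rlog_ln_bounds _ (rnode_pos y n Hy)). rewrite ln_rnode in H by exact Hy.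
unfold rnode in *. apply Rabs_le. lra.
Qed.

(** The rest of [(ln n - H_(n-1) - rlog) * rweight] once telescoping parts and multiples of
    [rdefect] are removed. With the weight split into step and defect, [- rlog * rstep] is half a
    decrement of [rlog^2] plus [rstep^2 / 2]. Subtracting [ln y] from [rlog] keeps the term bounded
    as [y] tends to 0. *)
Definition main_term (y : R) (n : nat) : R :=
  rstep y n ^ 2 / 2 - (rlog (rnode y n) - ln y) * rdefect y n
  + (euler_gamma - gamma_seq n) * rweight y n.

(** In units of the inverse square, the three parts of [main_term] are at most [1/2], [1 + ln n] and
    [1]; [3 + ln n] majorizes their sum. *)
Definition main_bound (n : nat) : R := (3 + ln (INR (S n))) / INR (S n) ^ 2.

Lemma main_term_bound (y : R) (n : nat) : 0 < y <= 1 -> Rabs (main_term y n) <= main_bound n.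
Proof.
intros Hy. unfold main_term, main_bound.
assert (H1 := rstep_bounds y n (proj1 Hy)). assert (H2 := rweight_bounds y n (proj1 Hy)).
assert (H3 := rdefect_range y n (proj1 Hy)). assert (H4 := rlog_minus_ln_bounds y n Hy).
assert (H5 := gamma_seq_error n). assert (Hl := ln_ge_0 _ (INR_S_ge1 n)).
assert (Hn := INR_S_pos n).
set (d := rstep y n) in *. set (w := rweight y n) in *. set (D := rdefect y n) in *.
set (a := rlog (rnode y n) - ln y) in *. set (e := euler_gamma - gamma_seq n) in *.
set (l := ln (INR (S n))) in *.
replace (/ INR (S n) ^ 2) with (/ INR (S n) * / INR (S n)) in H3 by (field; lra).
unfold Rdiv. replace (/ INR (S n) ^ 2) with (/ INR (S n) * / INR (S n)) by (field; lra).
set (i := / INR (S n)) in *.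
assert (Hd : 0 <= d ^ 2 <= i * i) by nra.
assert (He : 0 <= e * w <= i * i) by nra.
assert (Ha : - ((1 + l) * (i * i)) <= a * D <= (1 + l) * (i * i)) by nra.
apply Rabs_le. lra.
Qed.

Lemma main_bound_ex : ex_series main_bound.
Proof.
apply (ex_series_ext (fun n => 3 * / INR (S n) ^ 2 + ln (INR (S n)) / INR (S n) ^ 2)).
{ intros n. unfold main_bound, Rdiv. match goal with |- @eq _ ?a ?b => change (@eq R a b) end. ring. }
apply (ex_series_plus (fun n => 3 * / INR (S n) ^ 2)).
{ apply (ex_series_scal_l 3 (fun n => / INR (S n) ^ 2)), ex_series_inv_sqr. }
(* [- (ln x + 1) / x] is an antiderivative of [ln x / x^2]; the factor 2 below pays for
   [x * (x + 1)] in place of [x^2]. *)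
set (f := fun n => (ln (INR (S n)) + 1) / INR (S n)).
apply (ex_series_le (fun n => ln (INR (S n)) / INR (S n) ^ 2) (fun n => 2 * (f n - f (S n)))).
- intros n. change (norm ?a) with (Rabs a).
  assert (Hn := INR_S_ge1 n). assert (Hl := ln_ge_0 _ Hn).
  assert (HI := ln_incr_bounds _ (INR_S_pos n)). unfold f. rewrite (S_INR (S n)).
  set (x := INR (S n)) in *. set (l := ln x) in *. set (l' := ln (x + 1)) in *.
  assert (Hx2 : 0 < x ^ 2) by (apply pow_lt; lra).
  rewrite Rabs_pos_eq by (apply Rmult_le_pos; [lra | left; now apply Rinv_0_lt_compat]).
  apply Rle_trans with (2 * (l / (x * (x + 1)))).
  + replace (l / x ^ 2) with (l * (2 * / (2 * x ^ 2))) by (field; lra).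
    replace (2 * (l / (x * (x + 1)))) with (l * (2 * / (x * (x + 1)))) by (field; lra).
    apply Rmult_le_compat_l; [exact Hl|]. apply Rmult_le_compat_l; [lra|].
    apply Rinv_le_contravar; nra.
  + apply Rmult_le_compat_l; [lra|].
    replace (l / (x * (x + 1))) with ((l + 1) / x - (l + / x + 1) / (x + 1)) by (field; lra).
    assert ((l' + 1) / (x + 1) <= (l + / x + 1) / (x + 1)); [|lra].
    apply Rmult_le_compat_r; [left; apply Rinv_0_lt_compat; lra | lra].
- exists (2 * (f O - 0)). apply (is_series_scal_l 2 (fun n => f n - f (S n)) (f O - 0)).
  apply is_series_rsum.
  apply (is_lim_seq_ext (fun X => f O - f X)).
  { intros X. rewrite (rsum_ext _ (fun i => (- f (S i)) - (- f i))) by (intros; ring).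
    rewrite (rsum_telescope (fun i => - f i)). ring. }
  apply is_lim_seq_minus'; [apply is_lim_seq_const|].
  apply (is_lim_seq_ext (fun X => - (/ INR (S X) * ln (/ INR (S X))) + / INR (S X))).
  { intros X. unfold f. rewrite ln_Rinv by apply INR_S_pos. unfold Rdiv. ring. }
  replace (Finite 0) with (Finite (- 0 + 0)) by (f_equal; ring).
  apply is_lim_seq_plus'; [|apply is_lim_seq_inv_INR_S].
  apply (proj1 (is_lim_seq_opp _ (Finite 0))), inv_ln_inv_lim.
Qed.

Lemma main_term_ex (y : R) : 0 < y <= 1 -> ex_series (main_term y).
Proof.
intros Hy. apply (ex_series_le (main_term y) main_bound); [|apply main_bound_ex].
intros n. now apply main_term_bound.
Qed.

Definition rlambert (y : R) : R := Series (fun n => ln (INR (S n)) * rbose (rnode y n)).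

Lemma rlambert_ex (y : R) : 0 < y -> ex_series (fun n => ln (INR (S n)) * rbose (rnode y n)).
Proof.
intros Hy. apply (ex_series_le_inv_sqr _ (6 / y ^ 3)). intros n.
assert (Hn := INR_S_pos n). assert (Hx := rnode_pos y n Hy).
assert (H := rbose_pow_bound 2 _ Hx). assert (Hp := rbose_pos _ Hx).
assert (HH := ln_ge_0 _ (INR_S_ge1 n)). assert (HL := ln_le_self _ Hn).
rewrite Rabs_pos_eq by (apply Rmult_le_pos; lra).
apply Rle_trans with (INR (S n) * (INR (fact 3) / (rnode y n) ^ 3)).
- apply Rmult_le_compat; lra.
- right. unfold rnode. replace (INR (fact 3)) with 6 by (simpl; ring). field. lra.
Qed.

(* Split [ln n = H_(n-1) - gamma + error], invert the double sum for the harmonic part, and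
   compare [y / (e^(n y) - 1)] with the increments of [ln (1 - e^(-n y))]. *)
Lemma rlambert_identity (y : R) : 0 < y <= 1 ->
  y * rlambert y = rlog y ^ 2 / 2 + euler_gamma * rlog y + Series (main_term y)
    - (ln y + euler_gamma) * Series (rdefect y).
Proof.
intros Hy.
assert (H1 := Series_correct _ (rlambert_ex y (proj1 Hy))).
assert (H2 := Series_correct _ (harmonic_rbose_ex y (proj1 Hy))).
assert (H3 := harmonic_rbose_series y (proj1 Hy)).
assert (H4 := Series_correct _ (main_term_ex y Hy)).
assert (H5 := Series_correct _ (rdefect_ex y (proj1 Hy))).
fold (rlambert y) in H1. set (A := Series (fun n => harmonic n * rbose (INR (S n) * y))) in *.
set (T := Series (main_term y)) in *. set (D := Series (rdefect y)) in *.
assert (H6 : is_series (fun n => (rlog (rnode y n) ^ 2 / 2 + euler_gamma * rlog (rnode y n))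
   - (rlog (rnode y (S n)) ^ 2 / 2 + euler_gamma * rlog (rnode y (S n))))
   (rlog y ^ 2 / 2 + euler_gamma * rlog y)).
{ set (f := fun n => rlog (rnode y n) ^ 2 / 2 + euler_gamma * rlog (rnode y n)).
  apply is_series_rsum. apply (is_lim_seq_ext (fun X => f O - f X)).
  - intros X. rewrite (rsum_ext _ (fun i => (- f (S i)) - (- f i))) by (intros; unfold f; ring).
    rewrite (rsum_telescope (fun i => - f i)). ring.
  - assert (H0 := rlog_lim_infinity y (proj1 Hy)).
    replace (rlog y ^ 2 / 2 + euler_gamma * rlog y) with (f O - (0 * 0 * / 2 + euler_gamma * 0)).
    + apply is_lim_seq_minus'; [apply is_lim_seq_const|].
      apply (is_lim_seq_ext (fun n => rlog (INR (S n) * y) * rlog (INR (S n) * y) * / 2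
        + euler_gamma * rlog (INR (S n) * y))).
      { intros n. unfold f, rnode. field. }
      apply is_lim_seq_plus'; apply is_lim_seq_mult'; try apply is_lim_seq_const; try exact H0.
      now apply is_lim_seq_mult'.
    + unfold f, rnode. simpl (INR 1). rewrite Rmult_1_l. field. }
(* [A] is subtracted as the harmonic series and added back in the form of [harmonic_rbose_series],
   which exchanges the harmonic weights for [- rlog]. *)
assert (HL : is_series (fun n => y * (ln (INR (S n)) * rbose (rnode y n) - harmonic n * rbose (INR (S n) * y)
    + - rlog (INR (S n) * y) * rbose (INR (S n) * y))) (y * (rlambert y - A + A))).
{ apply (is_series_scal y (fun n => ln (INR (S n)) * rbose (rnode y n) - harmonic n * rbose (INR (S n) * y)
    + - rlog (INR (S n) * y) * rbose (INR (S n) * y)) (rlambert y - A + A)).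
  apply (is_series_plus (fun n => ln (INR (S n)) * rbose (rnode y n) - harmonic n * rbose (INR (S n) * y)));
    [|exact H3].
  now apply (is_series_minus (fun n => ln (INR (S n)) * rbose (rnode y n))). }
assert (HR : is_series (fun n => ((rlog (rnode y n) ^ 2 / 2 + euler_gamma * rlog (rnode y n))
   - (rlog (rnode y (S n)) ^ 2 / 2 + euler_gamma * rlog (rnode y (S n)))) + main_term y n
   - (ln y + euler_gamma) * rdefect y n)
   (rlog y ^ 2 / 2 + euler_gamma * rlog y + T - (ln y + euler_gamma) * D)).
{ apply (is_series_minus (fun n => ((rlog (rnode y n) ^ 2 / 2 + euler_gamma * rlog (rnode y n))
   - (rlog (rnode y (S n)) ^ 2 / 2 + euler_gamma * rlog (rnode y (S n)))) + main_term y n)).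
  - now apply (is_series_plus (fun n => (rlog (rnode y n) ^ 2 / 2 + euler_gamma * rlog (rnode y n))
      - (rlog (rnode y (S n)) ^ 2 / 2 + euler_gamma * rlog (rnode y (S n))))).
  - now apply (is_series_scal (ln y + euler_gamma) (rdefect y)). }
replace (y * rlambert y) with (y * (rlambert y - A + A)) by ring.
rewrite <- (is_series_unique _ _ HL), <- (is_series_unique _ _ HR).
apply Series_ext. intros n.
unfold main_term, rdefect, rstep, rweight, gamma_seq. fold (rnode y n). field.
Qed.

Definition main_term_0 (n : nat) : R :=
  ln_step n ^ 2 / 2 - ln (INR (S n)) * (/ INR (S n) - ln_step n)
  + (euler_gamma - gamma_seq n) * / INR (S n).

Lemma main_term_lim (n : nat) : is_lim_seq (fun j => main_term (/ INR (S j)) n) (main_term_0 n).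
Proof.
assert (Hw : is_lim_seq (fun j => rweight (/ INR (S j)) n) (/ INR (S n))).
{ apply (is_lim_seq_ext (fun j => (rweight (/ INR (S j)) n - / INR (S n)) + / INR (S n))); [intros; ring|].
  replace (Finite (/ INR (S n))) with (Finite (0 + / INR (S n))) by (f_equal; ring).
  apply is_lim_seq_plus'; [|apply is_lim_seq_const].
  apply (is_lim_seq_zero _ _ is_lim_seq_inv_INR_S). intros j. apply rweight_lim, inv_INR_S_range. }
assert (HL : forall m, is_lim_seq (fun j => rlog (rnode (/ INR (S j)) m) - ln (/ INR (S j))) (ln (INR (S m)))).
{ intros m. set (L := ln (INR (S m))).
  apply (is_lim_seq_ext (fun j => (rlog (rnode (/ INR (S j)) m) - ln (/ INR (S j)) - L) + L)); [intros; ring|].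
  replace (Finite L) with (Finite (0 + L)) by (f_equal; ring).
  apply is_lim_seq_plus'; [|apply is_lim_seq_const].
  apply (is_lim_seq_zero _ _ (is_lim_seq_cst_inv (INR (S m)))). intros j.
  apply rlog_minus_ln_lim, inv_INR_S_range. }
assert (Hd : is_lim_seq (fun j => rstep (/ INR (S j)) n) (ln_step n)).
{ apply (is_lim_seq_ext (fun j => (rlog (rnode (/ INR (S j)) (S n)) - ln (/ INR (S j))) -
    (rlog (rnode (/ INR (S j)) n) - ln (/ INR (S j))))); [intros; unfold rstep; ring|].
  apply is_lim_seq_minus'; apply HL. }
unfold main_term, main_term_0. apply is_lim_seq_plus'.
- apply is_lim_seq_minus'.
  + apply (is_lim_seq_ext (fun j => rstep (/ INR (S j)) n * rstep (/ INR (S j)) n * / 2)); [intros; field|].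
    replace (ln_step n ^ 2 / 2) with (ln_step n * ln_step n * / 2) by field.
    apply is_lim_seq_mult'; [now apply is_lim_seq_mult' | apply is_lim_seq_const].
  + apply is_lim_seq_mult'; [apply HL|]. unfold rdefect. now apply is_lim_seq_minus'.
- apply is_lim_seq_mult'; [apply is_lim_seq_const | exact Hw].
Qed.

(** The increments of [gamma_seq] are [/ INR (S n) - ln_step n]; in these terms [main_term_0] is
    half an inverse square plus an increment of a quadratic expression in [gamma_seq] and [ln]. *)
Lemma main_term_0_partial (X : nat) : rsum main_term_0 X =
  euler_gamma ^ 2 / 2 + rsum (fun n => / INR (S n) ^ 2) X / 2
  - (gamma_seq X - euler_gamma) * (gamma_seq X - euler_gamma + 2 * ln (INR (S X))) / 2.
Proof.
induction X as [|X IH].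
- unfold gamma_seq. simpl. rewrite harmonic_0, ln_1. field.
- rewrite !rsum_S, IH. unfold main_term_0, gamma_seq, ln_step. rewrite harmonic_S.
  assert (Hn := INR_S_pos X). field. lra.
Qed.

(** The quadratic expression vanishes at infinity because the error of [gamma_seq] is [O(1 / n)]
    against [ln n]; [PI^2 / 12] is half the sum of inverse squares. *)
Lemma main_term_0_sum : Series main_term_0 = euler_gamma ^ 2 / 2 + PI ^ 2 / 12.
Proof.
apply is_series_unique, is_series_rsum.
apply (is_lim_seq_ext _ _ _ (fun X => eq_sym (main_term_0_partial X))).
replace (euler_gamma ^ 2 / 2 + PI ^ 2 / 12) with (euler_gamma ^ 2 / 2 + inv_sqr_sum * / 2 - 0)
  by (rewrite basel; field).
apply is_lim_seq_minus'.
- apply is_lim_seq_plus'; [apply is_lim_seq_const|].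
  apply is_lim_seq_mult'; [apply inv_sqr_sum_lim | apply is_lim_seq_const].
- apply (is_lim_seq_zero _ (fun X => / INR (S X) - / INR (S X) * ln (/ INR (S X)))).
  + replace (Finite 0) with (Finite (0 - 0)) by (f_equal; ring).
    apply is_lim_seq_minus'; [apply is_lim_seq_inv_INR_S | apply inv_ln_inv_lim].
  + intros X. rewrite ln_Rinv by apply INR_S_pos.
    assert (H := gamma_seq_error X). assert (Hl := ln_ge_0 _ (INR_S_ge1 X)).
    assert (Hr := inv_INR_S_range X).
    set (i := / INR (S X)) in *. set (l := ln (INR (S X))) in *.
    replace (gamma_seq X - euler_gamma) with (- (euler_gamma - gamma_seq X)) by ring.
    set (e := euler_gamma - gamma_seq X) in *.
    apply Rabs_le. nra.
Qed.

(** In [rlambert_identity], [rlog y] is [ln y + O(y)] and the total defect is [euler_gamma + O(y)].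
    The terms [euler_gamma * ln y] cancel, and [euler_gamma^2] is subtracted from the limit of the
    series of [main_term]. *)
Lemma rlambert_constant :
  is_lim_seq (fun j => / INR (S j) * rlambert (/ INR (S j)) - ln (/ INR (S j)) ^ 2 / 2)
    (PI ^ 2 / 12 - euler_gamma ^ 2 / 2).
Proof.
assert (HT : is_lim_seq (fun j => Series (main_term (/ INR (S j)))) (Series main_term_0)).
{ apply (dominated_series_lim _ _ main_bound); [|apply main_bound_ex | apply main_term_lim].
  intros j n. apply main_term_bound, inv_INR_S_range. }
rewrite main_term_0_sum in HT.
assert (HD : is_lim_seq (fun j => Series (rdefect (/ INR (S j))) - euler_gamma) 0).
{ apply (is_lim_seq_zero _ _ is_lim_seq_inv_INR_S). intros j. apply rdefect_sum, inv_INR_S_range. }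
assert (HlD : is_lim_seq (fun j => ln (/ INR (S j)) * (Series (rdefect (/ INR (S j))) - euler_gamma)) 0).
{ apply (is_lim_seq_zero _ (fun j => Rabs (/ INR (S j) * ln (/ INR (S j))))).
  - rewrite <- Rabs_R0. apply (is_lim_seq_abs _ (Finite 0)), inv_ln_inv_lim.
  - intros j. assert (H := rdefect_sum _ (proj1 (inv_INR_S_range j))).
    rewrite !Rabs_mult, (Rabs_pos_eq (/ INR (S j))) by (generalize (inv_INR_S_range j); lra).
    rewrite Rmult_comm. apply Rmult_le_compat_r; [apply Rabs_pos | exact H]. }
assert (HE : is_lim_seq (fun j => rlog (/ INR (S j)) - ln (/ INR (S j))) 0).
{ apply (is_lim_seq_zero _ _ is_lim_seq_inv_INR_S). intros j.
  assert (H := rlog_ln_bounds _ (proj1 (inv_INR_S_range j))). apply Rabs_le.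
  generalize (inv_INR_S_range j); lra. }
assert (HlE : is_lim_seq (fun j => (rlog (/ INR (S j)) - ln (/ INR (S j))) * ln (/ INR (S j))) 0).
{ apply (is_lim_seq_zero _ (fun j => Rabs (/ INR (S j) * ln (/ INR (S j))))).
  - rewrite <- Rabs_R0. apply (is_lim_seq_abs _ (Finite 0)), inv_ln_inv_lim.
  - intros j. assert (H := rlog_ln_bounds _ (proj1 (inv_INR_S_range j))).
    rewrite !Rabs_mult. apply Rmult_le_compat_r; [apply Rabs_pos|].
    rewrite (Rabs_pos_eq (/ INR (S j))) by (generalize (inv_INR_S_range j); lra).
    apply Rabs_le. generalize (inv_INR_S_range j); lra. }
apply (is_lim_seq_ext (fun j =>
  (rlog (/ INR (S j)) - ln (/ INR (S j))) * (rlog (/ INR (S j)) - ln (/ INR (S j))) * / 2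
  + (rlog (/ INR (S j)) - ln (/ INR (S j))) * ln (/ INR (S j))
  + euler_gamma * (rlog (/ INR (S j)) - ln (/ INR (S j)))
  + Series (main_term (/ INR (S j)))
  - ln (/ INR (S j)) * (Series (rdefect (/ INR (S j))) - euler_gamma)
  - euler_gamma * (Series (rdefect (/ INR (S j))) - euler_gamma) - euler_gamma ^ 2)).
{ intros j. rewrite rlambert_identity by apply inv_INR_S_range. field. }
replace (PI ^ 2 / 12 - euler_gamma ^ 2 / 2) with
  (0 * 0 * / 2 + 0 + euler_gamma * 0 + (euler_gamma ^ 2 / 2 + PI ^ 2 / 12) - 0
   - euler_gamma * 0 - euler_gamma ^ 2) by field.
repeat (apply is_lim_seq_minus' || apply is_lim_seq_plus'); try apply is_lim_seq_const; try assumption.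
- apply is_lim_seq_mult'; [now apply is_lim_seq_mult' | apply is_lim_seq_const].
- apply is_lim_seq_mult'; [apply is_lim_seq_const | exact HE].
- apply is_lim_seq_mult'; [apply is_lim_seq_const | exact HD].
Qed.

Lemma lambert_log_real (y : R) : 0 < y -> lambert_log (RtoC y) = RtoC (rlambert y).
Proof.
intros Hy.
assert (E : forall n, lambert_log_term (RtoC y) (S n) = RtoC (ln (INR (S n)) * rbose (rnode y n))).
{ intros n. rewrite lambert_log_term_bose, RtoC_mult. f_equal. unfold bose, rbose.
  rewrite <- RtoC_mult, Cexp_RtoC, <- RtoC_minus.
  assert (H := exp_minus_1_pos _ (rnode_pos y n Hy)). rewrite RtoC_inv; [reflexivity|].
  unfold rnode in *. lra. }
apply C_ext.
- apply Series_ext. intros n. now rewrite E.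
- change (Series (fun n => Im (lambert_log_term (RtoC y) (S n))) = 0).
  rewrite (Series_ext _ (fun _ => 0 * 0)).
  + rewrite Series_scal_l. ring.
  + intros n. rewrite E. simpl. ring.
Qed.

(** * Assembling the expansion *)

Definition leading_const : R := PI ^ 2 / 12 - euler_gamma ^ 2 / 2.

Lemma lambert_reg_real_lim (M : nat) : is_lim_seq (fun j =>
  Cmod (lambert_reg M (lambert_log (RtoC (/ INR (S j)))) (RtoC (/ INR (S j))) - RtoC leading_const)%C) 0.
Proof.
set (r := fun j => / INR (S j) * rlambert (/ INR (S j)) - ln (/ INR (S j)) ^ 2 / 2
  - rsum (fun k => bern_fact (S k) * pow_ln_const k * (/ INR (S j)) ^ S k) M).
assert (Hr : is_lim_seq r leading_const).
{ replace leading_const with (leading_const - rsum (fun k => bern_fact (S k) * pow_ln_const k * 0 ^ S k) M).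
  - apply is_lim_seq_minus'; [apply rlambert_constant|].
    apply is_lim_seq_rsum. intros k _. apply is_lim_seq_mult'; [apply is_lim_seq_const|].
    generalize (S k); intros d. induction d as [|d IH]; simpl; [apply is_lim_seq_const|].
    apply is_lim_seq_mult'; [apply is_lim_seq_inv_INR_S | exact IH].
  - rewrite rsum_0; [ring|]. intros k _. rewrite pow_i by lia. ring. }
apply (is_lim_seq_ext (fun j => Rabs (r j - leading_const))).
- intros j. assert (Hj := proj1 (inv_INR_S_range j)).
  rewrite lambert_log_real by exact Hj. rewrite <- Cmod_R, RtoC_minus. f_equal. f_equal.
  unfold r, lambert_reg. rewrite Clog_RtoC by exact Hj.
  rewrite (csum_ext _ (fun k => RtoC (bern_fact (S k) * pow_ln_const k * (/ INR (S j)) ^ S k))).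
  + rewrite csum_RtoC, !RtoC_minus, RtoC_mult. f_equal. f_equal.
    rewrite RtoC_div by lra. f_equal. rewrite <- RtoC_mult. f_equal. ring.
  + intros k _. now rewrite <- RtoC_pow, <- RtoC_mult.
- rewrite <- Rabs_R0. apply (is_lim_seq_abs _ (Finite 0)).
  replace (Finite 0) with (Finite (leading_const - leading_const)) by (f_equal; ring).
  apply is_lim_seq_minus'; [exact Hr | apply is_lim_seq_const].
Qed.

(** The value at [y] is compared with the value at a small positive real point, which lies in every
    cone with [c <= 1]. With [rho = Cmod y] and a chord of length at most [2 * Cmod y], the
    Lipschitz bound gives the last power. *)
Lemma lambert_reg_bound (c : R) (M : nat) : 0 < c <= 1 -> exists K, 0 <= K /\
  forall y, cone c y -> Cmod y <= 1 ->
  Cmod (lambert_reg M (lambert_log y) y - RtoC leading_const)%C <= K * Cmod y ^ S M.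
Proof.
intros Hc. destruct (lambert_reg_lipschitz c M (proj1 Hc)) as (K & HK & H).
exists (2 * K); split; [lra|]. intros y Hy Hy1.
assert (Hm : 0 < Cmod y) by (apply Cmod_gt_0, Hy).
apply Rle_eps. intros eps He.
destruct (is_lim_seq_small _ _ eps (lambert_reg_real_lim M) He) as [N1 HN1].
destruct (is_lim_seq_small _ _ (Cmod y) is_lim_seq_inv_INR_S Hm) as [N2 HN2].
set (j := (N1 + N2)%nat).
specialize (HN1 j ltac:(unfold j; lia)). specialize (HN2 j ltac:(unfold j; lia)).
assert (Hj := inv_INR_S_range j). set (e := / INR (S j)) in *.
rewrite Rminus_0_r in HN1, HN2. rewrite Rabs_pos_eq in HN1 by apply Cmod_ge_0.
rewrite Rabs_pos_eq in HN2 by lra.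
assert (Hme : Cmod (RtoC e) = e) by (rewrite Cmod_R, Rabs_pos_eq; lra).
assert (Hce : cone c (RtoC e)).
{ split; [intros E; apply RtoC_inj in E; lra|]. rewrite Hme. simpl. nra. }
assert (HL := H (Cmod y) (RtoC e) y Hy1 Hce Hy ltac:(lra) (Rle_refl _)).
assert (Hd : Cmod (y - RtoC e) <= 2 * Cmod y).
{ eapply Rle_trans; [apply Cmod_triangle|]. rewrite Cmod_opp. lra. }
assert (HL2 : K * Cmod y ^ M * Cmod (y - RtoC e) <= 2 * K * Cmod y ^ S M).
{ replace (2 * K * Cmod y ^ S M) with (K * Cmod y ^ M * (2 * Cmod y)) by (simpl; ring).
  apply Rmult_le_compat_l; [|exact Hd]. apply Rmult_le_pos; [lra | apply pow_le; lra]. }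
set (W := lambert_reg M (lambert_log y) y) in *.
set (We := lambert_reg M (lambert_log (RtoC e)) (RtoC e)) in *.
replace (W - RtoC leading_const)%C with ((W - We) + (We - RtoC leading_const))%C by ring.
eapply Rle_trans; [apply Cmod_triangle|]. lra.
Qed.

(** The upper index [2 * N + 1] admits one power more than the expansion shows, with an odd
    Bernoulli number as coefficient, hence 0. This free term brings the error of [y S] to order
    [2 * N + 2], that is [2 * N + 1] after division by [y]. *)
Lemma reg_sum_expansion (N : nat) (y : C) : (1 <= N)%nat ->
  csum (fun k => RtoC (bern_fact (S k) * pow_ln_const k) * y ^ S k)%C (2 * N + 1)
  = (y * (- RtoC (1 / 4 * ln (2 * PI)) + y / 12 * RtoC (ln glaisher - 1 / 12) +
     sum_n_m (fun k => RtoC (lambert_log_coeff k) * y ^ (2 * k - 1))%C 2 N))%C.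
Proof.
induction N as [|N IH]; intros HN; [lia|].
destruct (Nat.eq_dec N 0) as [->|Hne].
- rewrite sum_n_m_zero by lia. change (@zero C_AbelianMonoid) with (RtoC 0).
  change (2 * 1 + 1)%nat with 3%nat. simpl csum.
  replace (bern_fact 3) with 0 by (symmetry; apply (bern_fact_odd 1); lia).
  rewrite bern_fact_1, bern_fact_2, pow_ln_const_0, ln_glaisher.
  replace (- (1 / 2) * (ln (2 * PI) / 2)) with (- (1 / 4 * ln (2 * PI))) by field.
  replace (pow_ln_const 1 + 1 / 12 - 1 / 12) with (pow_ln_const 1) by ring.
  rewrite RtoC_opp, Rmult_0_l, (RtoC_mult (1 / 12)), (RtoC_div 1 12) by lra. field.
- rewrite sum_n_Sm by lia. change (plus ?a ?b) with (a + b)%C.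
  replace (2 * S N + 1)%nat with (S (S (2 * N + 1))) by lia.
  rewrite !csum_S, IH by lia.
  replace (S (S (2 * N + 1))) with (2 * S N + 1)%nat by lia.
  rewrite bern_fact_odd by lia. rewrite Rmult_0_l.
  replace (S (2 * N + 1)) with (2 * S N)%nat by lia.
  replace (2 * N + 1)%nat with (2 * S N - 1)%nat by lia.
  rewrite lambert_log_coeff_pow_ln by lia.
  replace (y ^ (2 * S N))%C with (y * y ^ (2 * S N - 1))%C.
  + ring.
  + rewrite <- Cpow_S. f_equal. lia.
Qed.

Lemma lambert_reg_expansion (N : nat) (y : C) : (1 <= N)%nat -> y <> RtoC 0 ->
  (lambert_log y - lambert_log_expansion N y)%C =
  ((lambert_reg (2 * N + 1) (lambert_log y) y - RtoC leading_const) / y)%C.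
Proof.
intros HN Hy. unfold lambert_reg, lambert_log_expansion. rewrite reg_sum_expansion by exact HN.
fold leading_const. field. exact Hy.
Qed.

Lemma Rabs_Carg (y : C) : Rabs (Carg y) = acos (Re y / Cmod y).
Proof.
assert (H := acos_bound (Re y / Cmod y)). unfold Carg.
destruct (Rle_dec 0 (Im y)); [|rewrite Rabs_Ropp]; apply Rabs_pos_eq; lra.
Qed.

Lemma cos_Carg (y : C) : y <> RtoC 0 -> Cmod y * cos (Rabs (Carg y)) = fst y.
Proof.
intros Hy. assert (Hm := proj1 (Cmod_gt_0 y) Hy). rewrite Rabs_Carg, cos_acos.
- unfold Re. field. lra.
- assert (H := Rabs_fst_le_Cmod y). apply Rabs_le_between in H. unfold Re.
  split; apply (Rmult_le_reg_r (Cmod y)); try exact Hm;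
    unfold Rdiv; rewrite ?Rmult_assoc, ?Rinv_l by lra; lra.
Qed.

Theorem theorem1p2 :
  (forall y : C, y <> RtoC 0 -> Rabs (Carg y) < PI / 2 ->
     is_series (K := C_AbsRing) (V := C_NormedModule)
       (fun n => lambert_log_term y (S n)) (lambert_log y)) /\
  (forall (theta : R) (N : nat), theta < PI / 2 -> (1 <= N)%nat ->
     exists K delta : R, 0 < delta /\
       forall y : C, y <> RtoC 0 -> Rabs (Carg y) <= theta -> Cmod y < delta ->
         Cmod (lambert_log y - lambert_log_expansion N y)%C
           <= K * Cmod y ^ (2 * N + 1)).
Proof.
split.
- intros y Hy Harg. apply lambert_log_is_series. rewrite <- (cos_Carg y Hy).
  apply Rmult_lt_0_compat; [now apply Cmod_gt_0|].
  apply cos_gt_0; [generalize (Rabs_pos (Carg y)) PI_RGT_0; lra | exact Harg].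
- intros theta N Htheta HN. assert (HP := PI_RGT_0).
  (* For negative [theta] the sector is empty. *)
  destruct (Rlt_le_dec theta 0) as [Hneg|Hpos].
  { exists 0, 1. split; [lra|]. intros y _ Harg. generalize (Rabs_pos (Carg y)); lra. }
  assert (Hc : 0 < cos theta <= 1) by (split; [apply cos_gt_0; lra | apply COS_bound]).
  destruct (lambert_reg_bound (cos theta) (2 * N + 1) Hc) as (K & HK & H).
  exists K, 1. split; [lra|]. intros y Hy Harg Hy1.
  assert (Hm := proj1 (Cmod_gt_0 y) Hy).
  (* The sector is the cone with [c = cos theta], as cosine decreases on [[0, PI]]. *)
  assert (Hcone : cone (cos theta) y).
  { split; [exact Hy|]. rewrite <- (cos_Carg y Hy), Rmult_comm.
    apply Rmult_le_compat_l; [lra|].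
    apply cos_decr_1; generalize (Rabs_pos (Carg y)); lra. }
  rewrite lambert_reg_expansion, Cmod_div by assumption.
  apply (Rmult_le_reg_r (Cmod y)); [exact Hm|].
  unfold Rdiv. rewrite !Rmult_assoc, Rinv_l, Rmult_1_r by lra.
  replace (Cmod y ^ (2 * N + 1) * Cmod y) with (Cmod y ^ S (2 * N + 1)) by (simpl; ring).
  apply H; [exact Hcone | lra].
Qed.
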